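(* Let $\alpha>0$, let $d\ge 1$ be an integer with $d>2(\alpha\wedge 2)$, and let $h$ be as in the context. There is $L_0$ (depending on $d,\alpha,h$) such that for all $L\ge L_0$ the following holds for self-avoiding walk with step distribution $D(x)=h(x/L)/\sum_{y\in\mathbb{Z}^d}h(y/L)$. For every $r\in(0,\alpha\wedge2)$, the mean-$r$ displacement $$\xi^{(r)}(n):=\left(\frac{\sum_{x\in\mathbb{Z}^d}|x|^r c_n(x)}{c_n}\right)^{1/r}$$ satisfies, as $n\to\infty$, $$\xi^{(r)}(n)\asymp\begin{cases}n^{1/(\alpha\wedge2)},&\text{if }\alpha\ne2,\\ (n\log n)^{1/2},&\text{if }\alpha=2,\end{cases}$$ where $a(n)\asymp b(n)$ as $n\to\infty$ means that there are constants $0<c\le C<\infty$, not depending on $n$, with $c\,b(n)\le a(n)\le C\,b(n)$ for all sufficiently large $n$.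
   Context: Notation: $a\wedge b=\min\{a,b\}$; $|\cdot|$ is the Euclidean norm on $\mathbb{R}^d$. Step distribution. $h$ is a non-negative bounded function on $\mathbb{R}^d$, almost everywhere continuous, symmetric under reflections in coordinate hyperplanes and rotations by ninety degrees, with $h(x)\sim c_h|x|^{-d-\alpha}$ as $|x|\to\infty$ for some constant $c_h>0$ (ratio tends to 1). If $\alpha\le 2$, $h$ is moreover assumed to be completely rotation invariant on $\mathbb{R}^d$. For a spread-out parameter $L\ge1$, $D(x)=h(x/L)/\sum_{y\in\mathbb{Z}^d}h(y/L)$, $x\in\mathbb{Z}^d$. It is assumed that $D(0)=0$. Self-avoiding walk. $\mathcal W_n(x)$ is the set of $(w_0,\dots,w_n)$ with $w_i\in\mathbb{Z}^d$, $w_0=0$, $w_n=x$; $w$ is self-avoiding if $w_i\ne w_j$ for $i\ne j$. $c_0(x)=\delta_{0,x}$ and, for $n\ge1$, $c_n(x)=\sum_{w\in\mathcal W_n(x)}\prod_{i=1}^nD(w_i-w_{i-1})\mathbf 1\{w\text{ is self-avoiding}\}$. $c_n=\sum_{x\in\mathbb{Z}^d}c_n(x)$. *)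

(* Defs.v *)
From HB Require Import structures.
From mathcomp Require Import all_boot all_order all_algebra.
From mathcomp Require Import all_classical all_reals all_analysis.
Set Implicit Arguments.
Unset Strict Implicit.
Unset Printing Implicit Defensive.
Import Order.TTheory GRing.Theory Num.Theory.
Import numFieldNormedType.Exports.
Local Open Scope classical_set_scope.
Local Open Scope ring_scope.

(* The library norm on 'rV[R]_d is the sup norm, hence this definition. *)
Definition enorm (R : realType) (d : nat) (x : 'rV[R]_d) : R :=
  Num.sqrt (\sum_(i < d) x 0 i ^+ 2).

(* The neighbourhoods of |x| = +oo in R^d. *)
Definition enorm_infty (R : realType) (d : nat) : set_system 'rV[R]_d :=
  [set A | \forall M \near +oo, [set x | M <= enorm x] `<=` A].

Definition box (R : realType) (d : nat) (lo hi : 'rV[R]_d) : set 'rV[R]_d :=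
  [set x | forall i, lo 0 i <= x 0 i <= hi 0 i].

Definition box_volume (R : realType) (d : nat) (lo hi : 'rV[R]_d) : R :=
  \prod_(i < d) Num.max 0 (hi 0 i - lo 0 i).

(* The library has Lebesgue measure on R only; a set is null in R^d iff its
   outer measure below is 0. *)
Definition lebesgue_outer (R : realType) (d : nat) (A : set 'rV[R]_d) : \bar R :=
  ereal_inf [set s : \bar R | exists lo hi : nat -> 'rV[R]_d,
    A `<=` \bigcup_k box (lo k) (hi k) /\
    s = (\sum_(0 <= k <oo) (box_volume (lo k) (hi k))%:E)%E].

Definition ae_continuous (R : realType) (d : nat) (h : 'rV[R]_d -> R) : Prop :=
  lebesgue_outer [set x | ~ {for x, continuous h}] = 0%E.

Definition coord_reflection (R : realType) (d : nat) (i : 'I_d)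
    (x : 'rV[R]_d) : 'rV[R]_d :=
  \row_k (if k == i then - x 0 k else x 0 k).

(* For i != j, the rotation by ninety degrees in the (i, j) coordinate plane. *)
Definition quarter_turn (R : realType) (d : nat) (i j : 'I_d)
    (x : 'rV[R]_d) : 'rV[R]_d :=
  \row_k (if k == i then - x 0 j else if k == j then x 0 i else x 0 k).

Definition rotation_invariant (R : realType) (d : nat) (h : 'rV[R]_d -> R) :
    Prop :=
  forall Q : 'M[R]_d, Q *m Q^T = 1%:M -> \det Q = 1 ->
  forall x, h (x *m Q) = h x.

Record step_profile (R : realType) (d : nat) (alpha : R) (h : 'rV[R]_d -> R) :
    Prop := StepProfile {
  profile_ge0 : forall x, 0 <= h x;
  profile_bounded : exists M : R, forall x, h x <= M;
  profile_ae_continuous : ae_continuous h;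
  profile_reflection : forall i x, h (coord_reflection i x) = h x;
  profile_quarter_turn : forall i j, i != j ->
    forall x, h (quarter_turn i j x) = h x;
  profile_tail : exists2 c_h : R, 0 < c_h &
    h x / (c_h * enorm x `^ (- d%:R - alpha)) @[x --> @enorm_infty R d]
      --> (1 : R);
  profile_rotation : alpha <= 2 -> rotation_invariant h }.

Definition lattice_pt (R : realType) (d : nat) (x : 'rV[int]_d) : 'rV[R]_d :=
  map_mx intr x.

(* For a step profile and L >= 1 the normalizing sum is finite, so fine is
   harmless. *)
Definition step_distr (R : realType) (d : nat) (h : 'rV[R]_d -> R) (L : R)
    (x : 'rV[int]_d) : R :=
  h (L^-1 *: lattice_pt R x) /
  fine (\esum_(y in [set: 'rV[int]_d]) (h (L^-1 *: lattice_pt R y))%:E).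

Definition walks (d n : nat) (x : 'rV[int]_d) :
    set {ffun 'I_n.+1 -> 'rV[int]_d} :=
  [set w | w ord0 = 0 /\ w ord_max = x].
Arguments walks {d} n x.

Definition walk_weight (R : realType) (d n : nat) (D : 'rV[int]_d -> R)
    (w : {ffun 'I_n.+1 -> 'rV[int]_d}) : R :=
  \prod_(i < n) D (w (lift ord0 i) - w (widen_ord (leqnSn n) i)).

Definition saw_two_point (R : realType) (d : nat) (D : 'rV[int]_d -> R)
    (n : nat) (x : 'rV[int]_d) : \bar R :=
  if n is 0 then ((x == 0)%:R)%:E
  else \esum_(w in walks n x) (walk_weight D w * (injectiveb w)%:R)%:E.

Definition saw_total (R : realType) (d : nat) (D : 'rV[int]_d -> R)
    (n : nat) : \bar R :=
  \esum_(x in [set: 'rV[int]_d]) saw_two_point D n x.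

Definition mean_displacement (R : realType) (d : nat) (D : 'rV[int]_d -> R)
    (r : R) (n : nat) : \bar R :=
  (((\esum_(x in [set: 'rV[int]_d])
       ((enorm (lattice_pt R x) `^ r)%R%:E * saw_two_point D n x))
    / saw_total D n) `^ r^-1)%E.

Definition asymp (R : realType) (a : nat -> \bar R) (b : nat -> R) : Prop :=
  exists c C : R, [/\ 0 < c, c <= C &
    \forall n \near \oo, ((c * b n)%:E <= a n <= (C * b n)%:E)%E].

(* Main.v *)
(* Fix a time horizon and replace Z^d by a large discrete torus on which walks of that
   length do not wrap around, with the kernel truncated accordingly; all constants are
   uniform in the torus and in the truncation, so they survive the limit.  On the torus
   the lace expansion, obtained by decomposing walks at the first hit of the past, gives
   for each character k a recursion
     u_n(k) = q(k) u_{n-1}(k) + sum_m Pi_m(k) u_{n-m}(k).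
   By induction on n, |u_n(k)| is at most K u_n(0) (1 + (1 - |q(k)|) n)^-theta for some
   theta in (2, d / min(alpha, 2)): this decay, averaged over k, bounds c_n(x) by
   L^-d n^-theta, and theta > 2 makes the lace coefficients and their second differences
   summable.  Hence sum_x (1 - cos k.x) c_n(x) <= K n (1 - q(k)) c_n, while the cosine
   transform of c_n is at most c_n / 2 once n (1 - q(k)) is large.  For a frequency
   2 pi / 2^j along an axis, 1 - q(k) is of order sum_(m <= j) 2^(-alpha m) 4^-(j - m),
   which is 2^(-j min(alpha, 2)), times j when alpha = 2.  Summing over dyadic frequencies
   controls |x|^r from above, and the single frequency with n (1 - q(k)) of order one
   controls it from below. *)
Require Import Defs.
From HB Require Import structures.
From mathcomp Require Import all_boot all_order all_algebra.
From mathcomp Require Import all_classical all_reals all_analysis.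
From mathcomp Require Import ring lra zify.
Set Implicit Arguments.
Unset Strict Implicit.
Unset Printing Implicit Defensive.
Import Order.TTheory GRing.Theory Num.Theory.
Import numFieldNormedType.Exports.
Local Open Scope classical_set_scope.
Local Open Scope ring_scope.

(** * Walks and the lace expansion *)

(** The growth rate of [c_n] is not known in advance, so the recursion has to be stabilized while it
    is being proved. At horizon [M] walks are weighted by [lam ^+ n], where [lam] solves the
    critical equation cut off at [M]. Raising the horizon adds one small coefficient and moves [lam]
    so little that [lam ^+ n] at most doubles for [n <= M.+1]. The bounds at the new [lam] are thus
    known up to a factor 2; with these the lace coefficients are of order [L ^- d], and for large
    [L] the recursion returns the bounds without the factor. At criticality the perturbation has
    total mass zero at the trivial mode, so at mode [k] it is, up to a summable tail, of the order
    of the gap [1 - |q|]. That compensates the factor [1 / (1 - |q|)] lost by summing the powers of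
    [q]. Values of [q] near -1 would break this and are excluded separately. No derivative in [k]
    occurs. The weight [w = 1 - cos k.x] satisfies [w (x + y) <= 2 * w x + 2 * w y], which, with
    [w >= 0], [w 0 = 0] and evenness, is all that the diagrams use; it treats all [alpha] alike. *)

Section Walks.
Variables (R : realType) (G : finZmodType) (D : G -> R).
Implicit Types (s t A : seq G) (x y a : G) (n m j f : nat).

(** A walk is the list of its increments rather than of its positions: concatenation is then [++],
    and translations are invisible. *)
Fixpoint wsum n (Phi : seq G -> R) : R :=
  if n is n'.+1 then \sum_y D y * wsum n' (fun s => Phi (y :: s)) else Phi [::].

Definition ssum s : G := \sum_(y <- s) y.
Definition pos s (i : nat) : G := ssum (take i s).
Definition saw s := uniq [seq pos s i | i <- iota 0 (size s).+1].
(** Time 0 is left out here and in [hit]: a continuation starts at the endpoint of its past, which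
    for a self-avoiding past is not in [back]. *)
Definition avoid A s := all (fun i => pos s i \notin A) (iota 1 (size s)).
Definition hit A s :=
  (ssum s \in A) && all (fun i => pos s i \notin A) (iota 1 (size s).-1).
(* The strict past of a walk, seen from its endpoint. *)
Definition back s := [seq pos s i - ssum s | i <- iota 0 (size s)].

Lemma eq_wsum n Phi Psi : (forall s, size s = n -> Phi s = Psi s) ->
  wsum n Phi = wsum n Psi.
Proof.
elim: n Phi Psi => [|n IH] Phi Psi e /=; first exact: e.
by apply: eq_bigr => y _; congr (_ * _); apply: IH => s es; apply: e; rewrite /= es.
Qed.

Lemma wsum_cat n m Phi :
  wsum (n + m) Phi = wsum n (fun s => wsum m (fun t => Phi (s ++ t))).
Proof.
by elim: n Phi => [//|n IH] Phi /=; apply: eq_bigr => y _; rewrite IH.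
Qed.

Lemma wsumZ n (c : R) Phi : wsum n (fun s => c * Phi s) = c * wsum n Phi.
Proof.
elim: n Phi => [//|n IH] Phi /=; rewrite mulr_sumr; apply: eq_bigr => y _.
by rewrite IH mulrCA.
Qed.

Lemma wsumZr n (c : R) Phi : wsum n (fun s => Phi s * c) = wsum n Phi * c.
Proof. by rewrite mulrC -wsumZ; apply: eq_wsum => s _; rewrite mulrC. Qed.

Lemma wsumD n Phi Psi :
  wsum n (fun s => Phi s + Psi s) = wsum n Phi + wsum n Psi.
Proof.
elim: n Phi Psi => [//|n IH] Phi Psi /=; rewrite -big_split; apply: eq_bigr => y _.
by rewrite IH mulrDr.
Qed.

Lemma wsumN n Phi : wsum n (fun s => - Phi s) = - wsum n Phi.
Proof.
rewrite -mulN1r -wsumZ; apply: eq_wsum => s _; by rewrite mulN1r.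
Qed.

Lemma wsum_sum n (I : Type) (r : seq I) (P : pred I) (F : I -> seq G -> R) :
  wsum n (fun s => \sum_(i <- r | P i) F i s) = \sum_(i <- r | P i) wsum n (F i).
Proof.
elim: n F => [//|n IH] F /=; rewrite exchange_big; apply: eq_bigr => y _ /=.
by rewrite IH mulr_sumr.
Qed.

Definition saw_count n x : R := wsum n (fun s => (saw s && (ssum s == x))%:R).
Local Notation c := saw_count.

Lemma ssum_cat s t : ssum (s ++ t) = ssum s + ssum t.
Proof. exact: big_cat. Qed.

Lemma pos_cat s t i : pos (s ++ t) i =
  if (i < size s)%N then pos s i else ssum s + pos t (i - size s).
Proof.
rewrite /pos take_cat; case: ifP => // ltis; by rewrite ssum_cat.
Qed.

Lemma pos_size s : pos s (size s) = ssum s.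
Proof. by rewrite /pos take_size. Qed.

Lemma pos0 s : pos s 0 = 0.
Proof. by rewrite /pos take0 /ssum big_nil. Qed.

Lemma pos_take s i j : (i <= j)%N -> pos (take j s) i = pos s i.
Proof. by move=> leij; rewrite /pos take_takel. Qed.

(** Seen from the end of [s], a collision between the two pieces is a visit of [t] to [back s] at a
    positive time. This is what makes the expansion recursive. *)
Lemma saw_cat s t : saw (s ++ t) = [&& saw s, saw t & avoid (back s) t].
Proof.
rewrite /saw size_cat -addnS iotaD add0n map_cat.
have -> : [seq pos (s ++ t) i | i <- iota 0 (size s)] =
          [seq pos s i | i <- iota 0 (size s)].
  by apply/eq_in_map => i; rewrite mem_iota /= add0n pos_cat => ->.
have -> : [seq pos (s ++ t) i | i <- iota (size s) (size t).+1] =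
          [seq ssum s + p | p <- [seq pos t i | i <- iota 0 (size t).+1]].
  rewrite -[in LHS](addn0 (size s)) iotaDl -!map_comp; apply: eq_map => i /=.
  by rewrite pos_cat ltnNge leq_addr /= addKn.
have -> : iota 0 (size s).+1 = iota 0 (size s) ++ [:: size s].
  by rewrite -addn1 iotaD add0n.
rewrite map_cat !cat_uniq /= orbF pos_size andbT.
rewrite (map_inj_uniq (addrI _)) /=.
case: (uniq [seq pos s i | i <- iota 0 (size s)]) => //=.
rewrite pos0 addr0.
have -> : avoid (back s) t = ~~ has [in [seq pos s i | i <- iota 0 (size s)]]
   [seq ssum s + p | p <- [seq pos t i | i <- iota 1 (size t)]].
  rewrite /avoid has_map has_map -all_predC; apply: eq_all => i /=.
  congr (~~ _); apply/mapP/mapP => [] [j jI e]; exists j => //.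
    by rewrite e addrC subrK.
  by rewrite -e addrAC subrr add0r.
have -> : (ssum s \in [seq ssum s + p | p <- [seq pos t i | i <- iota 1 (size t)]])
    = (0 \in [seq pos t i | i <- iota 1 (size t)]).
  by rewrite -{1}(addr0 (ssum s)) (mem_map (addrI _)).
rewrite negb_or -!andbA; case: (_ \notin _) => //=.
by rewrite andbC -andbA.
Qed.

Lemma first_hit_sum (P : nat -> bool) n :
  \sum_(1 <= j < n.+1) (P j && all (fun i => ~~ P i) (iota 1 j.-1))%:R =
  1 - (all (fun i => ~~ P i) (iota 1 n))%:R :> R.
Proof.
elim: n => [|n IH]; first by rewrite big_geq //= subrr.
rewrite big_nat_recr // IH -{3}(addn1 n) iotaD all_cat /= add1n andbT.
case: (all _ _); case: (P _) => /=; lra.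
Qed.

Lemma avoid_hit A s : (avoid A s)%:R =
  1 - \sum_(1 <= j < (size s).+1) (hit A (take j s))%:R :> R.
Proof.
have -> : \sum_(1 <= j < (size s).+1) (hit A (take j s))%:R =
   \sum_(1 <= j < (size s).+1) ((pos s j \in A) &&
       all (fun i => ~~ (pos s i \in A)) (iota 1 j.-1))%:R :> R.
  apply: eq_big_nat => j /andP[j0 js].
  rewrite /hit -/(pos s j) size_takel //; congr ((_ && _)%:R).
  apply: eq_in_all => i; rewrite mem_iota => /andP[_ ij].
  by rewrite pos_take //; lia.
by rewrite first_hit_sum; rewrite /avoid; lra.
Qed.

Definition saw_avoid n A x : R :=
  wsum n (fun s => (saw s && avoid A s && (ssum s == x))%:R).

Lemma natrb_and (a b : bool) : (a && b)%:R = a%:R * b%:R :> R.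
Proof. by case: a b => [] []; rewrite /= ?mul1r ?mulr0 ?mul0r. Qed.

(** At the first hit time [j] the walk factorizes. The remainder is no longer constrained by [A],
    only by the past [back s], so it is again counted by [saw_avoid], with a new obstacle set. *)
Lemma saw_avoid_rec n A x : saw_avoid n A x = c n x -
  \sum_(1 <= j < n.+1) wsum j (fun s => (hit A s && saw s)%:R *
    saw_avoid (n - j) (back s) (x - ssum s)).
Proof.
rewrite -[- _]mulN1r -[c n x]mul1r mulr_sumr /c.
transitivity (wsum n (fun s => (saw s && (ssum s == x))%:R
   + \sum_(1 <= j < n.+1) - (hit A (take j s) && saw s && (ssum s == x))%:R)).
  apply: eq_wsum => s es; rewrite andbAC natrb_and avoid_hit es mulrBr mulr1.
  congr (_ + _); rewrite mulr_sumr -sumrN; apply: eq_bigr => j _.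
  by congr (- _); rewrite -andbA [in RHS]natrb_and mulrC.
rewrite wsumD mul1r wsum_sum; congr (_ + _); apply: eq_big_nat => j /andP[j1 jn].
rewrite wsumN mulN1r; congr (- _).
have {1}-> : n = (j + (n - j))%N by lia.
rewrite wsum_cat; apply: eq_wsum => s es.
rewrite -wsumZ; apply: eq_wsum => t et.
rewrite -es take_size_cat // saw_cat ssum_cat -natrb_and; congr (_%:R).
rewrite (addrC (ssum s)) [ssum t == _]eq_sym subr_eq (eq_sym x).
by case: (hit A s) (saw s) (saw t) (avoid (back s) t) => [] [] [] [].
Qed.

(* [f] is recursion fuel; any [f >= m] gives the same lace coefficient. *)
Fixpoint lace f m A x : R :=
  if f is f'.+1 then
    - wsum m (fun s => (hit A s && saw s && (ssum s == x))%:R)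
    - \sum_(1 <= j < m) wsum j (fun s => (hit A s && saw s)%:R *
        lace f' (m - j) (back s) (x - ssum s))
  else 0.

Lemma triangle_sum n (F : nat -> nat -> R) :
  \sum_(1 <= m < n.+1) \sum_(1 <= j < m) F m j =
  \sum_(1 <= j < n.+1) \sum_(1 <= m < (n - j).+1) F (j + m)%N j.
Proof.
elim: n => [|n IH]; first by rewrite !big_geq.
rewrite big_nat_recr //= IH [RHS]big_nat_recr //= subnn [X in _ = _ + X]big_geq //.
rewrite addr0 -big_split /=; apply: eq_big_nat => j /andP[j1 jn].
rewrite subSn // [RHS]big_nat_recr //=; congr (_ + F _ _).
by lia.
Qed.

(** Iteration of [saw_avoid_rec]; the free factor [c (n - m)] is what follows the last hit. Every
    hit uses at least one unit of time, hence fuel [n] suffices. *)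
Lemma saw_avoid_lace f n A x : (n <= f)%N -> saw_avoid n A x = c n x +
  \sum_(1 <= m < n.+1) \sum_y lace f m A y * c (n - m) (x - y).
Proof.
elim: f n A x => [|f IH] n A x.
  rewrite leqn0 => /eqP->; rewrite big_geq // addr0 /c /saw_avoid /=.
  by rewrite /avoid /=.
move=> lenf; rewrite saw_avoid_rec; congr (_ + _).
rewrite -sumrN.
have E1 m : \sum_y lace f.+1 m A y * c (n - m) (x - y) =
   - wsum m (fun s => (hit A s && saw s)%:R * c (n - m) (x - ssum s))
   - \sum_(1 <= j < m) wsum j (fun s => (hit A s && saw s)%:R *
       \sum_y lace f (m - j) (back s) y * c (n - m) (x - ssum s - y)).
  rewrite /=; under eq_bigr do rewrite mulrBl.
  rewrite sumrB; congr (_ - _).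
    under eq_bigr do rewrite mulNr -wsumZr.
    rewrite sumrN; congr (- _).
    rewrite -wsum_sum; apply: eq_wsum => s es.
    rewrite (bigD1 (ssum s)) //= eqxx andbT big1 ?addr0 //.
    by move=> y; rewrite eq_sym => /negbTE->; rewrite andbF mul0r.
  under [LHS]eq_bigr do rewrite mulr_suml.
  rewrite exchange_big /=; apply: eq_bigr => j _.
  under [LHS]eq_bigr do rewrite -wsumZr.
  rewrite -wsum_sum; apply: eq_wsum => s es.
  rewrite mulr_sumr (reindex_inj (addrI (ssum s))) /=.
  apply: eq_bigr => y _; rewrite mulrA opprD addrA.
  by rewrite (addrC (ssum s) y) addrK.
under [RHS]eq_bigr do rewrite E1.
rewrite sumrB (triangle_sum n (fun m j => wsum j (fun s => (hit A s && saw s)%:R *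
       \sum_y lace f (m - j) (back s) y * c (n - m) (x - ssum s - y)))).
rewrite -sumrB; apply: eq_big_nat => j /andP[j1 jn].
rewrite -opprD; congr (- _).
rewrite -wsum_sum -wsumD; apply: eq_wsum => s es.
rewrite IH; last by lia.
rewrite mulrDr; congr (_ + _); rewrite mulr_sumr; apply: eq_bigr => m _.
congr (_ * _); apply: eq_bigr => y _; rewrite addKn; congr (_ * c _ _); lia.
Qed.

Definition lace_coef f m x : R :=
  \sum_y D y * lace f m.-1 [:: - y] (x - y).

Lemma saw_count0 x : c 0 x = (x == 0)%:R.
Proof. by rewrite /c /= /saw /= /ssum big_nil eq_sym. Qed.

(** After a first step [y] the past is the single point [- y]. By [D 0 = 0] every one-step walk of
    nonzero weight is self-avoiding. *)
Lemma lace_expansion f n x : D 0 = 0 -> (n <= f)%N ->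
  c n.+1 x = \sum_y D y * c n (x - y) +
    \sum_(2 <= m < n.+2) \sum_y lace_coef f m y * c (n.+1 - m) (x - y).
Proof.
move=> D0 nf.
have -> : c n.+1 x = \sum_y D y * saw_avoid n [:: - y] (x - y).
  rewrite /c /=; apply: eq_bigr => y _.
  have [->|y0] := eqVneq y 0; first by rewrite D0 !mul0r.
  congr (_ * _); apply: eq_wsum => t et.
  rewrite -cat1s saw_cat ssum_cat /=.
  have -> : saw [:: y].
    rewrite /saw /= andbT inE pos0 /pos /= /ssum big_seq1.
    by rewrite eq_sym.
  have -> : back [:: y] = [:: - y].
    by rewrite /back /= pos0 /ssum big_seq1 sub0r.
  rewrite /= /ssum big_seq1 (addrC y) [X in _ = (_ && X)%:R]eq_sym subr_eq (eq_sym x).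
  by [].
under eq_bigr => y _ do rewrite (saw_avoid_lace _ _ nf) mulrDr.
rewrite big_split /=; congr (_ + _).
rewrite [RHS]big_add1 /=.
under eq_bigr do rewrite mulr_sumr.
rewrite exchange_big /=; apply: eq_bigr => m _.
under [RHS]eq_bigr do rewrite /lace_coef mulr_suml.
rewrite [RHS]exchange_big /=; apply: eq_bigr => z _.
rewrite [RHS](reindex_inj (addrI z)) mulr_sumr; apply: eq_bigr => y _ /=.
rewrite subSS (addrC z y) addrK mulrA; congr (_ * _ * c _ _).
by rewrite [y + z]addrC opprD addrA.
Qed.

End Walks.

(** * Diagrammatic bounds *)

Section LaceBounds.
Variables (R : realType) (G : finZmodType) (D : G -> R).
Hypothesis D_ge0 : forall y, 0 <= D y.
Implicit Types (s t A : seq G) (x y a : G) (n m i j l f N : nat).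
Local Notation c := (saw_count D).
Local Notation wsum := (wsum D).

Lemma le_wsum n Phi Psi : (forall s, size s = n -> Phi s <= Psi s) ->
  wsum n Phi <= wsum n Psi.
Proof.
elim: n Phi Psi => [|n IH] Phi Psi le /=; first exact: le.
apply: ler_sum => y _; apply: ler_wpM2l => //; apply: IH => s es.
by apply: le; rewrite /= es.
Qed.

Lemma wsum_ge0 n Phi : (forall s, 0 <= Phi s) -> 0 <= wsum n Phi.
Proof.
elim: n Phi => [|n IH] Phi ge /=; first exact: ge.
by apply: sumr_ge0 => y _; apply: mulr_ge0 => //; apply: IH.
Qed.

Lemma norm_wsum n Phi : `|wsum n Phi| <= wsum n (fun s => `|Phi s|).
Proof.
elim: n Phi => [//|n IH] Phi /=.
apply: le_trans (ler_norm_sum _ _ _) _; apply: ler_sum => y _.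
by rewrite normrM ger0_norm //; apply: ler_wpM2l.
Qed.

Lemma saw_count_ge0 n x : 0 <= c n x.
Proof. by apply: wsum_ge0 => s. Qed.
Local Hint Resolve saw_count_ge0 : core.

Lemma wsum_saw n (g : G -> R) :
  wsum n (fun s => (saw s)%:R * g (ssum s)) = \sum_x c n x * g x.
Proof.
under [RHS]eq_bigr do rewrite -wsumZr.
rewrite -wsum_sum; apply: eq_wsum => s _.
rewrite (bigD1 (ssum s)) //= eqxx andbT big1 ?addr0 //.
by move=> y; rewrite eq_sym => /negbTE->; rewrite andbF mul0r.
Qed.

(** The walk is cut at time [i], where [g] is read, and the mutual avoidance of the two pieces is
    dropped. *)
Lemma saw_count_split i j a (g : G -> R) : (i <= j)%N -> (forall y, 0 <= g y) ->
  wsum j (fun s => (saw s && (ssum s == a))%:R * g (pos s i)) <=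
  \sum_y c i y * c (j - i) (a - y) * g y.
Proof.
move=> leij g0; rewrite -{1}(subnKC leij) wsum_cat.
under [leRHS]eq_bigr do rewrite -mulrA.
rewrite -(wsum_saw i (fun y => c (j - i) (a - y) * g y)).
apply: le_wsum => s es; rewrite -wsumZr -wsumZ; apply: le_wsum => t et.
rewrite saw_cat ssum_cat.
have -> : pos (s ++ t) i = ssum s by rewrite pos_cat es ltnn subnn pos0 addr0.
rewrite mulrA; apply: ler_wpM2r => //.
rewrite (addrC (ssum s)) [ssum t == _]eq_sym subr_eq (eq_sym a).
rewrite -natrb_and ler_nat.
by case: (saw s) (saw t) (avoid (back s) t) (_ == _) => [] [] [] [].
Qed.

Lemma saw_count_add i j x :
  c (i + j) x <= \sum_y c i y * c j (x - y).
Proof.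
have := @saw_count_split i (i + j) x (fun=> 1) (leq_addr _ _) (fun=> ler01).
rewrite addKn wsumZr mulr1; under eq_bigr do rewrite mulr1.
by [].
Qed.

Lemma saw_count1 : D 0 = 0 -> c 1 =1 D.
Proof.
move=> D0 x; rewrite /saw_count /= (bigD1 x) //= big1 ?addr0.
  have [->|x0] := eqVneq x 0; first by rewrite D0 mul0r.
  rewrite /saw /= andbT inE pos0 /pos /= /ssum !big_seq1 eq_sym x0 eqxx.
  by rewrite mulr1.
by move=> y yx; rewrite /ssum big_seq1 (negbTE yx) andbF mulr0.
Qed.

(* Legs of lengths [i], [l >= 1], [n >= 1] that use up [m] steps. *)
Definition legs i l n m := [&& (0 < l)%N, (0 < n)%N & (i + l + n == m)%N].

(** The dominating diagram. The hit point [a] is reached in [i + l] steps through [y], and [y], seen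
    from [a], is the point that the rest of the ladder, with [n] steps left, has to hit next. *)
Fixpoint ladder f m a x : R :=
  if f is f'.+1 then
    c m a * (x == a)%:R +
    \sum_(i < m) \sum_(l < m) \sum_(n < m) (legs i l n m)%:R *
      \sum_y c i y * c l (a - y) * ladder f' n (y - a) (x - a)
  else 0.

Lemma ladder_ge0 f m a x : 0 <= ladder f m a x.
Proof.
elim: f m a x => [//|f IH] m a x /=; apply: addr_ge0; first exact: mulr_ge0.
do 3 (apply: sumr_ge0 => ? _); apply: mulr_ge0 => //.
by apply: sumr_ge0 => y _; do !apply: mulr_ge0.
Qed.
Local Hint Resolve ladder_ge0 : core.

(** Independent ordinal ranges with the indicator [legs] replace the dependent range [i < j < m], so
    that the three lengths can later be summed in any order. *)
Lemma sum_legs m (F : nat -> nat -> nat -> R) : (forall i l n, 0 <= F i l n) ->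
  \sum_(1 <= j < m) \sum_(0 <= i < j) F i (j - i)%N (m - j)%N <=
  \sum_(i < m) \sum_(l < m) \sum_(n < m) (legs i l n m)%:R * F i l n.
Proof.
move=> F0.
have -> : \sum_(i < m) \sum_(l < m) \sum_(n < m) (legs i l n m)%:R * F i l n =
   \sum_(n < m) \sum_(i < m) \sum_(l < m) (legs i l n m)%:R * F i l n.
  by under eq_bigr do rewrite exchange_big; rewrite exchange_big.
have nn (i l n : nat) : 0 <= (legs i l n m)%:R * F i l n by rewrite mulr_ge0.
have [m0|m0] := leqP m 1.
  by rewrite big_geq //; do 3 (apply: sumr_ge0 => ? _).
rewrite -(big_mkord predT (fun n => \sum_(i < m) \sum_(l < m)
   (legs i l n m)%:R * F i l n)) [leRHS]big_ltn; last by lia.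
rewrite -[leLHS]add0r; apply: lerD; first by do 2 (apply: sumr_ge0 => ? _).
rewrite [leLHS]big_nat_rev /= add1n.
apply: ler_sum_nat => n /andP[n1 nm]; rewrite subSS subKn; last by lia.
rewrite big_mkord (big_ord_widen m (fun i => F i (m - n - i)%N n)); last by lia.
rewrite big_mkcond /=; apply: ler_sum => i _; case: ifP => lti; last first.
  by apply: sumr_ge0.
have lm : (m - n - i < m)%N by lia.
rewrite (bigD1 (Ordinal lm)) //= -[leLHS]addr0; apply: lerD.
  rewrite /legs (_ : [&& _, _ & _]) ?mul1r //.
  by apply/and3P; split; lia.
by apply: sumr_ge0.
Qed.

(** A union bound, over the point of [A] that is hit and over the time [i < j] whose position is the
    next obstacle; [i] becomes the cut in [saw_count_split]. *)
Lemma lace_le_ladder f m A x :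
  `|lace D f m A x| <= \sum_(a <- A) ladder f m a x.
Proof.
elim: f m A x => [|f IH] m A x /=.
  by rewrite normr0 sumr_ge0.
apply: le_trans (ler_normB _ _) _; rewrite normrN big_split /=.
have hitA s (g : G -> R) : (forall y, 0 <= g y) ->
    (hit A s && saw s)%:R * g (ssum s) <=
    \sum_(a <- A) (saw s && (ssum s == a))%:R * g a.
  move=> g0; case hs: (hit A s && saw s); last first.
    by rewrite mulr0n mul0r sumr_ge0 // => a _; rewrite mulr_ge0.
  case/andP: hs => /andP[sA _] ws; rewrite mul1r ws (big_rem _ sA) /= eqxx mul1r lerDl.
  by rewrite sumr_ge0 // => a _; rewrite mulr_ge0.
apply: lerD.
  apply: le_trans (norm_wsum _ _) _.
  under [leRHS]eq_bigr do rewrite -wsumZr.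
  rewrite -wsum_sum; apply: le_wsum => s es; rewrite ger0_norm // natrb_and eq_sym.
  exact: (hitA s (fun y => (x == y)%:R)).
apply: le_trans (ler_norm_sum _ _ _) _.
apply: (@le_trans _ _ (\sum_(a <- A) \sum_(1 <= j < m) \sum_(0 <= i < j)
   \sum_y c i y * c (j - i) (a - y) * ladder f (m - j) (y - a) (x - a))); last first.
  apply: ler_sum => a _.
  apply: (@sum_legs m (fun i l n => \sum_y c i y * c l (a - y) *
    ladder f n (y - a) (x - a))) => i l n.
  by apply: sumr_ge0 => y _; do !apply: mulr_ge0.
rewrite exchange_big /=; apply: ler_sum => j _.
apply: le_trans (norm_wsum _ _) _.
apply: (@le_trans _ _ (wsum j (fun s => \sum_(a <- A) \sum_(0 <= i < j)
    (saw s && (ssum s == a))%:R * ladder f (m - j) (pos s i - a) (x - a)))); last first.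
  rewrite wsum_sum; apply: ler_sum => a _; rewrite wsum_sum.
  apply: ler_sum_nat => i /andP[_ ij].
  by apply: (@saw_count_split i j a (fun y => ladder f (m - j) (y - a) (x - a)));
     [exact: ltnW|].
apply: le_wsum => s es; rewrite normrM ger0_norm //.
apply: (@le_trans _ _ ((hit A s && saw s)%:R * \sum_(0 <= i < j)
   ladder f (m - j) (pos s i - ssum s) (x - ssum s))).
  apply: ler_wpM2l => //; apply: le_trans (IH _ _ _) _.
  by rewrite /back big_map es /index_iota subn0.
apply: le_trans (@hitA s (fun a => \sum_(0 <= i < j)
   ladder f (m - j) (pos s i - a) (x - a)) _) _.
  by move=> y; apply: sumr_ge0.
by apply: ler_sum => a _; rewrite mulr_sumr.
Qed.

Definition ladder_mass f m a : R := \sum_x ladder f m a x.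

Lemma ladder_mass_rec f m a : ladder_mass f.+1 m a = c m a +
  \sum_(i < m) \sum_(l < m) \sum_(n < m) (legs i l n m)%:R *
    \sum_y c i y * c l (a - y) * ladder_mass f n (y - a).
Proof.
rewrite /ladder_mass /= big_split /=; congr (_ + _).
  rewrite (bigD1 a) //= eqxx mulr1 big1 ?addr0 // => x /negbTE->.
  by rewrite mulr0.
do 3 (rewrite exchange_big /=; apply: eq_bigr => ? _).
rewrite -mulr_sumr; congr (_ * _); rewrite exchange_big /=; apply: eq_bigr => y _.
by rewrite -mulr_sumr; congr (_ * _); rewrite [RHS](reindex_inj (addIr (- a))).
Qed.

Lemma ladder_mass_ge0 f m a : 0 <= ladder_mass f m a.
Proof. exact: sumr_ge0. Qed.
Local Hint Resolve ladder_mass_ge0 : core.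

(* [w] stands for [1 - cos k]: twice-subadditive weights of the displacement. *)
Variable w : G -> R.
Hypothesis w_ge0 : forall x, 0 <= w x.
Hypothesis w0 : w 0 = 0.
Hypothesis w_sub : forall x y, w (x + y) <= 2 * w x + 2 * w y.

(** Displacement is measured from [a], so the term [x = a] does not contribute. For a lace
    coefficient, where [a = - y] after a first step [y], this is the full displacement of the
    coefficient. *)
Definition ladder_spread f m a : R := \sum_x w (x - a) * ladder f m a x.

Lemma ladder_spread_ge0 f m a : 0 <= ladder_spread f m a.
Proof. by apply: sumr_ge0 => x _; apply: mulr_ge0. Qed.

Lemma ladder_spread_rec f m a : ladder_spread f.+1 m a <=
  \sum_(i < m) \sum_(l < m) \sum_(n < m) (legs i l n m)%:R *
    \sum_y c i y * c l (a - y) *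
      (2 * w (y - a) * ladder_mass f n (y - a) + 2 * ladder_spread f n (y - a)).
Proof.
rewrite /ladder_spread /=; under eq_bigr do rewrite mulrDr.
rewrite big_split /= big1 ?add0r; last first.
  move=> x _; have [->|] := eqVneq x a; first by rewrite subrr w0 mul0r.
  by rewrite !mulr0.
under [leLHS]eq_bigr do rewrite mulr_sumr.
rewrite [leLHS]exchange_big /=; apply: ler_sum => i _.
under [leLHS]eq_bigr do rewrite mulr_sumr.
rewrite [leLHS]exchange_big /=; apply: ler_sum => l _.
under [leLHS]eq_bigr do rewrite mulr_sumr.
rewrite [leLHS]exchange_big /=; apply: ler_sum => n _.
under [leLHS]eq_bigr do rewrite mulrCA.
rewrite -mulr_sumr; apply: ler_wpM2l => //.
under [leLHS]eq_bigr do rewrite mulr_sumr.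
rewrite [leLHS]exchange_big /=; apply: ler_sum => y _.
under [leLHS]eq_bigr do rewrite mulrCA.
rewrite -mulr_sumr; apply: ler_wpM2l; first exact: mulr_ge0.
rewrite /ladder_mass !mulr_sumr -big_split /=.
rewrite [leRHS](reindex_inj (addIr (- a))) /=; apply: ler_sum => x _.
rewrite mulrA -mulrDl; apply: ler_wpM2r => //.
apply: le_trans (_ : w ((y - a) + ((x - a) - (y - a))) <= _); last exact: w_sub.
by rewrite (addrC (y - a)) subrK.
Qed.

Lemma lace_coef_mass f m :
  \sum_x `|lace_coef D f m x| <= \sum_y D y * ladder_mass f m.-1 (- y).
Proof.
rewrite /lace_coef.
apply: (@le_trans _ _ (\sum_x \sum_y D y * ladder f m.-1 (- y) (x - y))).
  apply: ler_sum => x _; apply: le_trans (ler_norm_sum _ _ _) _.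
  apply: ler_sum => y _; rewrite normrM ger0_norm //; apply: ler_wpM2l => //.
  by apply: le_trans (lace_le_ladder _ _ _ _) _; rewrite big_seq1.
rewrite [leLHS]exchange_big /=; apply: ler_sum => y _; rewrite -mulr_sumr.
by apply: ler_wpM2l => //; rewrite /ladder_mass [leRHS](reindex_inj (addIr (- y))).
Qed.

Lemma lace_coef_spread f m :
  \sum_x w x * `|lace_coef D f m x| <= \sum_y D y * ladder_spread f m.-1 (- y).
Proof.
rewrite /lace_coef.
apply: (@le_trans _ _ (\sum_x w x * \sum_y D y * ladder f m.-1 (- y) (x - y))).
  apply: ler_sum => x _; apply: ler_wpM2l => //.
  apply: le_trans (ler_norm_sum _ _ _) _.
  apply: ler_sum => y _; rewrite normrM ger0_norm //; apply: ler_wpM2l => //.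
  by apply: le_trans (lace_le_ladder _ _ _ _) _; rewrite big_seq1.
under [leLHS]eq_bigr do rewrite mulr_sumr.
rewrite [leLHS]exchange_big /=; apply: ler_sum => y _.
rewrite /ladder_spread mulr_sumr [leRHS](reindex_inj (addIr (- y))) /=.
by apply: ler_sum => x _; rewrite opprK subrK mulrCA.
Qed.

End LaceBounds.

Ltac nlia :=
  try match goal with R : realType |- _ =>
    repeat match goal with H : context [R] |- _ => clear H end end; lia.

(** * Index sums over the legs of a diagram *)

Section OrdSums.
Variable R : realDomainType.

Lemma sum_unique_le1 m (P : pred nat) :
  (forall i j, P i -> P j -> i = j) -> \sum_(i < m) (P i)%:R <= 1 :> R.
Proof.
move=> Pu; have [/existsP[i Pi]|/existsPn nP] := boolP [exists i : 'I_m, P i].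
  rewrite (bigD1 i) //= Pi big1 ?addr0 // => j /eqP ji.
  by case Pj : (P j) => //; case: ji; apply/val_inj/Pu.
by rewrite big1 // => i _; rewrite (negbTE (nP i)).
Qed.

Lemma ler_sum_widen m M (F : nat -> R) : (m <= M)%N -> (forall i, 0 <= F i) ->
  \sum_(i < m) F i <= \sum_(i < M) F i.
Proof.
move=> mM F0; rewrite (big_ord_widen _ _ mM) big_mkcond /=.
by apply: ler_sum => i _; case: ifP.
Qed.

Lemma legs_sum_n m (h : nat -> nat -> R) : (forall i l, 0 <= h i l) ->
  \sum_(i < m) \sum_(l < m) \sum_(n < m) (legs i l n m)%:R * h i l <=
  \sum_(i < m) \sum_(l < m) h i l.
Proof.
move=> h0; do 2 (apply: ler_sum => ? _); rewrite -mulr_suml -[leRHS]mul1r.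
apply: ler_wpM2r => //; apply: (@sum_unique_le1 _ (fun n => legs _ _ n m)).
by move=> n n' /and3P[_ _ /eqP e] /and3P[_ _ /eqP e']; lia.
Qed.

Lemma legs_sum_l m (h : nat -> nat -> R) : (forall i l, 0 <= h i l) ->
  \sum_(i < m) \sum_(l < m) \sum_(n < m) (legs i l n m)%:R * h i n <=
  \sum_(i < m) \sum_(n < m) h i n.
Proof.
move=> h0; apply: ler_sum => i _; rewrite exchange_big; apply: ler_sum => n _ /=.
rewrite -mulr_suml -[leRHS]mul1r.
apply: ler_wpM2r => //; apply: (@sum_unique_le1 _ (fun l => legs _ l _ m)).
by move=> l l' /and3P[_ _ /eqP e] /and3P[_ _ /eqP e']; lia.
Qed.

Lemma legs_sum_i m (h : nat -> nat -> R) : (forall i l, 0 <= h i l) ->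
  \sum_(i < m) \sum_(l < m) \sum_(n < m) (legs i l n m)%:R * h l n <=
  \sum_(l < m) \sum_(n < m) h l n.
Proof.
move=> h0; rewrite exchange_big; apply: ler_sum => l _ /=.
rewrite exchange_big; apply: ler_sum => n _ /=.
rewrite -mulr_suml -[leRHS]mul1r.
apply: ler_wpM2r => //; apply: (@sum_unique_le1 _ (fun i => legs i _ _ m)).
by move=> l1 l' /and3P[_ _ /eqP e] /and3P[_ _ /eqP e']; lia.
Qed.

(** Once [m] is summed as well, the three lengths are free, because they determine [m]. *)
Lemma legs_cumul M (Y : nat -> nat -> nat -> R) : (forall i l n, 0 <= Y i l n) ->
  \sum_(m < M.+1) \sum_(i < m) \sum_(l < m) \sum_(n < m)
    (legs i l n m)%:R * Y i l n <=
  \sum_(i < M) \sum_(l < M) \sum_(n < M) ((0 < l)%N && (0 < n)%N)%:R * Y i l n.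
Proof.
move=> Y0.
have nn i l n m : 0 <= (legs i l n m)%:R * Y i l n by rewrite mulr_ge0.
apply: (@le_trans _ _ (\sum_(m < M.+1) \sum_(i < M) \sum_(l < M) \sum_(n < M)
    (legs i l n m)%:R * Y i l n)).
  apply: ler_sum => -[m /= mM] _; rewrite ltnS in mM.
  apply: le_trans (_ : _ <= \sum_(i < m) \sum_(l < M) \sum_(n < M)
      (legs i l n m)%:R * Y i l n) _; last first.
    apply: (@ler_sum_widen _ _ (fun i => \sum_(l < M) \sum_(n < M)
      (legs i l n m)%:R * Y i l n)) => // i.
    by do 2 (apply: sumr_ge0 => ? _).
  apply: ler_sum => i _.
  apply: le_trans (_ : _ <= \sum_(l < m) \sum_(n < M)
      (legs i l n m)%:R * Y i l n) _; last first.
    apply: (@ler_sum_widen _ _ (fun l => \sum_(n < M)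
      (legs i l n m)%:R * Y i l n)) => // l.
    by do 1 (apply: sumr_ge0 => ? _).
  apply: ler_sum => l _.
  exact: (@ler_sum_widen _ _ (fun n => (legs i l n m)%:R * Y i l n)).
rewrite exchange_big; apply: ler_sum => i _ /=.
rewrite exchange_big; apply: ler_sum => l _ /=.
rewrite exchange_big; apply: ler_sum => n _ /=.
rewrite -mulr_suml; apply: ler_wpM2r => //.
have [ln|nln] := boolP ((0 < l)%N && (0 < n)%N).
  apply: (@sum_unique_le1 _ (fun m => legs i l n m)).
  by move=> m m' /and3P[_ _ /eqP e] /and3P[_ _ /eqP e']; lia.
by rewrite big1 // => m _; rewrite /legs andbA (negbTE nln).
Qed.

Lemma le_sum6 (a b c d e f : R) : 0 <= a -> 0 <= b -> 0 <= c -> 0 <= d ->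
  0 <= e -> 0 <= f -> let S := a + b + (c + d) + (e + f) in
  ([/\ a <= S, b <= S & c <= S] * [/\ d <= S, e <= S & f <= S])%type.
Proof. by move=> a0 b0 c0 d0 e0 f0 S; rewrite /S; split; split; clear S; lra. Qed.

End OrdSums.

(* [om n] plays the role of [(1 + n) ^ - theta], with [theta > 2]. *)
Record decay_seq (R : realType) (om : nat -> R) (Cd Cw : R) : Prop := DecaySeq {
  decay0 : om 0 = 1;
  decay_gt0 : forall n, 0 < om n;
  decay_anti : forall n m, (n <= m)%N -> om m <= om n;
  decay_third : forall l m, (m.+1 <= 3 * l.+1)%N -> om l <= Cd * om m;
  decay_sum : forall M, \sum_(n < M) n.+1%:R * om n <= Cw }.

(** * Decay and spread of the diagrams *)

Section DiagramEstimates.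
Variables (R : realType) (om : nat -> R) (Cd Cw : R).
Hypothesis omP : decay_seq om Cd Cw.

(** The price of two legs when the longer one is taken in supremum and the shorter one is summed in
    space. Summing over the shorter length costs [v.+1], whence the weight in [decay_sum]. *)
Definition shorter (u v : nat) : R := om v * (u <= v)%:R.
Local Notation g := shorter.

Let om_ge0 n : 0 <= om n. Proof. exact/ltW/(decay_gt0 omP). Qed.
Lemma shorter_ge0 u v : 0 <= g u v. Proof. exact: mulr_ge0. Qed.
Local Hint Resolve om_ge0 shorter_ge0 : core.

Lemma decay_Cd_ge1 : 1 <= Cd.
Proof. by have := decay_third omP (leqnn 1 : (1 <= 3 * 0.+1)%N); rewrite (decay0 omP) mulr1; apply. Qed.

Lemma decay_Cw_ge1 : 1 <= Cw.
Proof. by have := decay_sum omP 1; rewrite big_ord1 (decay0 omP) mulr1. Qed.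

Lemma sum_shorterr m : \sum_(u < m) \sum_(v < m) g u v <= Cw.
Proof.
apply: le_trans (decay_sum omP m); rewrite exchange_big; apply: ler_sum => v _ /=.
rewrite -mulr_sumr mulrC; apply: ler_wpM2r => //.
have [vm|vm] := leqP m v.+1.
  apply: le_trans (_ : \sum_(u < m) (1 : R) <= _).
    by apply: ler_sum => u _; rewrite -[leRHS]mulr1n ler_nat leq_b1.
  by rewrite sumr_const card_ord ler_nat.
rewrite -(big_mkord predT (fun u => (u <= v)%:R)).
rewrite (big_cat_nat (n := v.+1)) ?(ltnW vm) //=.
rewrite [X in _ + X]big_nat_cond [X in _ + X]big1 ?addr0; last first.
  by move=> i /andP[/andP[iv _] _]; rewrite leqNgt iv.
rewrite big_mkord; apply: le_trans (_ : \sum_(u < v.+1) (1 : R) <= _).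
  by apply: ler_sum => u _; rewrite -[leRHS]mulr1n ler_nat leq_b1.
by rewrite sumr_const card_ord.
Qed.

Lemma sum_shorterl m : \sum_(u < m) \sum_(v < m) g v u <= Cw.
Proof. by rewrite exchange_big; apply: sum_shorterr. Qed.

Variables (G : finZmodType) (D : G -> R).
Hypothesis D_ge0 : forall y, 0 <= D y.
Local Notation c := (saw_count D).
Variables (sigma K : R) (N : nat).
Hypothesis sigma_ge0 : 0 <= sigma.
Hypothesis K_ge1 : 1 <= K.
Hypothesis c_sup : forall n x, (0 < n <= N)%N -> c n x <= sigma * om n.
Hypothesis c_mass : forall n, (n <= N)%N -> \sum_x c n x <= K.
Hypothesis small : 96 * (sigma * K * Cd * Cw) <= 1.

Let c_ge0 n x : 0 <= c n x. Proof. exact: saw_count_ge0. Qed.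
Let K_ge0 : 0 <= K. Proof. exact: le_trans ler01 K_ge1. Qed.
Let Cd_ge0 : 0 <= Cd. Proof. exact: le_trans ler01 decay_Cd_ge1. Qed.
Let Cw_ge0 : 0 <= Cw. Proof. exact: le_trans ler01 decay_Cw_ge1. Qed.
Local Hint Resolve c_ge0 K_ge0 Cd_ge0 Cw_ge0 : core.
Local Notation B := (ladder_mass D).
Let B_ge0 f n x : 0 <= B f n x. Proof. exact: ladder_mass_ge0. Qed.
Local Hint Resolve B_ge0 : core.

Lemma shorter_le u v : (u <= v)%N -> g u v = om v.
Proof. by move=> uv; rewrite /g uv mulr1. Qed.

Let sumC (a : G) (n : nat) : \sum_y c n (a - y) = \sum_y c n y.
Proof.
rewrite [RHS](reindex_inj (h := fun y => a - y)) //.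
by move=> x y /addrI /oppr_inj.
Qed.

Let sumB f n (a : G) : \sum_y B f n (y - a) = \sum_y B f n y.
Proof. by rewrite [RHS](reindex_inj (addIr (- a))). Qed.

Lemma sumM_lel (F H : G -> R) b : (forall y, F y <= b) -> (forall y, 0 <= H y) ->
  \sum_y F y * H y <= b * \sum_y H y.
Proof. by move=> Fb H0; rewrite mulr_sumr; apply: ler_sum => y _; apply: ler_wpM2r. Qed.

Lemma sumM_ler (F H : G -> R) b : (forall y, F y <= b) -> (forall y, 0 <= H y) ->
  \sum_y H y * F y <= (\sum_y H y) * b.
Proof. by move=> Fb H0; rewrite mulr_suml; apply: ler_sum => y _; apply: ler_wpM2l. Qed.

Section Step.
Variable f : nat.
Hypothesis B_sup : forall m a, (0 < m <= N)%N -> B f m a <= 2 * sigma * om m.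
Hypothesis B_mass : forall m, (0 < m <= N)%N -> \sum_a B f m a <= 2 * K.

(** The two longest legs are bounded in supremum, the shortest one by its mass. The longest has
    about a third of the [m] steps and yields [Cd * om m]; the middle one keeps its own decay and
    the fact that the shortest is below it. A leg [i = 0] has no supremum bound, but it is then the
    shortest. *)
Lemma diagram_sup i l n m a : legs i l n m -> (m <= N)%N ->
  \sum_y c i y * c l (a - y) * B f n (y - a) <=
  2 * K * sigma ^+ 2 * Cd * om m *
    (g i l + g l i + (g i n + g n i) + (g l n + g n l)).
Proof.
move=> /and3P[l0 n0 /eqP e] mN.
have lN : (0 < l <= N)%N by nlia.
have nN : (0 < n <= N)%N by nlia.
have iN : (i <= N)%N by nlia.
have s2 : 0 <= 2 * K * sigma ^+ 2 by rewrite !mulr_ge0 ?exprn_ge0.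
have third u v : (v.+1 <= 3 * u.+1)%N -> om u <= Cd * om v := @decay_third _ _ _ _ omP u v.
suff S : exists u v, [/\ \sum_y c i y * c l (a - y) * B f n (y - a) <=
    2 * K * sigma ^+ 2 * (om u * om v), om u <= Cd * om m &
    om v <= g i l + g l i + (g i n + g n i) + (g l n + g n l)].
  case: S => u [v [S1 S2 S3]]; apply: le_trans S1 _.
  by rewrite -(mulrA _ Cd) -(mulrA _ (Cd * _)); apply: ler_wpM2l => //; apply: ler_pM.
have gg u v : 0 <= g u v by [].
have Xln : \sum_y c i y * c l (a - y) * B f n (y - a) <=
    2 * K * sigma ^+ 2 * (om l * om n).
  apply: (@le_trans _ _ ((\sum_y c i y) * (sigma * om l * (2 * sigma * om n)))).
    under eq_bigr do rewrite -mulrA.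
    by apply: sumM_ler => // y; apply: ler_pM => //; [exact: c_sup|exact: B_sup].
  have -> : 2 * K * sigma ^+ 2 * (om l * om n) =
    K * (sigma * om l * (2 * sigma * om n)) by ring.
  by apply: ler_wpM2r; [rewrite !mulr_ge0|exact: c_mass].
have Xin : (0 < i)%N -> \sum_y c i y * c l (a - y) * B f n (y - a) <=
    2 * K * sigma ^+ 2 * (om i * om n).
  move=> i0; apply: (@le_trans _ _ ((\sum_y c l y) * (sigma * om i * (2 * sigma * om n)))).
    rewrite -(sumC a); under eq_bigr do rewrite mulrAC mulrC.
    apply: sumM_ler => // y; apply: ler_pM => //; last exact: B_sup.
    by apply: c_sup; rewrite i0.
  have -> : 2 * K * sigma ^+ 2 * (om i * om n) =
    K * (sigma * om i * (2 * sigma * om n)) by ring.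
  by apply: ler_wpM2r; [rewrite !mulr_ge0|apply: c_mass; nlia].
have Xil : (0 < i)%N -> \sum_y c i y * c l (a - y) * B f n (y - a) <=
    2 * K * sigma ^+ 2 * (om i * om l).
  move=> i0; apply: (@le_trans _ _ ((sigma * om i * (sigma * om l)) * \sum_y B f n y)).
    rewrite -(sumB f n a); apply: sumM_lel => // y; apply: ler_pM => //; last exact: c_sup.
    by apply: c_sup; rewrite i0.
  have -> : 2 * K * sigma ^+ 2 * (om i * om l) =
    sigma * om i * (sigma * om l) * (2 * K) by ring.
  by apply: ler_wpM2l; [rewrite !mulr_ge0|exact: B_mass].
have [[r1 r2 r3] [r4 r5 r6]] :=
  le_sum6 (gg i l) (gg l i) (gg i n) (gg n i) (gg l n) (gg n l).
have tl : (m.+1 <= 3 * l.+1)%N -> om l <= Cd * om m by apply: third.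
have tn : (m.+1 <= 3 * n.+1)%N -> om n <= Cd * om m by apply: third.
have ti : (m.+1 <= 3 * i.+1)%N -> om i <= Cd * om m by apply: third.
have [iln|] := boolP ((i <= l)%N && (i <= n)%N).
  case/andP: iln => il inn.
  have [ln|nl] := leqP l n.
    exists n, l; rewrite -{2}(shorter_le il); split=> //; first by rewrite (mulrC (om n)).
    by apply: tn; nlia.
  exists l, n; rewrite -{2}(shorter_le inn); split=> //.
  by apply: tl; nlia.
move=> ni; have i0 : (0 < i)%N by nlia.
have [ln|nl] := leqP l n.
  have li : (l <= i)%N by nlia.
  have [inn|nii] := leqP i n.
    exists n, i; rewrite -{2}(shorter_le li); split=> //.
      by rewrite (mulrC (om n)); exact: Xin.
    by apply: tn; nlia.
  exists i, n; rewrite -{2}(shorter_le ln); split=> //; first exact: Xin.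
  by apply: ti; nlia.
have nii : (n <= i)%N by nlia.
have [il|li] := leqP i l.
  exists l, i; rewrite -{2}(shorter_le nii); split=> //.
    by rewrite (mulrC (om l)); exact: Xil.
  by apply: tl; nlia.
exists i, l; rewrite -{2}(shorter_le (ltnW nl)); split=> //; first exact: Xil.
by apply: ti; nlia.
Qed.

(** Summation over [a] detaches the leg [i], which gives its mass. Of the other two the longer is
    bounded in supremum and the shorter in mass. *)
Lemma diagram_mass i l n m : legs i l n m -> (m <= N)%N ->
  \sum_a \sum_y c i y * c l (a - y) * B f n (y - a) <=
  2 * K ^+ 2 * sigma * (g l n + g n l).
Proof.
move=> /and3P[l0 n0 /eqP e] mN.
have lN : (0 < l <= N)%N by nlia.
have nN : (0 < n <= N)%N by nlia.
have iN : (i <= N)%N by nlia.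
have -> : \sum_a \sum_y c i y * c l (a - y) * B f n (y - a) =
    (\sum_y c i y) * \sum_z c l z * B f n (- z).
  rewrite exchange_big mulr_suml; apply: eq_bigr => y _ /=.
  rewrite mulr_sumr [LHS](reindex_inj (addIr y)); apply: eq_bigr => z _ /=.
  by rewrite addrK opprD addrCA subrr addr0 mulrA.
have -> : 2 * K ^+ 2 * sigma * (g l n + g n l) =
   K * (2 * K * sigma * (g l n + g n l)) by ring.
apply: ler_pM; [exact: sumr_ge0| |exact: c_mass|].
  by apply: sumr_ge0 => z _; apply: mulr_ge0.
have := (shorter_ge0 l n, shorter_ge0 n l); case=> g1 g2.
have kk : 0 <= 2 * K * sigma by rewrite !mulr_ge0.
have [ln|nl] := leqP l n.
  apply: (@le_trans _ _ (2 * K * sigma * om n)); last first.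
    by apply: ler_wpM2l => //; rewrite (shorter_le ln); lra.
  apply: (@le_trans _ _ ((\sum_z c l z) * (2 * sigma * om n))).
    by apply: sumM_ler => // z; apply: B_sup.
  have -> : 2 * K * sigma * om n = K * (2 * sigma * om n) by ring.
  by apply: ler_wpM2r; [rewrite !mulr_ge0|apply: c_mass; nlia].
apply: (@le_trans _ _ (2 * K * sigma * om l)); last first.
  by apply: ler_wpM2l => //; rewrite (shorter_le (ltnW nl)); lra.
apply: (@le_trans _ _ ((sigma * om l) * \sum_z B f n (- z))).
  by apply: sumM_lel => // z; apply: c_sup.
have -> : 2 * K * sigma * om l = sigma * om l * (2 * K) by ring.
apply: ler_wpM2l; first by rewrite mulr_ge0.
suff -> : \sum_z B f n (- z) = \sum_z B f n z by apply: B_mass.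
by rewrite [RHS](reindex_inj (@oppr_inj G)).
Qed.

End Step.

Lemma sum_roles m :
  \sum_(i < m) \sum_(l < m) \sum_(n < m) (legs i l n m)%:R *
    (g i l + g l i + (g i n + g n i) + (g l n + g n l)) <= 6 * Cw.
Proof.
have gg := shorter_ge0.
have S1 := @legs_sum_n R m (fun i l => g i l + g l i)
   (fun i l => addr_ge0 (gg i l) (gg l i)).
have S2 := @legs_sum_l R m (fun i l => g i l + g l i)
   (fun i l => addr_ge0 (gg i l) (gg l i)).
have S3 := @legs_sum_i R m (fun i l => g i l + g l i)
   (fun i l => addr_ge0 (gg i l) (gg l i)).
have T : \sum_(i < m) \sum_(l < m) (g i l + g l i) <= 2 * Cw.
  under eq_bigr do rewrite big_split /=.
  rewrite big_split /=; have := sum_shorterr m; have := sum_shorterl m; lra.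
under eq_bigr do under eq_bigr do under eq_bigr do rewrite 2!mulrDr.
under eq_bigr do under eq_bigr do rewrite 2!big_split.
under eq_bigr do rewrite 2!big_split.
rewrite 2!big_split /=; lra.
Qed.

(** Induction on the fuel. With the claimed bounds inserted, a rung adds at most 1/8 of the first
    term, so twice the first term is never exceeded. *)
Lemma ladder_mass_bounds f m : (0 < m <= N)%N ->
  (forall a, B f m a <= 2 * sigma * om m) /\ \sum_a B f m a <= 2 * K.
Proof.
elim: f m => [|f IH] m mN.
  have B0 a : B 0 m a = 0 by rewrite /ladder_mass big1.
  split=> [a|]; first by rewrite B0 !mulr_ge0.
  by rewrite big1 ?mulr_ge0.
have B_sup n a : (0 < n <= N)%N -> B f n a <= 2 * sigma * om n.
  by move=> /IH[].
have B_mass n : (0 < n <= N)%N -> \sum_a B f n a <= 2 * K by move=> /IH[].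
have mN' : (m <= N)%N by nlia.
have sK : 0 <= sigma * K by rewrite mulr_ge0.
split=> [a|].
  rewrite ladder_mass_rec.
  apply: (@le_trans _ _ (sigma * om m + 2 * K * sigma ^+ 2 * Cd * om m * (6 * Cw))).
    apply: lerD; first exact: c_sup.
    apply: le_trans (ler_wpM2l _ (sum_roles m)); last first.
      by rewrite !mulr_ge0 ?exprn_ge0.
    rewrite mulr_sumr; apply: ler_sum => i _; rewrite mulr_sumr.
    apply: ler_sum => l _; rewrite mulr_sumr; apply: ler_sum => n _.
    case E: (legs i l n m); last by rewrite mulr0n !mul0r mulr0.
    by rewrite !mul1r; apply: diagram_sup.
  have -> : sigma * om m + 2 * K * sigma ^+ 2 * Cd * om m * (6 * Cw) =
    sigma * om m * (1 + 12 * (sigma * K * Cd * Cw)) by ring.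
  have -> : 2 * sigma * om m = sigma * om m * 2 by ring.
  apply: ler_wpM2l; first by rewrite mulr_ge0.
  by have := small; lra.
under eq_bigr do rewrite ladder_mass_rec.
rewrite big_split /=.
apply: (@le_trans _ _ (K + 2 * K ^+ 2 * sigma * (2 * Cw))).
  apply: lerD; first exact: c_mass.
  have T : \sum_(i < m) \sum_(l < m) \sum_(n < m) (legs i l n m)%:R *
      (g l n + g n l) <= 2 * Cw.
    apply: le_trans (@legs_sum_i R m (fun l n => g l n + g n l) _) _.
      by move=> i l; rewrite addr_ge0 ?shorter_ge0.
    under eq_bigr do rewrite big_split /=.
    by rewrite big_split /=; have := sum_shorterr m; have := sum_shorterl m; lra.
  apply: le_trans (ler_wpM2l _ T); last by rewrite !mulr_ge0 ?exprn_ge0.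
  rewrite exchange_big mulr_sumr; apply: ler_sum => i _; rewrite mulr_sumr /=.
  rewrite exchange_big; apply: ler_sum => l _; rewrite mulr_sumr /=.
  rewrite exchange_big; apply: ler_sum => n _; rewrite -mulr_sumr /=.
  case E: (legs i l n m); last by rewrite mulr0n !mul0r mulr0.
  by rewrite !mul1r; apply: diagram_mass E mN'.
have : sigma * K * Cw <= 96^-1.
  apply: (@le_trans _ _ (sigma * K * Cd * Cw)); last by have := small; lra.
  rewrite ler_wpM2r // -[leLHS]mulr1; apply: ler_wpM2l => //.
  exact: decay_Cd_ge1.
move=> h; have -> : 2 * K ^+ 2 * sigma * (2 * Cw) = K * (4 * (sigma * K * Cw)) by ring.
have : K * (4 * (sigma * K * Cw)) <= K * 1 by apply: ler_wpM2l => //; lra.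
lra.
Qed.

Variables (w : G -> R) (E : R) (K3 : R).
Hypothesis w_ge0 : forall x, 0 <= w x.
Hypothesis w0 : w 0 = 0.
Hypothesis w_sym : forall x, w (- x) = w x.
Hypothesis w_sub : forall x y, w (x + y) <= 2 * w x + 2 * w y.
Hypothesis K3_ge1 : 1 <= K3.
Hypothesis E_ge0 : 0 <= E.
Hypothesis c_spread : forall n, (n <= N)%N -> \sum_x w x * c n x <= K3 * n%:R * E.
Local Notation V := (ladder_spread D w).
Let V_ge0 f n x : 0 <= V f n x. Proof. exact: ladder_spread_ge0. Qed.
Let K3_ge0 : 0 <= K3. Proof. exact: le_trans ler01 K3_ge1. Qed.
Local Hint Resolve V_ge0 K3_ge0 : core.

Let small' : 96 * (sigma * K * Cw) <= 1.
Proof.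
apply: le_trans small; apply: ler_wpM2l => //; rewrite ler_wpM2r //.
by rewrite -[leLHS]mulr1 ler_wpM2l ?mulr_ge0 //; exact: decay_Cd_ge1.
Qed.

Let sigma_le1 : sigma <= 1.
Proof.
have : sigma * 1 * 1 <= sigma * K * Cw.
  by rewrite -!mulrA !mulr1 ler_peMr // mulr_ege1 //; exact: decay_Cw_ge1.
by have := small'; lra.
Qed.

Let W l : R := 4 * K3 * E * Cd * (l.+1%:R * om l).
Let W_ge0 l : 0 <= W l. Proof. by rewrite !mulr_ge0. Qed.

(* Cutting the walk in the middle: one half carries [w], the other is bounded
   in sup norm. *)
Lemma spread_sup l x : (0 < l <= N)%N -> w x * c l x <= W l.
Proof.
move=> /andP[l0 lN].
(* A single step cannot be cut into two nonempty halves; it is bounded by its whole spread. *)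
have [l1|l1] := leqP l 1.
  have {l0 l1}e : l = 1%N by nlia.
  subst l; apply: le_trans (_ : K3 * 1%:R * E <= _).
    apply: le_trans (c_spread lN); rewrite (bigD1 x) //= lerDl.
    by apply: sumr_ge0 => y _; apply: mulr_ge0.
  rewrite mulr1 /W; have := @decay_third _ _ _ _ omP 0 1 isT.
  rewrite (decay0 omP) => h.
  have KE : 0 <= K3 * E by rewrite mulr_ge0.
  have -> : 4 * K3 * E * Cd * (2 * om 1) = (8 * (Cd * om 1)) * (K3 * E) by ring.
  by rewrite -[leLHS]mul1r; apply: ler_wpM2r => //; lra.
pose i := (l./2)%N; have il : (i <= l)%N by rewrite /i; nlia.
have i0 : (0 < i)%N by rewrite /i; nlia.
rewrite -{1}(subnKC il).
apply: le_trans (ler_wpM2l (w_ge0 x) (saw_count_add D_ge0 _ _ _)) _.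
have iN : (0 < i <= N)%N by nlia.
have jN : (0 < l - i <= N)%N by rewrite /i; nlia.
have oi : om i <= Cd * om l by apply: (decay_third omP); rewrite /i; nlia.
have oj : om (l - i) <= Cd * om l by apply: (decay_third omP); rewrite /i; nlia.
apply: (@le_trans _ _ (\sum_y (2 * (w y * c i y) * c (l - i) (x - y) +
    2 * c i y * (w (x - y) * c (l - i) (x - y))))).
  rewrite mulr_sumr; apply: ler_sum => y _.
  have -> : 2 * (w y * c i y) * c (l - i) (x - y) +
    2 * c i y * (w (x - y) * c (l - i) (x - y)) =
    (2 * w y + 2 * w (x - y)) * (c i y * c (l - i) (x - y)) by ring.
  apply: ler_wpM2r; first exact: mulr_ge0.
  by apply: le_trans (w_sub y (x - y)); rewrite addrC subrK.
rewrite big_split /=.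
have so n : (0 < n <= N)%N -> om n <= Cd * om l -> forall y, c n y <= Cd * om l.
  move=> nN on y; apply: le_trans (c_sup _ nN) _; apply: le_trans on.
  by rewrite -[leRHS]mul1r; apply: ler_wpM2r.
have T1 : \sum_y 2 * (w y * c i y) * c (l - i) (x - y) <=
    (2 * (K3 * l%:R * E)) * (Cd * om l).
  apply: le_trans (@sumM_ler (fun y => c (l - i) (x - y)) (fun y => 2 * (w y * c i y))
    (Cd * om l) _ _) _.
  - by move=> y; apply: so.
  - by move=> y; do !apply: mulr_ge0.
  apply: ler_wpM2r; first by rewrite mulr_ge0.
  rewrite -mulr_sumr; apply: ler_wpM2l => //; apply: le_trans (c_spread _) _; first by nlia.
  by apply: ler_wpM2r => //; apply: ler_wpM2l => //; rewrite ler_nat.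
have T2 : \sum_y 2 * c i y * (w (x - y) * c (l - i) (x - y)) <=
    (2 * (Cd * om l)) * (K3 * l%:R * E).
  apply: le_trans (@sumM_lel (fun y => 2 * c i y) (fun y => w (x - y) * c (l - i) (x - y))
    (2 * (Cd * om l)) _ _) _.
  - by move=> y; apply: ler_wpM2l => //; apply: so.
  - by move=> y; do !apply: mulr_ge0.
  apply: ler_wpM2l; first by rewrite !mulr_ge0.
  have -> : \sum_y w (x - y) * c (l - i) (x - y) = \sum_y w y * c (l - i) y.
    rewrite [RHS](reindex_inj (h := fun y => x - y)) //.
    by move=> y z /addrI /oppr_inj.
  apply: le_trans (c_spread _) _; first by nlia.
  by apply: ler_wpM2r => //; apply: ler_wpM2l => //; rewrite ler_nat leq_subr.
have T3 : K3 * E * Cd * (l%:R * om l) <= K3 * E * Cd * (l.+1%:R * om l).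
  apply: ler_wpM2l; first by rewrite !mulr_ge0.
  by apply: ler_wpM2r => //; rewrite ler_nat.
apply: le_trans (lerD T1 T2) _; rewrite /W; move: T3; nra.
Qed.

Lemma cB_bound f i n a : (i <= N)%N -> (0 < n <= N)%N ->
  \sum_y c i y * B f n (y - a) <= 2 * sigma * K * (g i n + g n i).
Proof.
move=> iN nN; have [Bs Bm] := ladder_mass_bounds f nN.
have := (shorter_ge0 i n, shorter_ge0 n i); case=> g1 g2.
have kk : 0 <= 2 * sigma * K by rewrite !mulr_ge0.
have [inn|ni] := leqP i n.
  apply: (@le_trans _ _ (2 * sigma * K * om n)); last first.
    by apply: ler_wpM2l => //; rewrite (shorter_le inn); lra.
  have -> : 2 * sigma * K * om n = K * (2 * sigma * om n) by ring.
  apply: le_trans (_ : (\sum_y c i y) * (2 * sigma * om n) <= _).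
    by apply: sumM_ler.
  by apply: ler_wpM2r; [rewrite !mulr_ge0|exact: c_mass].
apply: (@le_trans _ _ (2 * sigma * K * om i)); last first.
  by apply: ler_wpM2l => //; rewrite (shorter_le (ltnW ni)); lra.
have -> : 2 * sigma * K * om i = sigma * om i * (2 * K) by ring.
apply: le_trans (_ : (sigma * om i) * (\sum_y B f n (y - a)) <= _).
  by apply: sumM_lel => // y; apply: c_sup; nlia.
by rewrite sumB; apply: ler_wpM2l; [rewrite mulr_ge0|].
Qed.

Lemma cc_bound i l a : (i <= N)%N -> (0 < l <= N)%N ->
  \sum_y c i y * c l (a - y) <= sigma * K * (g i l + g l i).
Proof.
move=> iN lN.
have := (shorter_ge0 i l, shorter_ge0 l i); case=> g1 g2.
have kk : 0 <= sigma * K by rewrite mulr_ge0.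
have [il|li] := leqP i l.
  apply: (@le_trans _ _ (sigma * K * om l)); last first.
    by apply: ler_wpM2l => //; rewrite (shorter_le il); lra.
  have -> : sigma * K * om l = K * (sigma * om l) by ring.
  apply: le_trans (_ : (\sum_y c i y) * (sigma * om l) <= _).
    by apply: sumM_ler => // y; apply: c_sup.
  by apply: ler_wpM2r; [rewrite !mulr_ge0|exact: c_mass].
apply: (@le_trans _ _ (sigma * K * om i)); last first.
  by apply: ler_wpM2l => //; rewrite (shorter_le (ltnW li)); lra.
have -> : sigma * K * om i = sigma * om i * K by ring.
apply: le_trans (_ : (sigma * om i) * (\sum_y c l (a - y)) <= _).
  by apply: sumM_lel => // y; apply: c_sup; nlia.
by rewrite sumC; apply: ler_wpM2l; [rewrite mulr_ge0|apply: c_mass; nlia].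
Qed.

(** Twice the contribution of a first rung that carries [w]; the other half is room for the rest of
    the ladder. *)
Definition spread_const : R := 64 * (sigma * K * K3 * Cd * Cw ^+ 2).

(** Only the total over [m] is bounded. Either the leg [l] of the first rung carries [w], and
    [spread_sup] gives a factor summable in [l], or the rest of the ladder does, and the induction
    hypothesis is multiplied by the small sum over the first rung. *)
Lemma ladder_spread_bound f M a : (M <= N)%N ->
  \sum_(m < M.+1) V f m a <= spread_const * E.
Proof.
have sc0 : 0 <= spread_const by rewrite /spread_const !mulr_ge0 ?exprn_ge0.
elim: f M a => [|f IH] M a MN.
  rewrite big1 ?mulr_ge0 // => m _; rewrite /ladder_spread big1 // => x _.
  by rewrite mulr0.
pose Y i l n := \sum_y c i y * c l (a - y) *
      (2 * w (y - a) * B f n (y - a) + 2 * V f n (y - a)).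
have Y0 i l n : 0 <= Y i l n.
  by apply: sumr_ge0 => y _; rewrite !(mulr_ge0, addr_ge0).
apply: le_trans (_ : \sum_(m < M.+1) \sum_(i < m) \sum_(l < m) \sum_(n < m)
    (legs i l n m)%:R * Y i l n <= _).
  by apply: ler_sum => m _; apply: ladder_spread_rec.
apply: le_trans (legs_cumul _ Y0) _.
pose P i l n : R := ((0 < l)%N && (0 < n)%N)%:R * (2 * (W l *
   (2 * sigma * K * (g i n + g n i)))).
pose Q i l : R := (0 < l)%N%:R * \sum_y c i y * c l (a - y).
have S1 : \sum_(i < M) \sum_(l < M) \sum_(n < M) ((0 < l)%N && (0 < n)%N)%:R * Y i l n <=
  \sum_(i < M) \sum_(l < M) (\sum_(n < M) P i l n) +
  \sum_(i < M) \sum_(l < M) Q i l * (2 * (spread_const * E)).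
  rewrite -big_split /=; apply: ler_sum => -[i /= iM] _.
  rewrite -big_split /=; apply: ler_sum => -[l /= lM] _.
  have -> : \sum_(n < M) ((0 < l)%N && (0 < n)%N)%:R * Y i l n =
    \sum_(n < M) ((0 < l)%N && (0 < n)%N)%:R *
       (2 * \sum_y c i y * (w (y - a) * c l (a - y)) * B f n (y - a)) +
    \sum_(n < M) ((0 < l)%N && (0 < n)%N)%:R *
       (2 * \sum_y c i y * c l (a - y) * V f n (y - a)).
    rewrite -big_split /=; apply: eq_bigr => n _; rewrite -mulrDr; congr (_ * _).
    rewrite !mulr_sumr -big_split /=; apply: eq_bigr => y _; ring.
  have [l0|l0] := posnP l.
    have e0 (F : 'I_M -> R) :
        \sum_(n < M) ((0 < 0)%N && (0 < n)%N)%:R * F n = 0.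
      by rewrite big1 // => n _; rewrite mul0r.
    by rewrite l0 /Q /P !e0 mulr0n !mul0r !addr0.
  apply: lerD.
    apply: ler_sum => -[n /= nM] _; rewrite /P l0 /=.
    have [n0|n0] := posnP n; first by rewrite n0 mulr0n !mul0r.
    rewrite !mul1r; apply: ler_wpM2l => //.
    apply: le_trans (_ : W l * \sum_y c i y * B f n (y - a) <= _).
      rewrite mulr_sumr; apply: ler_sum => y _.
      rewrite (mulrC (c i y)) -mulrA; apply: ler_wpM2r; first exact: mulr_ge0.
      by rewrite -w_sym opprB; apply: spread_sup; nlia.
    by apply: ler_wpM2l => //; apply: cB_bound; nlia.
  rewrite /Q l0 mul1r.
  apply: le_trans (_ : \sum_(n < M) 2 * (\sum_y c i y * c l (a - y) * V f n (y - a)) <= _).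
    apply: ler_sum => n _; rewrite -[leRHS]mul1r; apply: ler_wpM2r.
      by rewrite mulr_ge0 // sumr_ge0 // => y _; rewrite !mulr_ge0.
    by case: (_ && _).
  rewrite -mulr_sumr mulrCA; apply: ler_wpM2l => //.
  rewrite exchange_big mulr_suml; apply: ler_sum => y _ /=.
  rewrite -mulr_sumr; apply: ler_wpM2l; first exact: mulr_ge0.
  case: M iM lM MN => [//|M] _ _ MN; apply: IH; nlia.
apply: le_trans S1 _.
have sWE : \sum_(l < M) W l <= 4 * K3 * E * Cd * Cw.
  rewrite /W -mulr_sumr; apply: ler_wpM2l; first by rewrite !mulr_ge0.
  exact: (decay_sum omP).
have gsum : \sum_(i < M) \sum_(l < M) (g i l + g l i) <= 2 * Cw.
  under eq_bigr do rewrite big_split /=.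
  by rewrite big_split /=; have := sum_shorterr M; have := sum_shorterl M; lra.
have S2 : \sum_(i < M) \sum_(l < M) (\sum_(n < M) P i l n) <=
    (\sum_(l < M) W l) * (4 * sigma * K * (2 * Cw)).
  rewrite exchange_big mulr_suml; apply: ler_sum => l _ /=.
  have -> : W l * (4 * sigma * K * (2 * Cw)) = (4 * sigma * K * W l) * (2 * Cw) by ring.
  apply: le_trans (ler_wpM2l _ gsum); last by rewrite !mulr_ge0.
  rewrite mulr_sumr; apply: ler_sum => i _; rewrite mulr_sumr; apply: ler_sum => n _.
  have -> : 4 * sigma * K * W l * (g i n + g n i) =
     2 * (W l * (2 * sigma * K * (g i n + g n i))) by ring.
  rewrite /P; set b := (_ && _); case: b; rewrite ?mul1r // mulr0n mul0r.
  by have := (shorter_ge0 i n, shorter_ge0 n i); case=> g1 g2; rewrite !(mulr_ge0, addr_ge0).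
have S3 : \sum_(i < M) \sum_(l < M) Q i l * (2 * (spread_const * E)) <=
    (sigma * K * (2 * Cw)) * (2 * (spread_const * E)).
  under eq_bigr do rewrite -mulr_suml.
  rewrite -mulr_suml; apply: ler_wpM2r; first by rewrite !mulr_ge0.
  apply: le_trans (ler_wpM2l _ gsum); last by rewrite mulr_ge0.
  rewrite mulr_sumr; apply: ler_sum => -[i /= iM] _; rewrite mulr_sumr.
  apply: ler_sum => -[l /= lM] _; rewrite /Q; case: (posnP l) => l0.
    have := (shorter_ge0 i l, shorter_ge0 l i); case=> g1 g2.
    by rewrite mulr0n mul0r !(mulr_ge0, addr_ge0).
  by rewrite mul1r; apply: cc_bound; nlia.
have S4 : (\sum_(l < M) W l) * (4 * sigma * K * (2 * Cw)) <=
    4 * K3 * E * Cd * Cw * (4 * sigma * K * (2 * Cw)).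
  by apply: ler_wpM2r => //; rewrite !mulr_ge0.
apply: le_trans (lerD (le_trans S2 S4) S3) _.
have -> : 4 * K3 * E * Cd * Cw * (4 * sigma * K * (2 * Cw)) =
   2^-1 * (spread_const * E) by rewrite /spread_const; field.
have -> : sigma * K * (2 * Cw) * (2 * (spread_const * E)) =
  (4 * (sigma * K * Cw)) * (spread_const * E) by ring.
rewrite -mulrDl -[leRHS]mul1r; apply: ler_wpM2r; first by rewrite mulr_ge0.
by have := small'; lra.
Qed.

Variable f : nat.
Hypothesis D_mass : \sum_y D y <= 2.

Lemma lace_coef_bound m : (1 < m <= N.+1)%N ->
  \sum_x `|lace_coef D f m x| <= 4 * sigma * Cd * om m.
Proof.
move=> mN; apply: le_trans (lace_coef_mass D_ge0 _ _) _.
have mN' : (0 < m.-1 <= N)%N by nlia.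
have [Bs _] := ladder_mass_bounds f mN'.
apply: le_trans (_ : (\sum_y D y) * (2 * sigma * om m.-1) <= _).
  by rewrite mulr_suml; apply: ler_sum => y _; apply: ler_wpM2l.
have -> : 4 * sigma * Cd * om m = 2 * (2 * sigma * (Cd * om m)) by ring.
apply: ler_pM => //; first exact: sumr_ge0.
  by rewrite !mulr_ge0.
by apply: ler_wpM2l; [rewrite mulr_ge0|apply: (decay_third omP); nlia].
Qed.

Lemma lace_coef_spread_sum :
  \sum_(2 <= m < N.+2) \sum_x w x * `|lace_coef D f m x| <=
  2 * spread_const * E.
Proof.
apply: le_trans (_ : \sum_(2 <= m < N.+2) \sum_y D y * V f m.-1 (- y) <= _).
  by apply: ler_sum => m _; apply: lace_coef_spread.
rewrite exchange_big /=.
apply: le_trans (_ : (\sum_y D y) * (spread_const * E) <= _); last first.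
  rewrite -mulrA; apply: ler_wpM2r => //.
  by rewrite /spread_const !mulr_ge0 ?exprn_ge0.
rewrite mulr_suml; apply: ler_sum => y _; rewrite -mulr_sumr; apply: ler_wpM2l => //.
apply: le_trans (ladder_spread_bound f (- y) (leqnn N)).
rewrite big_add1 /= -(big_mkord predT (fun m => V f m (- y))) [leRHS]big_ltn //.
by rewrite lerDr.
Qed.

End DiagramEstimates.

(** * The scalar recursion at a Fourier mode *)

Section Convolution.
Variable R : realDomainType.
Implicit Types f g h : nat -> R.

Definition conv f g n : R := \sum_(i < n.+1) f i * g (n - i)%N.

(** Truncated sequences are polynomials and [conv] is their product; commutativity and associativity
    are inherited from there. *)
Lemma conv_poly f g n N : (n <= N)%N ->
  conv f g n = ((\poly_(i < N.+1) f i) * (\poly_(i < N.+1) g i))`_n.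
Proof.
move=> nN; rewrite coefM; apply: eq_bigr => -[i /= iN] _.
by rewrite !coef_poly !ifT //; lia.
Qed.

Lemma convC f g n : conv f g n = conv g f n.
Proof. by rewrite !(conv_poly _ _ (leqnn n)) mulrC. Qed.

Lemma convA f g h n : conv f (conv g h) n = conv (conv f g) h n.
Proof.
have tr p (q : {poly R}) : (forall i, (i <= n)%N -> p i = q`_i) -> forall f',
    conv f' p n = ((\poly_(i < n.+1) f' i) * q)`_n.
  move=> pq f'; rewrite coefM; apply: eq_bigr => -[i /= iN] _.
  by rewrite coef_poly iN pq // leq_subr.
rewrite [RHS]convC.
rewrite (tr _ ((\poly_(i < n.+1) g i) * (\poly_(i < n.+1) h i))); last first.
  by move=> i iN; apply: conv_poly.
rewrite (tr _ ((\poly_(i < n.+1) f i) * (\poly_(i < n.+1) g i))); last first.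
  by move=> i iN; apply: conv_poly.
by rewrite mulrA mulrC.
Qed.

Lemma eq_conv f f' g g' n : (forall i, (i <= n)%N -> f i = f' i) ->
  (forall i, (i <= n)%N -> g i = g' i) -> conv f g n = conv f' g' n.
Proof.
move=> ff gg; apply: eq_bigr => -[i /= iN] _.
by rewrite ff ?gg ?leq_subr.
Qed.

Lemma ler_conv f f' g g' n : (forall i, (i <= n)%N -> 0 <= f i <= f' i) ->
  (forall i, (i <= n)%N -> 0 <= g i <= g' i) -> conv f g n <= conv f' g' n.
Proof.
move=> ff gg; apply: ler_sum => -[i /= iN] _.
have /andP[f0 f1] := ff _ iN; have /andP[g0 g1] := gg _ (leq_subr i n).
exact: ler_pM.
Qed.

Lemma conv_ge0 f g n : (forall i, (i <= n)%N -> 0 <= f i) ->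
  (forall i, (i <= n)%N -> 0 <= g i) -> 0 <= conv f g n.
Proof.
move=> ff gg; apply: sumr_ge0 => -[i /= iN] _.
by apply: mulr_ge0; [apply: ff|apply: gg; apply: leq_subr].
Qed.

Lemma norm_conv f g n : `|conv f g n| <= conv (fun i => `|f i|) (fun i => `|g i|) n.
Proof.
apply: le_trans (ler_norm_sum _ _ _) _; apply: ler_sum => i _.
by rewrite normrM.
Qed.

Lemma convZr (a : R) f g n : conv f (fun i => a * g i) n = a * conv f g n.
Proof. by rewrite /conv mulr_sumr; apply: eq_bigr => i _; rewrite mulrCA. Qed.

Lemma convDl f f' g n : conv (fun i => f i + f' i) g n = conv f g n + conv f' g n.
Proof. by rewrite /conv -big_split; apply: eq_bigr => i _; rewrite mulrDl. Qed.

Lemma conv_geoS (q : R) g n :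
  conv (fun i => q ^+ i) g n.+1 = g n.+1 + q * conv (fun i => q ^+ i) g n.
Proof.
rewrite /conv big_ord_recl expr0 mul1r subn0; congr (_ + _).
rewrite mulr_sumr; apply: eq_bigr => i _.
by rewrite /= /bump /= add1n subSS exprS mulrA.
Qed.

End Convolution.

(** * Power decay at a given spectral gap *)

Section PowerDecay.
Variables (R : realType) (theta : R).
Implicit Types (t : R) (n m : nat).
Hypothesis theta_gt2 : 2 < theta.

(* [t] stands for [1 - |q|], the spectral gap at a Fourier mode. *)
Definition phi (t : R) (n : nat) : R := (1 + t * n%:R) `^ (- theta).
Local Notation H := (2 `^ theta).

Let theta_ge0 : 0 <= theta. Proof. by apply: ltW; apply: lt_trans theta_gt2. Qed.

Lemma powRN_le (x y c : R) : 0 < x -> 0 < y -> 0 <= c -> y <= c * x ->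
  x `^ (- theta) <= c `^ theta * y `^ (- theta).
Proof.
move=> x0 y0 c0 yx; rewrite !powRN ler_pdivlMr ?powR_gt0 //.
rewrite mulrC ler_pdivrMr ?powR_gt0 // -powRM ?(ltW x0) //.
by apply: ge0_ler_powR; rewrite ?nnegrE ?mulr_ge0 // ltW.
Qed.

Lemma phi_arg_gt0 t n : 0 <= t -> 0 < 1 + t * n%:R.
Proof. by move=> t0; rewrite ltr_pwDl // mulr_ge0. Qed.

Lemma phi_gt0 t n : 0 <= t -> 0 < phi t n.
Proof. by move=> t0; rewrite powR_gt0 // phi_arg_gt0. Qed.

Lemma phi0 t : phi t 0 = 1.
Proof. by rewrite /phi mulr0 addr0 powR1. Qed.

Lemma phi_0 n : phi 0 n = 1.
Proof. by rewrite /phi mul0r addr0 powR1. Qed.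

Lemma phi_anti t n m : 0 <= t -> (n <= m)%N -> phi t m <= phi t n.
Proof.
move=> t0 nm; have := @powRN_le (1 + t * m%:R) (1 + t * n%:R) 1.
rewrite powR1 !mul1r; apply; rewrite ?phi_arg_gt0 //.
by rewrite lerD2l ler_wpM2l // ler_nat.
Qed.

Lemma phi_le1 t n : 0 <= t -> phi t n <= 1.
Proof. by move=> t0; rewrite -(phi0 t); apply: phi_anti. Qed.

Lemma phi_mono_t t t' n : 0 <= t -> t <= t' -> phi t' n <= phi t n.
Proof.
move=> t0 tt; have t'0 := le_trans t0 tt.
have := @powRN_le (1 + t' * n%:R) (1 + t * n%:R) 1.
rewrite powR1 !mul1r; apply; rewrite ?phi_arg_gt0 //.
by rewrite lerD2l ler_wpM2r.
Qed.

Lemma phi_half t n m : 0 <= t -> (n <= 2 * m)%N -> phi t m <= H * phi t n.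
Proof.
move=> t0 nm; apply: powRN_le; rewrite ?phi_arg_gt0 //.
have : t * n%:R <= t * (2 * m%:R) by apply: ler_wpM2l => //; rewrite -natrM ler_nat.
lra.
Qed.

Lemma H_ge1 : 1 <= H.
Proof. by have := @ler_powR R 2 _ 0 theta theta_ge0; rewrite powRr0; apply; lra. Qed.

Lemma phi_le_inv2 t n : 0 <= t -> phi t n <= (1 + t * n%:R) ^- 2.
Proof.
move=> t0; rewrite /phi powRN lef_pV2 ?posrE ?exprn_gt0 ?powR_gt0 ?phi_arg_gt0 //.
rewrite -powR_mulrn ?(ltW (phi_arg_gt0 _ t0)) //.
by apply: ler_powR; rewrite ?(ltW theta_gt2) // lerDl mulr_ge0.
Qed.

Lemma phi_sum t M : 0 <= t <= 1 -> t * \sum_(j < M) phi t j <= 2.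
Proof.
move=> /andP[t0 t1].
(* The bound telescopes: the decrement of [(1 + t * n)^-1] dominates [t * (1 + t * n.+1) ^- 2]. *)
suff S n : t * \sum_(j < n.+1) phi t j <= t + 1 - (1 + t * n%:R)^-1.
  case: M => [|M]; first by rewrite big_ord0 mulr0.
  apply: le_trans (S M) _.
  have : 0 <= (1 + t * M%:R)^-1 by rewrite invr_ge0 ltW // phi_arg_gt0.
  move: t1; lra.
elim: n => [|n IH]; first by rewrite big_ord1 phi0 mulr0 addr0 invr1 mulr1 addrK.
rewrite big_ord_recr mulrDr /=; apply: le_trans (lerD IH (ler_wpM2l t0 (phi_le_inv2 n.+1 t0))) _.
rewrite -addrA lerD2l addrC -[n.+1]addn1 natrD mulrDr mulr1 addrA.
set x := 1 + t * n%:R; have x0 : 0 < x by apply: phi_arg_gt0.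
have xt : 0 < x + t by apply: ltr_pwDl.
rewrite lerBlDr -subr_ge0.
have -> : - (x + t)^-1 + x^-1 - t * (x + t) ^- 2 = (t ^+ 2) / (x * (x + t) ^+ 2).
  by field; rewrite !gt_eqF.
by rewrite divr_ge0 ?exprn_ge0 // mulr_ge0 ?exprn_ge0 // ltW.
Qed.

(** For [t * n >= 1] one has [1 + t * n <= 2 * t * (1 + n)], and [theta > 2] with [t <= 1] turns
    [t ^ theta] into at most [t ^+ 2]. *)
Lemma phi1_le t n : 0 <= t <= 1 -> 1 <= t * n%:R -> phi 1 n <= H * t ^+ 2 * phi t n.
Proof.
move=> /andP[t0 t1] tn.
have tp : 0 < t by rewrite lt_neqAle t0 andbT eq_sym; apply: contraTneq tn => ->; rewrite mul0r ler10.
have := @powRN_le (1 + 1 * n%:R) (1 + t * n%:R) (2 * t).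
move=> /(_ (phi_arg_gt0 _ ler01) (phi_arg_gt0 _ t0) _ _) h.
apply: le_trans (h _ _) _; first by rewrite mulr_ge0.
  by rewrite mul1r; nra.
apply: ler_wpM2r; first exact: powR_ge0.
rewrite powRM //; apply: ler_wpM2l; first exact: powR_ge0.
rewrite -powR_mulrn //.
have e z : t `^ z = (t^-1) `^ (- z) by rewrite -powR_inv1 // -powRrM mulN1r opprK.
rewrite !e; apply: ler_powR; last by rewrite lerN2 ltW.
by rewrite invf_ge1.
Qed.

Lemma pow1D_le (x : R) : 0 <= x -> theta * x <= 2^-1 ->
  (1 + x) `^ theta <= 1 + 2 * (theta * x).
Proof.
move=> x0 tx; have x1 : 0 < 1 + x by rewrite ltr_pwDl.
rewrite /powR gt_eqF //; set y := theta * x in tx *.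
have y0 : 0 <= y by rewrite mulr_ge0.
apply: le_trans (_ : expR y <= _).
  by rewrite ler_expR ler_wpM2l // le_ln1Dx //; lra.
have h := expR_ge1Dx (- y); rewrite expRN in h.
have e0 := expR_gt0 y.
have : (1 - y) * expR y <= 1.
  by move: h; rewrite -ler_pdivlMr // div1r.
by nra.
Qed.

Local Notation A := (4 * theta).
Local Notation C1 := ((2 + A) `^ theta).

Lemma C1_ge2 : 2 <= C1.
Proof.
have A0 : 0 <= A by rewrite mulr_ge0.
apply: le_trans (_ : (2 + A) `^ 1 <= _).
  by rewrite powRr1; lra.
by apply: ler_powR; [lra|have := theta_gt2; lra].
Qed.

Lemma phi_small t n : 0 <= t -> t * n%:R <= 1 + A -> 1 <= C1 * phi t n.
Proof.
move=> t0 tn; have := @powRN_le 1 (1 + t * n%:R) (2 + A).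
have A0 : 0 <= A by rewrite mulr_ge0.
rewrite powR1; apply; rewrite ?phi_arg_gt0 //; lra.
Qed.

(** Since [1 + t * n >= A = 4 * theta], one step lowers [phi t] by a factor at most [1 + t / 2], and
    [(1 - t) * (1 + t / 2) <= 1 - t / 2]. Half of the gap survives. *)
Lemma phi_step t n : 0 <= t <= 1 -> 1 + A <= t * n.+1%:R ->
  (1 - t) * phi t n <= (1 - t / 2) * phi t n.+1.
Proof.
move=> /andP[t0 t1] tn; have th0 : 0 < theta by apply: lt_trans theta_gt2.
set x := 1 + t * n%:R; have x0 : 0 < x by apply: phi_arg_gt0.
have xA : A <= x.
  by move: tn; rewrite /x -(natr1 n) mulrDr mulr1; move: t1; clear; lra.
have xS : 1 + t * n.+1%:R = x * (1 + t / x).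
  by rewrite mulrDr mulr1 mulrCA divff ?gt_eqF // mulr1 /x -(natr1 n) mulrDr mulr1 addrA.
have tx0 : 0 <= t / x by rewrite divr_ge0 // ltW.
have ttx : theta * (t / x) <= t / 4.
  rewrite mulrA ler_pdivrMr // mulrAC ler_pdivlMr // -mulrA (mulrC theta).
  by rewrite -mulrA; apply: ler_wpM2l => //; rewrite mulrC.
have phiE : phi t n = (1 + t / x) `^ theta * phi t n.+1.
  rewrite /phi xS powRM ?(ltW x0) //; last by rewrite addr_ge0.
  rewrite mulrCA -powRD; last first.
    by apply/implyP => _; rewrite gt_eqF // ltr_pwDl.
  by rewrite subrr powRr0 mulr1.
rewrite phiE mulrA; apply: ler_wpM2r; first exact/ltW/phi_gt0.
apply: le_trans (_ : (1 - t) * (1 + 2 * (theta * (t / x))) <= _).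
  by apply: ler_wpM2l; [rewrite subr_ge0|apply: pow1D_le => //; move: ttx t1; clear; lra].
by move: ttx t0 t1; set y := theta * _; clear; nra.
Qed.

Lemma geo_phi t n m : 0 <= t <= 1 -> (m <= n)%N ->
  (1 - t) ^+ (n - m) * phi t m <= C1 * phi t n.
Proof.
move=> t01 mn; have /andP[t0 t1] := t01; rewrite -{2}(subnKC mn).
have q0 : 0 <= 1 - t by rewrite subr_ge0.
have C10 : 0 <= C1 by exact: powR_ge0.
elim: (n - m)%N => [|k IH].
  rewrite mul1r addn0; have := C1_ge2; have := phi_gt0 m t0; nra.
have [small|/ltW large] := leP (t * (m + k.+1)%:R) (1 + A).
  apply: le_trans (phi_small t0 small).
  apply: mulr_ile1; rewrite ?exprn_ge0 ?(ltW (phi_gt0 _ _)) ?phi_le1 //.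
  by apply: exprn_ile1 => //; rewrite gerBl.
rewrite exprS -mulrA; apply: le_trans (ler_wpM2l q0 IH) _.
rewrite mulrCA; apply: ler_wpM2l => //.
rewrite addnS in large *; apply: le_trans (phi_step t01 large) _.
rewrite -[leRHS]mul1r; apply: ler_wpM2r; first exact/ltW/phi_gt0.
by rewrite gerBl divr_ge0.
Qed.

(** While [t * n] is bounded the total geometric mass [1 / t] is enough. Afterwards the [t / 2]
    spared by [phi_step] absorbs the new term [t * phi t n.+1], because [C1 >= 2]. *)
Lemma conv_geo_phi t n : 0 <= t <= 1 ->
  t * conv (fun i => (1 - t) ^+ i) (phi t) n <= C1 * phi t n.
Proof.
move=> t01; have /andP[t0 t1] := t01.
have q0 : 0 <= 1 - t by rewrite subr_ge0.
have C10 : 0 <= C1 by exact: powR_ge0.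
have C12 := C1_ge2.
have mass k : t * conv (fun i => (1 - t) ^+ i) (phi t) k <= 1.
  apply: le_trans (_ : t * \sum_(i < k.+1) (1 - t) ^+ i <= _).
    apply: ler_wpM2l => //; apply: ler_sum => i _; rewrite -[leRHS]mulr1.
    by apply: ler_wpM2l; rewrite ?exprn_ge0 ?phi_le1.
  have : (1 - (1 - t)) * \sum_(i < k.+1) (1 - t) ^+ i = 1 - (1 - t) ^+ k.+1.
    have := subrXX 1 (1 - t) k.+1; rewrite expr1n => ->; congr (_ * _).
    by apply: eq_bigr => i _; rewrite expr1n mul1r.
  by rewrite opprB addrC subrK => ->; rewrite gerBl exprn_ge0.
elim: n => [|n IH].
  by apply: le_trans (mass _) _; rewrite phi0 mulr1; apply: le_trans C12; rewrite ler1n.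
have [small|/ltW large] := leP (t * n.+1%:R) (1 + A).
  exact: le_trans (mass _) (phi_small t0 small).
rewrite conv_geoS mulrDr mulrCA.
apply: le_trans (lerD (lexx _) (ler_wpM2l q0 IH)) _.
have := phi_step t01 large; rewrite (mulrCA (1 - t)).
set x := phi t n.+1; have x0 : 0 < x by apply: phi_gt0.
set z := (1 - t) * _; move=> hz.
apply: le_trans (lerD (lexx _) (ler_wpM2l C10 hz)) _.
rewrite -subr_ge0.
have -> : C1 * x - (t * x + C1 * ((1 - t / 2) * x)) = t * x * (C1 - 2) / 2 by field.
by rewrite !mulr_ge0 ?subr_ge0 // ltW.
Qed.

(* Half of the mass sits in the short lags, where [phi] is doubling; at long
   lags the kernel is smaller than [phi] itself by a factor [t ^+ 2]. *)
Lemma conv_phi_kernel (a : nat -> R) e t n : 0 <= t <= 1 -> 0 <= e ->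
  (forall m, 0 <= a m <= e * phi 1 m) ->
  (forall M, \sum_(m < M) a m <= e * t) ->
  conv a (phi t) n <= (2 * H + 2 * H ^+ 2) * e * t * phi t n.
Proof.
move=> t01 e0 aom asum; have /andP[t0 t1] := t01.
have a0 m : 0 <= a m by have /andP[] := aom m.
have p0 m : 0 <= phi t m by apply/ltW/phi_gt0.
have et : 0 <= e * t by rewrite mulr_ge0.
have H1 := H_ge1; have H0 : 0 <= H by apply: le_trans H1.
rewrite /conv (bigID (fun i : 'I_n.+1 => (2 * i <= n)%N)) /=.
have S1 : \sum_(i < n.+1 | (2 * i <= n)%N) a i * phi t (n - i)%N <=
    H * phi t n * (e * t).
  apply: le_trans (ler_wpM2l _ (asum n.+1)); last by rewrite mulr_ge0.
  rewrite big_mkcond mulr_sumr /=; apply: ler_sum => -[i /= iN] _.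
  case: ifP => h; last by rewrite !mulr_ge0.
  rewrite mulrC; apply: ler_wpM2r => //; apply: phi_half => //.
  by move: h iN; clear; lia.
have S2 : \sum_(i < n.+1 | ~~ (2 * i <= n)%N) a i * phi t (n - i)%N <=
    (H + 2 * H ^+ 2) * (e * t) * phi t n.
  have [tn|/ltW tn] := leP (t * n%:R) 1.
    have h1 : 1 <= H * phi t n.
      have := @powRN_le 1 (1 + t * n%:R) 2; rewrite powR1; apply; rewrite ?phi_arg_gt0 //.
      by rewrite mulr1; move: tn; clear; lra.
    apply: le_trans (_ : e * t <= _).
      apply: le_trans (asum n.+1); rewrite big_mkcond; apply: ler_sum => i _.
      case: ifP => // _; rewrite -[leRHS]mulr1; apply: ler_wpM2l => //.
      exact: phi_le1.
    have -> : (H + 2 * H ^+ 2) * (e * t) * phi t n =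
       (e * t) * (H * phi t n) + 2 * H ^+ 2 * (e * t) * phi t n by ring.
    apply: le_trans (_ : (e * t) * (H * phi t n) <= _).
      by rewrite -[leLHS]mulr1; apply: ler_wpM2l.
    by rewrite lerDl !mulr_ge0 ?exprn_ge0.
  have tp : 0 < t.
    by rewrite lt_neqAle t0 andbT eq_sym; apply: contraTneq tn => ->; rewrite mul0r ler10.
  apply: le_trans (_ : e * (H * phi 1 n) * \sum_(j < n.+1) phi t j <= _).
    rewrite [X in _ <= _ * X](reindex_inj rev_ord_inj) mulr_sumr big_mkcond /=.
    apply: ler_sum => -[i /= iN] _; rewrite subSS.
    case: ifP => h; last first.
      by rewrite mulr_ge0 // mulr_ge0 // mulr_ge0 // ltW // phi_gt0.
    apply: ler_wpM2r => //; have /andP[_ h1] := aom i; apply: le_trans h1 _.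
    by apply: ler_wpM2l => //; apply: phi_half => //; move: h; clear; lia.
  have h2 := phi_sum n.+1 t01; set S := \sum_(j < n.+1) _ in h2 *.
  have S0 : 0 <= S by apply: sumr_ge0.
  apply: le_trans (_ : e * (H * (H * t ^+ 2 * phi t n)) * S <= _).
    by apply: ler_wpM2r => //; do 2 apply: ler_wpM2l => //; apply: phi1_le.
  have -> : e * (H * (H * t ^+ 2 * phi t n)) * S =
    (t * S) * (H ^+ 2 * (e * t) * phi t n) by ring.
  apply: le_trans (ler_wpM2r _ h2) _; first by rewrite !mulr_ge0 ?exprn_ge0.
  have -> : 2 * (H ^+ 2 * (e * t) * phi t n) = 2 * H ^+ 2 * (e * t) * phi t n by ring.
  by apply: ler_wpM2r => //; apply: ler_wpM2r => //; rewrite lerDr.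
apply: le_trans (lerD S1 S2) _.
by rewrite le_eqVlt; apply/orP; left; apply/eqP; ring.
Qed.

(** Discrete comparison of [x ^ - s] with its antiderivative. *)
Lemma inv_pow_telescope (s : R) n : 1 < s ->
  (s - 1) * n.+2%:R `^ (- s) <= n.+1%:R `^ (1 - s) - n.+2%:R `^ (1 - s).
Proof.
move=> s1; have d0 : 0 < s - 1 by rewrite subr_gt0.
have n1 : 0 < n.+1%:R :> R by [].
have n2 : 0 < n.+2%:R :> R by [].
have e : n.+1%:R `^ (1 - s) = n.+2%:R `^ (1 - s) * (n.+1%:R / n.+2%:R) `^ (1 - s).
  by rewrite -powRM ?divr_ge0 // mulrCA divff ?mulr1 ?gt_eqF.
have -> : n.+2%:R `^ (- s) = n.+2%:R `^ (1 - s) / n.+2%:R.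
  rewrite -[n.+2%:R in X in _ / X]powRr1 // -powRB; last by rewrite (gt_eqF n2) implybT.
  by rewrite addrAC subrr add0r.
rewrite e -[X in _ <= _ - X]mulr1 -mulrBr mulrCA; apply: ler_wpM2l; first exact: powR_ge0.
have q0 : 0 < n.+1%:R / n.+2%:R :> R by rewrite divr_gt0.
rewrite /powR gt_eqF //.
apply: le_trans (_ : (1 - s) * ln (n.+1%:R / n.+2%:R) <= _); last first.
  by rewrite lerBrDl expR_ge1Dx.
have -> : n.+1%:R / n.+2%:R = 1 + - (n.+2%:R)^-1 :> R.
  have n2' : n.+2%:R != 0 :> R by rewrite gt_eqF.
  by apply: (mulIf n2'); rewrite mulrDl mulNr mulVf // divfK // mul1r -(natr1 n.+1) addrK.
rewrite -[1 - s]opprB mulNr -mulrN; apply: ler_wpM2l; first exact: ltW.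
by rewrite lerNr le_ln1Dx // ltrN2 invf_lt1 // ltr1n.
Qed.

Lemma phi_decay : decay_seq (phi 1) (3 `^ theta) (1 + (theta - 2)^-1).
Proof.
have d0 : 0 < theta - 2 by rewrite subr_gt0.
split=> [|n|n m|l m lm|M].
- exact: phi0.
- exact: phi_gt0.
- exact: phi_anti.
- apply: powRN_le; rewrite ?phi_arg_gt0 // !mul1r -!(natrD _ 1) -natrM ler_nat.
  by rewrite !add1n.
have e n : n.+1%:R * phi 1 n = n.+1%:R `^ (1 - theta) :> R.
  rewrite /phi mul1r addrC natr1 -{1}[n.+1%:R]powRr1 // -powRD ?(gt_eqF (ltr0Sn R n)) ?implybT //.
under eq_bigr do rewrite e.
case: M => [|M]; first by rewrite big_ord0 addr_ge0 // invr_ge0 ltW.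
rewrite big_ord_recl powR1 lerD2l.
have -> : \sum_(i < M) (bump 0 i).+1%:R `^ (1 - theta) =
  \sum_(0 <= i < M) i.+2%:R `^ (1 - theta) :> R by rewrite big_mkord.
have s1 : 1 < theta - 1 by move: theta_gt2; lra.
rewrite -(ler_pM2l d0) divff ?gt_eqF // mulr_sumr.
apply: le_trans (_ : \sum_(0 <= i < M)
    - (i.+2%:R `^ (2 - theta) - i.+1%:R `^ (2 - theta)) <= _).
  apply: ler_sum => i _; have := inv_pow_telescope i s1.
  have -> : theta - 1 - 1 = theta - 2 by ring.
  have -> : - (theta - 1) = 1 - theta by ring.
  have -> : 1 + (1 - theta) = 2 - theta by ring.
  by rewrite opprB.
rewrite sumrN (telescope_sumr (fun i => i.+1%:R `^ (2 - theta))) // powR1 opprB.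
by rewrite gerBl powR_ge0.
Qed.

End PowerDecay.

(** * Solving the recursion at one mode *)

Section ScalarRecursion.
Variables (R : realType) (theta : R).
Hypothesis theta_gt2 : 2 < theta.
Variables (Ceta : R).
Hypothesis Ceta_ge1 : 1 <= Ceta.

Definition mode_const : R := (2 + 4 * theta) `^ theta.
Definition kernel_const : R := 2 * 2 `^ theta + 2 * (2 `^ theta) ^+ 2.
Definition decay_const : R := 1 + (theta - 2)^-1.
Definition lag_const : R := 2 + Ceta * decay_const.
(** Sum of the three errors in [scalar_recursion], each against [|u| <= 2 * mode_const * phi]: the
    gap part and the tail part of [T], and the part of [Dl]. *)
Definition scalar_const : R :=
  2 * mode_const ^+ 2 * (2 * kernel_const * lag_const + decay_const).
Local Notation C1 := mode_const.
Local Notation CL := kernel_const.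
Local Notation Cw := decay_const.
Local Notation c0 := lag_const.

Lemma mode_const_ge2 : 2 <= C1. Proof. exact: C1_ge2. Qed.
Lemma decay_const_ge1 : 1 <= Cw.
Proof. by rewrite lerDl invr_ge0 subr_ge0 ltW. Qed.
Lemma kernel_const_ge0 : 0 <= CL.
Proof. by rewrite addr_ge0 ?mulr_ge0 ?exprn_ge0 ?powR_ge0. Qed.
Lemma lag_const_ge : 2 <= c0 /\ Ceta * Cw <= c0.
Proof.
have CC : 0 <= Ceta * Cw.
  by rewrite mulr_ge0 // (le_trans ler01) //; exact: decay_const_ge1.
by rewrite /c0; split; move: CC; set z := Ceta * _; lra.
Qed.
Lemma scalar_const_ge0 : 0 <= scalar_const.
Proof.
have [h1 _] := lag_const_ge.
have h2 : 0 <= c0 := le_trans (ler0n R 2) h1.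
have h3 : 0 <= Cw := le_trans ler01 decay_const_ge1.
have h4 := kernel_const_ge0.
by rewrite mulr_ge0 ?mulr_ge0 ?exprn_ge0 ?powR_ge0 // addr_ge0 ?mulr_ge0.
Qed.

Variables (q eps : R) (N : nat) (P Dl u : nat -> R).
Local Notation t := (1 - `|q|).
Local Notation phit := (phi theta t).
Local Notation om := (phi theta 1).
Hypothesis q_le1 : `|q| <= 1.
Hypothesis q_gap : 1 - q <= Ceta * t.
Hypothesis eps_ge0 : 0 <= eps.
Hypothesis P0 : P 0%N = 0.
Hypothesis Dl0 : Dl 0%N = 0.
Hypothesis P_le : forall m, `|P m| <= eps * om m.
Hypothesis Dl_le : forall m, `|Dl m| <= eps * om m.
Hypothesis Dl_sum : forall M, \sum_(m < M) `|Dl m| <= eps * (1 - q).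
Hypothesis u0 : u 0%N = 1.
Hypothesis uS : forall n, (n < N)%N -> u n.+1 =
  (1 - \sum_(m < N.+1) P m) * q * u n + conv (fun m => P m - Dl m) u n.+1.
Hypothesis small : scalar_const * eps <= 1.

Let sP : R := \sum_(m < N.+1) P m.
Let geo i : R := q ^+ i.
Let Qg i : R := (1 - t) ^+ i.
(** [T'] is [geo] convolved with [P - sP * q * delta_1], the perturbation of the free recursion
    [u n.+1 = q * u n]. The formula [T] is valid from lag one on, hence the separate value at 0. *)
Let T r : R := conv P geo r - sP * q ^+ r.
Let T' r : R := if r is 0%N then 0 else T r.

Let t01 : 0 <= t <= 1.
Proof. by rewrite subr_ge0 q_le1 gerBl normr_ge0. Qed.
Let t0 : 0 <= t. Proof. by case/andP: t01. Qed.
Let om_ge0 m : 0 <= om m. Proof. by apply/ltW/phi_gt0. Qed.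
Let phit_ge0 m : 0 <= phit m. Proof. by apply/ltW/phi_gt0. Qed.
Let Qg_ge0 i : 0 <= Qg i.
Proof. by rewrite /Qg exprn_ge0 // opprB addrC subrK. Qed.
Let QgE i : Qg i = `|q ^+ i|.
Proof. by rewrite /Qg opprB addrC subrK normrX. Qed.
Local Hint Resolve om_ge0 phit_ge0 Qg_ge0 : core.

Let T_succ r : T r.+1 = q * T r + P r.+1.
Proof.
by rewrite /T convC conv_geoS convC mulrBr exprS mulrCA; ring.
Qed.

(** Variation of constants around [q ^+ n]. As [T'] and [Dl] vanish at lag 0, the right side
    involves [u] at earlier times only. *)
Lemma duhamel n : (n <= N)%N ->
  u n = q ^+ n + conv T' u n - conv geo (conv Dl u) n.
Proof.
elim: n => [_|n IH nN].
  have conv0 (f g : nat -> R) : conv f g 0 = f 0%N * g 0%N by rewrite /conv big_ord1.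
  by rewrite !conv0 u0 Dl0 !mul0r mulr0 subr0 addr0.
have E1 : conv T' u n.+1 = q * conv T' u n - sP * q * u n + conv P u n.+1.
  have -> : conv P u n.+1 = \sum_(i < n.+1) P i.+1 * u (n - i)%N.
    by rewrite /conv big_ord_recl P0 mul0r add0r.
  have -> : q * conv T' u n - sP * q * u n = q * \sum_(i < n.+1) T i * u (n - i)%N.
    rewrite /conv !big_ord_recl /= mul0r add0r subn0 mulrDr addrC; congr (_ + _).
    rewrite /T /conv big_ord1 P0 mul0r expr0 mulr1 sub0r; ring.
  rewrite /conv big_ord_recl /= mul0r add0r mulr_sumr -big_split /=.
  by apply: eq_bigr => i _; rewrite T_succ /bump /= add1n subSS; ring.
rewrite uS // -/sP E1 conv_geoS.
have -> : conv (fun m => P m - Dl m) u n.+1 = conv P u n.+1 - conv Dl u n.+1.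
  by rewrite /conv -sumrB; apply: eq_bigr => i _; rewrite mulrBl.
have := IH (ltnW nN); set a := conv T' u n; set b := conv geo _ n => e.
have -> : (1 - sP) * q * u n = q * u n - sP * q * u n by ring.
by rewrite {1}e exprS; ring.
Qed.

(** Bounds for the two parts of [T r]: a lag [m <= r] contributes
    [P m * q ^+ (r - m) * (1 - q ^+ m)], which is small with the gap, and the mass of [P] beyond [r]
    is at most [b r], summable because [m * om m] is. *)
Let a m : R := eps * om m * Num.min 2 (Ceta * m%:R * t).
Let b r : R := eps * \sum_(m < N.+1) (r < m)%N%:R * om m.

Let Ceta_ge0 : 0 <= Ceta. Proof. exact: le_trans ler01 Ceta_ge1. Qed.
Let min_ge0 m : 0 <= Num.min 2 (Ceta * m%:R * t) :> R.
Proof. by rewrite le_min ler0n !mulr_ge0. Qed.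
Let a_ge0 m : 0 <= a m. Proof. by rewrite /a !mulr_ge0. Qed.
Let b_ge0 m : 0 <= b m.
Proof. by rewrite /b mulr_ge0 // sumr_ge0 // => i _; rewrite mulr_ge0. Qed.
Local Hint Resolve a_ge0 b_ge0 : core.

Let gap_pow m : `|1 - q ^+ m| <= Num.min 2 (Ceta * m%:R * t).
Proof.
rewrite le_min; apply/andP; split.
  apply: le_trans (ler_normB _ _) _; rewrite normr1 normrX.
  by rewrite (_ : 2 = 1 + 1) // lerD2l exprn_ile1.
have -> : 1 - q ^+ m = (1 - q) * \sum_(i < m) q ^+ i.
  have := subrXX 1 q m; rewrite expr1n => ->; congr (_ * _).
  by apply: eq_bigr => i _; rewrite expr1n mul1r.
have q1 : 0 <= 1 - q by rewrite subr_ge0 (le_trans (ler_norm _)).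
rewrite normrM (ger0_norm q1).
apply: le_trans (_ : (1 - q) * m%:R <= _).
  apply: ler_wpM2l => //; apply: le_trans (ler_norm_sum _ _ _) _.
  apply: le_trans (_ : \sum_(i < m) 1 <= _); last by rewrite sumr_const card_ord.
  by apply: ler_sum => i _; rewrite normrX exprn_ile1.
by rewrite mulrAC; apply: ler_wpM2r.
Qed.

Let T_le r : (r <= N)%N -> `|T r| <= conv a Qg r + b r * Qg r.
Proof.
move=> rN.
have -> : T r = \sum_(i < r.+1) P i * q ^+ (r - i) * (1 - q ^+ i) -
    (\sum_(m < N.+1) (r < m)%N%:R * P m) * q ^+ r.
  rewrite /T; have -> : sP = \sum_(i < r.+1) P i + \sum_(m < N.+1) (r < m)%N%:R * P m.
    rewrite (big_ord_widen N.+1 (fun i => P i)) //.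
    rewrite /sP (bigID (fun i : 'I_N.+1 => (i < r.+1)%N)) /=; congr (_ + _).
    rewrite big_mkcond; apply: eq_bigr => i _; rewrite ltnS leqNgt negbK.
    by case: (r < i)%N; rewrite ?mul1r ?mulr0n ?mul0r.
  rewrite mulrDl opprD addrA; congr (_ - _).
  rewrite /conv mulr_suml -sumrB; apply: eq_bigr => -[i /= ir] _.
  rewrite mulrBr mulr1 -mulrA -exprD subnK //.
apply: le_trans (ler_normB _ _) _; apply: lerD.
  apply: le_trans (ler_norm_sum _ _ _) _; apply: ler_sum => i _.
  rewrite !normrM -QgE /a [leRHS]mulrAC.
  by apply: ler_pM => //; rewrite ?mulr_ge0 //; apply: ler_wpM2r.
rewrite normrM -QgE; apply: ler_wpM2r => //.
apply: le_trans (ler_norm_sum _ _ _) _; rewrite /b mulr_sumr; apply: ler_sum => i _.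
by rewrite normrM normr_nat mulrCA; apply: ler_wpM2l.
Qed.

Let omP := phi_decay theta_gt2.

Let sum_om M : \sum_(n < M) n%:R * om n <= Cw.
Proof.
apply: le_trans (decay_sum omP M); apply: ler_sum => n _.
by apply: ler_wpM2r => //; rewrite ler_nat.
Qed.

Let sum_a M : \sum_(m < M) a m <= c0 * eps * t.
Proof.
apply: le_trans (_ : eps * Ceta * t * \sum_(m < M) m%:R * om m <= _).
  rewrite mulr_sumr; apply: ler_sum => m _; rewrite /a.
  have -> : eps * Ceta * t * (m%:R * om m) = eps * om m * (Ceta * m%:R * t) by ring.
  by apply: ler_wpM2l; [rewrite mulr_ge0|rewrite ge_min lexx orbT].
apply: le_trans (ler_wpM2l _ (sum_om M)) _; first by rewrite !mulr_ge0.
have -> : eps * Ceta * t * Cw = Ceta * Cw * (eps * t) by ring.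
by rewrite -(mulrA c0); apply: ler_wpM2r; [rewrite mulr_ge0|have [] := lag_const_ge].
Qed.

Let c0_ge0 : 0 <= c0. Proof. by have [h _] := lag_const_ge; apply: le_trans h. Qed.

Let conv_a_phi i : conv a phit i <= CL * (c0 * eps) * t * phit i.
Proof.
apply: conv_phi_kernel => //; first by rewrite mulr_ge0.
move=> m; rewrite a_ge0 /= /a -(mulrA c0) (mulrC c0).
apply: le_trans (_ : eps * om m * 2 <= _); last first.
  by apply: ler_wpM2l; [rewrite mulr_ge0|have [] := lag_const_ge].
by apply: ler_wpM2l; [rewrite mulr_ge0|rewrite ge_min lexx].
Qed.

Let conv_Dl_phi i : conv (fun m => `|Dl m|) phit i <= CL * (c0 * eps) * t * phit i.
Proof.
have [c2 cw] := lag_const_ge.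
apply: conv_phi_kernel => //; first by rewrite mulr_ge0.
  move=> m; rewrite normr_ge0 /=; apply: le_trans (Dl_le m) _.
  apply: ler_wpM2r => //; rewrite -[leLHS]mul1r; apply: ler_wpM2r => //.
  by apply: le_trans c2; rewrite ler1n.
move=> M; apply: le_trans (Dl_sum M) _.
rewrite (mulrC c0) -mulrA; apply: ler_wpM2l => //; apply: le_trans q_gap _.
apply: ler_wpM2r => //; apply: le_trans cw.
by rewrite -[leLHS]mulr1; apply: ler_wpM2l => //; exact: decay_const_ge1.
Qed.

Let sum_b M : \sum_(r < M) b r <= eps * Cw.
Proof.
rewrite /b -mulr_sumr; apply: ler_wpM2l => //.
rewrite exchange_big; apply: le_trans (sum_om N.+1); apply: ler_sum => m _ /=.
rewrite -mulr_suml; apply: ler_wpM2r => //.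
apply: le_trans (_ : \sum_(i < maxn M m) ((i < m)%N)%:R <= _).
  by apply: (@ler_sum_widen _ _ _ (fun i => (i < m)%N%:R)) => //; apply: leq_maxl.
rewrite -(big_mkord predT (fun i => (i < m)%N%:R)).
rewrite (@big_cat_nat _ _ _ m) ?leq_maxr //= [X in _ + X]big_nat_cond.
rewrite [X in _ + X]big1 ?addr0; last first.
  by move=> i /andP[/andP[mi _] _]; rewrite ltnNge mi.
rewrite big_mkord; apply: le_trans (_ : \sum_(i < m) (1 : R) <= _).
  by apply: ler_sum => i _; rewrite -[leRHS]mulr1n ler_nat leq_b1.
by rewrite sumr_const card_ord.
Qed.

Let C1_ge0 : 0 <= C1. Proof. exact: powR_ge0. Qed.

Let conv_Qg_le (f : nat -> R) n (z : R) : 0 <= z ->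
  (forall i, (i <= n)%N -> 0 <= f i <= z * t * phit i) ->
  conv Qg f n <= z * C1 * phit n.
Proof.
move=> z0 fz; apply: le_trans (_ : conv Qg (fun i => z * t * phit i) n <= _).
  by apply: ler_conv => i iN; [rewrite Qg_ge0 lexx|apply: fz].
rewrite convZr -!mulrA; apply: ler_wpM2l => //.
exact: (conv_geo_phi theta_gt2).
Qed.

(** Strong induction: only [|u j| <= 2 * C1 * phit j] for [j < n] is needed, and it follows from the
    claim at [j] since [scalar_const * eps <= 1 <= C1]. In the parts of [a] and [Dl] the factor [t]
    gained from the gap is what [conv_geo_phi] consumes. *)
Theorem scalar_recursion n : (n <= N)%N ->
  `|u n - q ^+ n| <= scalar_const * eps * phit n.
Proof.
elim/ltn_ind: n => n IH nN.
have CL0 := kernel_const_ge0; have Cw0 : 0 <= Cw := le_trans ler01 decay_const_ge1.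
have uj j : (j < n)%N -> `|u j| <= 2 * C1 * phit j.
  move=> jn; have jN : (j <= N)%N := leq_trans (ltnW jn) nN.
  have -> : u j = q ^+ j + (u j - q ^+ j) by rewrite addrC subrK.
  apply: le_trans (ler_normD _ _) _.
  have -> : 2 * C1 * phit j = C1 * phit j + C1 * phit j by ring.
  apply: lerD.
    have := geo_phi theta_gt2 t01 (leq0n j); rewrite subn0 phi0 mulr1.
    by rewrite -/(Qg j) QgE.
  apply: le_trans (IH _ jn jN) _; apply: ler_wpM2r => //; apply: le_trans small _.
  by apply: le_trans mode_const_ge2; rewrite ler1n.
have C20 : 0 <= 2 * C1 by rewrite mulr_ge0.
have -> : u n - q ^+ n = conv T' u n - conv geo (conv Dl u) n.
  by rewrite (duhamel nN); ring.
apply: le_trans (ler_normB _ _) _.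
pose TT i := conv a Qg i + b i * Qg i.
have TT0 i : 0 <= TT i by apply: addr_ge0; [apply: conv_ge0|apply: mulr_ge0].
have S1 : `|conv T' u n| <= 2 * C1 * conv TT phit n.
  rewrite -convZr; apply: le_trans (norm_conv _ _ _) _.
  apply: ler_sum => -[i /= iN] _; case: i iN => [|i] iN.
    by rewrite normr0 mul0r !mulr_ge0.
  apply: ler_pM => //; first by apply: T_le; apply: leq_trans nN.
  by apply: uj; rewrite subnSK // leq_subr.
have S2 : conv TT phit n <= CL * c0 * eps * C1 * phit n + eps * Cw * C1 * phit n.
  rewrite convDl; apply: lerD.
    have -> : conv (conv a Qg) phit n = conv Qg (conv a phit) n.
      rewrite convA; apply: eq_conv => // i _; exact: convC.
    apply: conv_Qg_le => [|i _]; first by rewrite !mulr_ge0.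
    by rewrite conv_ge0 //= -(mulrA CL); apply: conv_a_phi.
  apply: le_trans (_ : (\sum_(i < n.+1) b i) * (C1 * phit n) <= _); last first.
    by rewrite -[leRHS]mulrA; apply: ler_wpM2r; [rewrite mulr_ge0|exact: sum_b].
  rewrite mulr_suml; apply: ler_sum => -[i /= iN] _; rewrite -mulrA.
  apply: ler_wpM2l => //.
  by have := geo_phi theta_gt2 t01 (leq_subr i n); rewrite subKn.
have S3 : `|conv geo (conv Dl u) n| <= 2 * C1 * (CL * c0 * eps * C1 * phit n).
  apply: le_trans (norm_conv _ _ _) _.
  apply: le_trans (_ : conv Qg (fun i => 2 * C1 * conv (fun m => `|Dl m|) phit i) n <= _).
    apply: ler_conv => i iN; first by rewrite normr_ge0 /= QgE.
    rewrite normr_ge0 -convZr /=; apply: le_trans (norm_conv _ _ _) _.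
    apply: ler_sum => -[m /= mi] _; case: m mi => [|m] mi.
      by rewrite Dl0 normr0 !mul0r.
    apply: ler_wpM2l => //; apply: uj; apply: leq_trans iN.
    by rewrite subnSK // leq_subr.
  rewrite convZr; apply: ler_wpM2l => //; apply: conv_Qg_le => [|i _].
    by rewrite !mulr_ge0.
  by rewrite conv_ge0 //= -(mulrA CL); apply: conv_Dl_phi.
apply: le_trans (lerD (le_trans S1 (ler_wpM2l C20 S2)) S3) _.
by rewrite le_eqVlt /scalar_const; apply/orP; left; apply/eqP; ring.
Qed.

Corollary scalar_recursion_le n : (n <= N)%N -> `|u n| <= 2 * C1 * phit n.
Proof.
move=> nN; have -> : u n = q ^+ n + (u n - q ^+ n) by rewrite addrC subrK.
apply: le_trans (ler_normD _ _) _.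
have -> : 2 * C1 * phit n = C1 * phit n + C1 * phit n by ring.
apply: lerD.
  have := geo_phi theta_gt2 t01 (leq0n n); rewrite subn0 phi0 mulr1.
  by rewrite -/(Qg n) QgE.
apply: le_trans (scalar_recursion nN) _; apply: ler_wpM2r => //.
by apply: le_trans small _; apply: le_trans mode_const_ge2; rewrite ler1n.
Qed.

End ScalarRecursion.

(** * Induction on the time horizon *)

Section Scaling.
Variables (R : realType) (G : finZmodType) (D : G -> R) (lam : R).
Implicit Types (s A : seq G) (x y : G) (n m f : nat).
Local Notation lD := (fun y => lam * D y).

(** The fugacity is put into the steps, so that all estimates for a general [D] apply to
    [lam ^+ n * c n]. *)
Lemma wsum_scale n Phi : wsum lD n Phi = lam ^+ n * wsum D n Phi.
Proof.
elim: n Phi => [|n IH] Phi /=; first by rewrite mul1r.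
rewrite mulr_sumr; apply: eq_bigr => y _; rewrite IH exprS; ring.
Qed.

Lemma saw_count_scale n x : saw_count lD n x = lam ^+ n * saw_count D n x.
Proof. exact: wsum_scale. Qed.

Lemma lace_scale f m A x : lace lD f m A x = lam ^+ m * lace D f m A x.
Proof.
elim: f m A x => [|f IH] m A x /=; first by rewrite mulr0.
rewrite mulrBr mulrN wsum_scale; congr (_ - _).
rewrite mulr_sumr; apply: eq_big_nat => j /andP[_ jm].
have -> : lam ^+ m = lam ^+ j * lam ^+ (m - j) by rewrite -exprD subnKC // ltnW.
rewrite wsum_scale -mulrA; congr (_ * _); rewrite -wsumZ.
by apply: eq_wsum => s _; rewrite IH mulrCA.
Qed.

Lemma lace_coef_scale f m x : (0 < m)%N ->
  lace_coef lD f m x = lam ^+ m * lace_coef D f m x.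
Proof.
move=> m0; rewrite /lace_coef mulr_sumr; apply: eq_bigr => y _.
by rewrite lace_scale -{3}(prednK m0) exprS; ring.
Qed.

End Scaling.

Section Symmetry.
Variables (R : realType) (G : finZmodType) (D : G -> R).
Hypothesis D_sym : forall y, D (- y) = D y.
Implicit Types (s : seq G) (x : G) (n : nat).

Lemma ssum_opp s : ssum (map -%R s) = - ssum s.
Proof. by rewrite /ssum big_map sumrN. Qed.

Lemma pos_opp s i : pos (map -%R s) i = - pos s i.
Proof. by rewrite /pos -map_take ssum_opp. Qed.

Lemma saw_opp s : saw (map -%R s) = saw s.
Proof.
rewrite /saw size_map -(map_inj_uniq (@oppr_inj G)) -map_comp.
by congr uniq; apply: eq_map => i /=; rewrite pos_opp opprK.
Qed.

Lemma wsum_opp n Phi : wsum D n Phi = wsum D n (fun s => Phi (map -%R s)).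
Proof.
elim: n Phi => [//|n IH] Phi /=; rewrite (reindex_inj (@oppr_inj G)).
by apply: eq_bigr => y _; rewrite D_sym IH.
Qed.

Lemma saw_count_sym n x : saw_count D n (- x) = saw_count D n x.
Proof.
rewrite /saw_count [RHS]wsum_opp; apply: eq_wsum => s _.
by rewrite saw_opp ssum_opp eqr_oppLR.
Qed.

End Symmetry.

(* Real and imaginary parts of a character of [G]. *)
Record character (R : realType) (G : finZmodType) (ck sk : G -> R) : Prop := Character {
  char0 : ck 0 = 1;
  charD : forall x y, ck (x + y) = ck x * ck y - sk x * sk y;
  charN : forall x, ck (- x) = ck x;
  charN_sin : forall x, sk (- x) = - sk x }.

(** * Fourier analysis with real characters *)

Section Characters.
Variables (R : realType) (G : finZmodType) (ck sk : G -> R).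
Hypothesis chi : character ck sk.
Implicit Types (x y : G) (f g : G -> R).

Lemma char_norm x : ck x ^+ 2 + sk x ^+ 2 = 1.
Proof.
have := charD chi x (- x); rewrite subrr (char0 chi) (charN chi) (charN_sin chi).
by move->; ring.
Qed.

Lemma char_abs x : `|ck x| <= 1.
Proof.
rewrite -[_ <= 1](@ler_pXn2r _ 2) ?nnegrE // expr1n real_normK ?num_real //.
by rewrite -(char_norm x) lerDl sqr_ge0.
Qed.

Lemma char_gap_ge0 x : 0 <= 1 - ck x.
Proof. by rewrite subr_ge0; apply: le_trans (ler_norm _) (char_abs x). Qed.

(** [2 * (1 - ck x)] is the squared chord from 1 to the value of the character at [x]. The triangle
    inequality for chords, squared, costs the factor 2. *)
Lemma char_gap_sub x y : 1 - ck (x + y) <= 2 * (1 - ck x) + 2 * (1 - ck y).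
Proof.
rewrite (charD chi); have := char_norm x; have := char_norm y.
set a := ck x; set b := ck y; set c := sk x; set d := sk y => h1 h2.
have : 0 <= (c - d) ^+ 2 + (2 - a - b) ^+ 2 by rewrite addr_ge0 ?sqr_ge0.
nra.
Qed.

Definition fourier f : R := \sum_x ck x * f x.

Lemma fourier_gap f : \sum_x (1 - ck x) * f x = \sum_x f x - fourier f.
Proof. by rewrite /fourier -sumrB; apply: eq_bigr => x _; rewrite mulrBl mul1r. Qed.

Lemma sum_odd f : (forall x, f (- x) = f x) -> \sum_x sk x * f x = 0.
Proof.
move=> fe; have : \sum_x sk x * f x = - \sum_x sk x * f x.
  rewrite {1}(reindex_inj (@oppr_inj G)) -sumrN; apply: eq_bigr => x _.
  by rewrite (charN_sin chi) fe mulNr.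
by move/eqP; rewrite -addr_eq0 -mulr2n mulrn_eq0 /= => /eqP.
Qed.

(** Evenness of [g] removes the sine term, so the cosine transform is multiplicative. *)
Lemma fourier_conv f g : (forall x, g (- x) = g x) ->
  fourier (fun x => \sum_y f y * g (x - y)) = fourier f * fourier g.
Proof.
move=> ge; rewrite /fourier mulr_suml.
under eq_bigr do rewrite mulr_sumr.
rewrite exchange_big; apply: eq_bigr => y _ /=.
rewrite (reindex_inj (addrI y)) /=.
under eq_bigr => x _ do rewrite (addrC y) addrK (addrC x) (charD chi).
have -> : \sum_i (ck y * ck i - sk y * sk i) * (f y * g i) =
   f y * ck y * (\sum_i ck i * g i) - f y * sk y * \sum_i sk i * g i.
  rewrite !mulr_sumr -sumrB; apply: eq_bigr => x _; ring.
by rewrite sum_odd // mulr0 subr0 (mulrC (f y)) mulr_sumr.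
Qed.

Lemma fourier_shift f x : (forall x, f (- x) = f x) ->
  \sum_y f y * ck (x - y) = ck x * fourier f.
Proof.
move=> fe; rewrite /fourier.
have -> : \sum_y f y * ck (x - y) =
   ck x * (\sum_y ck y * f y) + sk x * \sum_y sk y * f y.
  rewrite !mulr_sumr -big_split; apply: eq_bigr => y _ /=.
  by rewrite (charD chi) (charN chi) (charN_sin chi); ring.
by rewrite sum_odd // mulr0 addr0.
Qed.

Lemma fourier_abs f : `|fourier f| <= \sum_x `|f x|.
Proof.
apply: le_trans (ler_norm_sum _ _ _) _; apply: ler_sum => x _.
by rewrite normrM -[leRHS]mul1r; apply: ler_wpM2r => //; apply: char_abs.
Qed.

End Characters.

(** Fourier inversion for an even function. *)
Lemma fourier_sup (R : realType) (G : finZmodType) (I : finType)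
    (ck sk : I -> G -> R) (f : G -> R) x :
  (forall k, character (ck k) (sk k)) ->
  (forall x, \sum_k ck k x = #|I|%:R * (x == 0)%:R) ->
  (forall x, f (- x) = f x) ->
  #|I|%:R * f x <= \sum_k `|fourier (ck k) f|.
Proof.
move=> chi ortho fe.
have -> : #|I|%:R * f x = \sum_k ck k x * fourier (ck k) f.
  transitivity (\sum_y f y * \sum_k ck k (x - y)).
    rewrite (bigD1 x) //= ortho subrr eqxx mulr1 mulrC big1 ?addr0 // => y yx.
    by rewrite ortho subr_eq0 eq_sym (negbTE yx) !mulr0.
  under eq_bigr do rewrite mulr_sumr.
  by rewrite exchange_big; apply: eq_bigr => k _ /=; rewrite (fourier_shift (chi k)).
apply: ler_sum => k _; apply: le_trans (ler_norm _) _.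
by rewrite normrM -[leRHS]mul1r; apply: ler_wpM2r => //; apply: (char_abs (chi k)).
Qed.

(** The new term disturbs the equation by at most [e]. Replacing [lam] by [lam * (1 + z)] moves the
    left side by [lam * z] up to an error [|z| / 4]; with [lam >= 1/2] and [4 * e <= s] the sign
    changes between [z = - s] and [z = s]. *)
Lemma root_near (R : rcfType) (M : nat) (p : nat -> R) (lam s e : R) :
  0 < lam -> 0 <= s -> s <= 1 -> M%:R * s <= 4^-1 ->
  1 <= 2 * lam ->
  lam + \sum_(2 <= m < M) p m * lam ^+ m = 1 ->
  \sum_(2 <= m < M.+1) m%:R * `|p m * lam ^+ m| <= 8^-1 ->
  `|p M * lam ^+ M| <= e -> 4 * e <= s ->
  exists2 lam' : R, lam * (1 - s) <= lam' <= lam * (1 + s) &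
    lam' + \sum_(2 <= m < M.+1) p m * lam' ^+ m = 1.
Proof.
move=> l0 s0 s1 Ms l2 eq0 S8 eM es.
have pw m z : (m <= M)%N -> `|z| <= s -> `|(1 + z) ^+ m - 1| <= 2 * m%:R * `|z|.
  move=> mM zs; have ms : m%:R * `|z| <= 4^-1.
    apply: le_trans Ms; apply: ler_pM => //; by rewrite ler_nat.
  suff : `|(1 + z) ^+ m - 1| <= 2 * m%:R * `|z| /\ `|(1 + z) ^+ m| <= 2 by case.
  elim: m mM ms => [|m IH] mM ms; first by rewrite subrr normr0 mulr0 mul0r normr1 ler1n.
  have [|h1 h2] := IH (ltnW mM).
    by apply: le_trans ms; apply: ler_wpM2r => //; rewrite ler_nat.
  have h3 : `|(1 + z) ^+ m.+1 - 1| <= 2 * m.+1%:R * `|z|.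
    have -> : (1 + z) ^+ m.+1 - 1 = ((1 + z) ^+ m - 1) + z * (1 + z) ^+ m.
      by rewrite exprS; ring.
    apply: le_trans (ler_normD _ _) _; rewrite normrM -(natr1 m) mulrDr mulr1 mulrDl.
    by apply: lerD => //; rewrite mulrC; apply: ler_wpM2r.
  split=> //; have -> : (1 + z) ^+ m.+1 = 1 + ((1 + z) ^+ m.+1 - 1) by ring.
  apply: le_trans (ler_normD _ _) _; rewrite normr1.
  by move: ms h3; rewrite -mulrA; set a := _ * `|z|; set b := `|_ - 1|; lra.
pose g := 'X + \sum_(2 <= m < M.+1) p m *: 'X^m - 1 : {poly R}.
have gE x : g.[x] = x + \sum_(2 <= m < M.+1) p m * x ^+ m - 1.
  rewrite /g !hornerE horner_sum; congr (_ + _ - _); apply: eq_bigr => m _.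
  by rewrite !hornerE.
have g0 : `|lam + \sum_(2 <= m < M.+1) p m * lam ^+ m - 1| <= e.
  have e0 : 0 <= e by apply: le_trans eM.
  have [M2|M2] := ltnP M 2.
    move: eq0; rewrite (big_geq (n := M)) ?(ltnW M2) // addr0 => ->.
    by rewrite big_geq // addr0 subrr normr0.
  by rewrite big_nat_recr //= addrA eq0 [1 + _]addrC addrK.
have dev z : `|z| <= s -> `|g.[lam * (1 + z)] - lam * z -
    (lam + \sum_(2 <= m < M.+1) p m * lam ^+ m - 1)| <= 4^-1 * `|z|.
  move=> zs; rewrite gE.
  have -> : lam * (1 + z) + \sum_(2 <= m < M.+1) p m * (lam * (1 + z)) ^+ m - 1 -
      lam * z - (lam + \sum_(2 <= m < M.+1) p m * lam ^+ m - 1) =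
      \sum_(2 <= m < M.+1) p m * (lam * (1 + z)) ^+ m -
      \sum_(2 <= m < M.+1) p m * lam ^+ m by ring.
  rewrite -sumrB; apply: le_trans (ler_norm_sum _ _ _) _.
  apply: le_trans (_ : \sum_(2 <= m < M.+1) (m%:R * `|p m * lam ^+ m|) * (2 * `|z|) <= _).
    apply: ler_sum_nat => m /andP[m2 mM].
    have -> : p m * (lam * (1 + z)) ^+ m - p m * lam ^+ m =
       (p m * lam ^+ m) * ((1 + z) ^+ m - 1) by rewrite exprMn; ring.
    rewrite normrM (mulrC m%:R) -mulrA; apply: ler_wpM2l => //.
    by rewrite mulrA (mulrC m%:R); apply: pw.
  rewrite -mulr_suml; apply: le_trans (ler_wpM2r _ S8) _; first by rewrite mulr_ge0.
  by move: (normr_ge0 z); lra.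
have lo : g.[lam * (1 - s)] <= 0.
  have := dev (- s); rewrite normrN (ger0_norm s0) => /(_ (lexx s)).
  move: g0; set g1 := (_ + _ - 1); rewrite !ler_norml => /andP[a1 a2] /andP[a3 a4].
  have : s <= 2 * lam * s by rewrite ler_peMl.
  by move: a1 a2 a3 a4 es; rewrite mulrN opprK; nra.
have hi : 0 <= g.[lam * (1 + s)].
  have := dev s; rewrite (ger0_norm s0) => /(_ (lexx s)).
  move: g0; set g1 := (_ + _ - 1); rewrite !ler_norml => /andP[a1 a2] /andP[a3 a4].
  have : s <= 2 * lam * s by rewrite ler_peMl.
  by move: a1 a2 a3 a4 es; nra.
have le : lam * (1 - s) <= lam * (1 + s).
  by apply: ler_wpM2l; [exact: ltW|lra].
have [x xI] := poly_ivt le (introT andP (conj lo hi)).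
rewrite /root gE subr_eq0 => /eqP gx; exists x => //.
Qed.

Lemma pow1D_le2 (R : realFieldType) (s : R) n : 0 <= s -> n%:R * s <= 4^-1 ->
  (1 + s) ^+ n <= 2.
Proof.
move=> s0 ns; suff : (1 + s) ^+ n <= 1 + 2 * (n%:R * s) by move: ns; lra.
elim: n ns => [|n IH] ns; first by rewrite expr0 mul0r mulr0 addr0.
have ns' : n%:R * s <= 4^-1 by apply: le_trans ns; rewrite ler_wpM2r // ler_nat.
rewrite exprSr; apply: le_trans (ler_wpM2r _ (IH ns')) _; first by rewrite addr_ge0.
rewrite -(natr1 n) (mulrDl n%:R) mul1r.
have : n%:R * s * s <= 4^-1 * s by apply: ler_wpM2r.
move: (n%:R * s) ns' => z zs.
have -> : (1 + 2 * z) * (1 + s) = 1 + 2 * z + s + 2 * (z * s) by ring.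
by move: (z * s) => y; lra.
Qed.

Lemma sum_nat2_ord (R : zmodType) n (F : nat -> R) : F 0%N = 0 -> F 1%N = 0 ->
  \sum_(m < n) F m = \sum_(2 <= m < n) F m.
Proof.
move=> F0 F1; rewrite -(big_mkord predT F).
case: n => [|[|n]]; first by rewrite !big_geq.
  by rewrite big_ltn // F0 add0r !big_geq.
by rewrite big_ltn // F0 add0r big_ltn // F1 add0r.
Qed.

(** * Critical fugacity and bootstrap *)

Section SawCore.
Variables (R : realType) (theta Ceta : R).
Hypothesis theta_gt2 : 2 < theta.
Hypothesis Ceta_ge1 : 1 <= Ceta.
Local Notation om := (phi theta 1).
Local Notation C1 := (mode_const theta).
Local Notation Cd := (3 `^ theta).
Local Notation Cw := (decay_const theta).
Local Notation sc := (scalar_const theta Ceta).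

(** In [sup_step] two free steps with [lam' <= 2] and the mode bound [2 * C1] make the 8, and [Cd]
    replaces [om n] by [om n.+2]. *)
Definition sup_const : R := 8 * C1 * Cd.
Definition gap_const : R := 12 * C1.
(** The first summand is for the decay of the lace coefficients, the second for their spread; both
    are taken at the doubled constants of the bootstrap. *)
Definition lace_const : R :=
  16 * sup_const * Cd + 32 * 64 * (sup_const * gap_const * Cd * Cw ^+ 2).
Definition small_const : R :=
  12 * 64 * (sup_const * Cd * Cw) + 8 * lace_const + 2 * (sc * lace_const) +
  8 * (lace_const * Cw).
Local Notation K1 := sup_const.
Local Notation K3 := gap_const.
Local Notation Ke := lace_const.

Variables (G : finZmodType) (D : G -> R) (I : finType) (ck sk : I -> G -> R).
Variables (beta : R) (N : nat).
Hypothesis D_ge0 : forall y, 0 <= D y.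
Hypothesis D_sym : forall y, D (- y) = D y.
Hypothesis D0 : D 0 = 0.
Hypothesis D_mass : \sum_y D y = 1.
Hypothesis chi : forall k, character (ck k) (sk k).
Hypothesis I_gt0 : (0 < #|I|)%N.
Hypothesis ortho : forall x, \sum_k ck k x = #|I|%:R * (x == 0)%:R.
Local Notation q k := (fourier (ck k) D).
Hypothesis q_gap : forall k, 1 - q k <= Ceta * (1 - `|q k|).
Hypothesis beta_ge0 : 0 <= beta.
Hypothesis D_sup : forall y, D y <= beta.
Hypothesis mode_decay : forall n, (n <= N)%N ->
  \sum_k q k ^+ 2 * phi theta (1 - `|q k|) n <= #|I|%:R * (beta * om n).
Hypothesis beta_small : beta * small_const <= 1.

Local Notation c := (saw_count D).
Local Notation phat m := (\sum_x lace_coef D N m x).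

(** [ctl_eq] is criticality: the recursion of the total mass has weights of sum 1, so the mass
    neither grows nor decays. *)
Record controlled (M : nat) (lam : R) : Prop := Controlled {
  ctl_lam : 2^-1 <= lam <= 3 / 2;
  ctl_eq : lam + \sum_(2 <= m < M.+1) phat m * lam ^+ m = 1;
  ctl_sup : forall n x, (0 < n <= M)%N -> lam ^+ n * c n x <= K1 * beta * om n;
  ctl_mass : forall n, (n <= M)%N -> 2^-1 <= \sum_x lam ^+ n * c n x <= 2;
  ctl_gap : forall k n, (n <= M)%N ->
    \sum_x (1 - ck k x) * (lam ^+ n * c n x) <= K3 * n%:R * (1 - q k);
  ctl_mode : forall k n, (n <= M)%N ->
    `|fourier (ck k) (fun x => lam ^+ n * c n x)| <=
    2 * C1 * phi theta (1 - `|q k|) n }.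

Let omP : decay_seq om Cd Cw := phi_decay theta_gt2.
Let om_ge0 n : 0 <= om n. Proof. exact/ltW/(decay_gt0 omP). Qed.
Let C1_ge2 : 2 <= C1. Proof. exact: mode_const_ge2. Qed.
Let C1_ge0 : 0 <= C1. Proof. exact: powR_ge0. Qed.
Let Cd_ge0 : 0 <= Cd. Proof. exact: powR_ge0. Qed.
Let Cw_ge1 : 1 <= Cw. Proof. exact: decay_Cw_ge1 omP. Qed.
Let Cw_ge0 : 0 <= Cw. Proof. exact: le_trans ler01 Cw_ge1. Qed.
Let sc_ge0 : 0 <= sc. Proof. exact: scalar_const_ge0. Qed.
Let K1_ge0 : 0 <= K1. Proof. by rewrite !mulr_ge0. Qed.
Let K3_ge0 : 0 <= K3. Proof. by rewrite mulr_ge0. Qed.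
Let part1_ge0 : 0 <= 16 * K1 * Cd. Proof. by rewrite !mulr_ge0. Qed.
Let part2_ge0 : 0 <= 32 * 64 * (K1 * K3 * Cd * Cw ^+ 2).
Proof. by rewrite !mulr_ge0 ?exprn_ge0. Qed.
Let Ke_ge0 : 0 <= Ke. Proof. by rewrite addr_ge0. Qed.
Local Hint Resolve om_ge0 C1_ge0 Cd_ge0 Cw_ge0 sc_ge0 K1_ge0 K3_ge0 Ke_ge0 : core.

Let smalls : [/\ 12 * 64 * (beta * (K1 * Cd * Cw)) <= 1, 8 * (beta * Ke) <= 1,
  2 * (sc * (beta * Ke)) <= 1 & 8 * (beta * Ke * Cw) <= 1].
Proof.
have h : beta * small_const = 12 * 64 * (beta * (K1 * Cd * Cw)) + 8 * (beta * Ke) +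
    2 * (sc * (beta * Ke)) + 8 * (beta * Ke * Cw) by rewrite /small_const; ring.
have := beta_small; rewrite h.
have h1 : 0 <= beta * (K1 * Cd * Cw) by rewrite !mulr_ge0.
have h2 : 0 <= beta * Ke by rewrite mulr_ge0.
have h3 : 0 <= sc * (beta * Ke) by rewrite mulr_ge0.
have h4 : 0 <= beta * Ke * Cw by rewrite mulr_ge0.
move: (beta * (K1 * Cd * Cw)) (sc * (beta * Ke)) (beta * Ke * Cw) h1 h3 h4.
move: (beta * Ke) h2 => a a0 b1 b2 b3 b10 b20 b30 s.
by split; lra.
Qed.

Let c_ge0 n x : 0 <= c n x. Proof. exact: saw_count_ge0. Qed.
Local Hint Resolve c_ge0 : core.
Let E_ge0 k : 0 <= 1 - q k.
Proof.
rewrite -D_mass -(fourier_gap (ck k) D); apply: sumr_ge0 => x _.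
by rewrite mulr_ge0 // (char_gap_ge0 (chi k)).
Qed.
Let q_abs k : `|q k| <= 1.
Proof.
rewrite -D_mass; apply: le_trans (fourier_abs (chi k) D) _.
by apply: ler_sum => x _; rewrite ger0_norm.
Qed.
Local Hint Resolve E_ge0 : core.

Let scaleE lam n x : saw_count (fun y => lam * D y) n x = lam ^+ n * c n x.
Proof. exact: saw_count_scale. Qed.

Let om1_term m : m%:R * om m <= Cw.
Proof.
apply: le_trans (decay_sum omP m.+1); rewrite big_ord_recr /=.
apply: le_trans (_ : m.+1%:R * om m <= _); first by rewrite ler_wpM2r // ler_nat.
by rewrite lerDr sumr_ge0 // => i _; rewrite mulr_ge0.
Qed.

(** [s] is four times the bound on the new coefficient, as [root_near] requires. Because [m * om m]
    stays below [Cw], it is small even when multiplied by [M.+1], which keeps the powers of [lam]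
    under control. *)
Lemma next_lam M lam : controlled M lam -> exists lam' s, [/\ 0 <= s,
  M.+1%:R * s <= 4^-1, lam * (1 - s) <= lam' <= lam * (1 + s) &
  lam' + \sum_(2 <= m < M.+2) phat m * lam' ^+ m = 1].
Proof.
move=> [/andP[l1 l2] leq lsup lmass lgap _]; have [s1 s2 s3 s4] := smalls.
case: M leq lsup lmass lgap => [|M] leq lsup lmass lgap.
  (* For [M = 0] the new equation still has an empty sum, so [lam] is kept. *)
  exists lam, 0; split=> //.
  - by rewrite mulr0 invr_ge0.
  - by rewrite subr0 addr0 mulr1 lexx.
set L := M.+1 in leq lsup lmass lgap *.
have l0 : 0 < lam by apply: lt_le_trans l1.
have h1 : 0 <= beta * (K1 * Cd) by rewrite !mulr_ge0.
set e0 := 4 * (K1 * beta) * Cd.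
have e00 : 0 <= e0 by rewrite /e0 !mulr_ge0.
have e0K : e0 <= beta * Ke / 4.
  rewrite /e0 /lace_const; have : 0 <= beta * (32 * 64 * (K1 * K3 * Cd * Cw ^+ 2)).
    by rewrite mulr_ge0.
  have -> : beta * (16 * K1 * Cd + 32 * 64 * (K1 * K3 * Cd * Cw ^+ 2)) / 4 =
    4 * (K1 * beta) * Cd + beta * (32 * 64 * (K1 * K3 * Cd * Cw ^+ 2)) / 4 by field.
  by move: (beta * (32 * 64 * _)) (4 * _ * Cd) => a b; lra.
have e0Cw : 32 * (e0 * Cw) <= 1.
  apply: le_trans s4; have := ler_wpM2r Cw_ge0 e0K.
  have -> : beta * Ke / 4 * Cw = beta * Ke * Cw / 4 by field.
  by move: (beta * Ke * Cw) (e0 * Cw) => a b; lra.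
have pb m : (1 < m <= L.+1)%N -> `|phat m * lam ^+ m| <= e0 * om m.
  move=> /andP[m1 mL].
  have -> : phat m * lam ^+ m = \sum_x lace_coef (fun y => lam * D y) N m x.
    rewrite mulr_suml; apply: eq_bigr => x _.
    by rewrite lace_coef_scale ?(ltnW m1) // mulrC.
  apply: le_trans (ler_norm_sum _ _ _) _.
  apply: (@lace_coef_bound R om Cd Cw omP G _ _ (K1 * beta) 2 L _ _ _ _ _ N _ m _) => //.
  - by move=> y; rewrite mulr_ge0 // ltW.
  - by rewrite mulr_ge0.
  - by rewrite ler1n.
  - by move=> n x nL; rewrite scaleE; apply: lsup.
  - by move=> n nL; under eq_bigr do rewrite scaleE; have /andP[] := lmass n nL.
  - apply: le_trans s1.
    have -> : 96 * (K1 * beta * 2 * Cd * Cw) = 3 * 64 * (beta * (K1 * Cd * Cw)) by ring.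
    by apply: ler_wpM2r; [rewrite !mulr_ge0|rewrite ler_wpM2r // ler_nat].
  - rewrite -mulr_sumr D_mass mulr1; apply: le_trans l2 _.
    by rewrite ler_pdivrMr //; lra.
  - by rewrite m1.
set s := 4 * (e0 * om L.+1).
have s0 : 0 <= s by rewrite /s !mulr_ge0.
have Ls : L.+1%:R * s <= 4^-1.
  have := ler_wpM2l e00 (om1_term L.+1).
  have -> : L.+1%:R * s = 4 * (e0 * (L.+1%:R * om L.+1)) by rewrite /s; ring.
  by move: (e0 * (_ * _)) (e0 * Cw) e0Cw => a b; lra.
have s_le1 : s <= 1.
  apply: le_trans (_ : L.+1%:R * s <= _); first by rewrite ler_peMl // ler1n.
  by apply: le_trans Ls _; lra.
have [|||lam' lb le] := @root_near R L.+1 (fun m => phat m) lam s (e0 * om L.+1)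
  l0 s0 s_le1 Ls _ leq _ (pb _ _) (lexx _).
- by rewrite mulrC -ler_pdivrMr // mul1r.
- apply: le_trans (_ : e0 * \sum_(m < L.+2) m%:R * om m <= _).
    rewrite -(big_mkord predT (fun m => m%:R * om m)) mulr_sumr.
    rewrite [leRHS](@big_cat_nat _ _ _ 2) //= -[leLHS]add0r; apply: lerD.
      by apply: sumr_ge0 => m _; rewrite !mulr_ge0.
    apply: ler_sum_nat => m /andP[m2 mL].
    by rewrite mulrCA; apply: ler_wpM2l => //; apply: pb; rewrite m2.
  apply: le_trans (_ : e0 * Cw <= _); last by move: e0Cw; lra.
  apply: ler_wpM2l => //; apply: le_trans (decay_sum omP L.+2).
  by apply: ler_sum => m _; rewrite ler_wpM2r // ler_nat.
- by rewrite leqnn.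
by exists lam', s; split.
Qed.

(** * Recovering the undoubled bounds at the next horizon *)

Section Step.
Variables (M : nat) (lam lam' s : R).
Hypothesis ctl : controlled M lam.
Hypothesis MN : (M < N)%N.
Hypothesis s_ge0 : 0 <= s.
Hypothesis Ms : M.+1%:R * s <= 4^-1.
Hypothesis lam'_near : lam * (1 - s) <= lam' <= lam * (1 + s).
Hypothesis lam'_eq : lam' + \sum_(2 <= m < M.+2) phat m * lam' ^+ m = 1.

Local Notation D1 := (fun y => lam' * D y).
Local Notation c1 := (saw_count D1).

Let s_le : s <= 4^-1.
Proof. by apply: le_trans Ms; rewrite ler_peMl // ler1n. Qed.
Let lam_gt0 : 0 < lam.
Proof. by have /andP[l1 _] := ctl_lam ctl; apply: lt_le_trans l1. Qed.
Let lam'_gt0 : 0 < lam'.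
Proof.
have /andP[l1 _] := lam'_near; apply: lt_le_trans l1.
by rewrite mulr_gt0 // subr_gt0; apply: le_lt_trans s_le _; rewrite invf_lt1 // ltr1n.
Qed.
Let lam'_ge0 : 0 <= lam'. Proof. exact: ltW. Qed.
Let lam'_le2 : lam' <= 2.
Proof.
have /andP[_ l2] := lam'_near; have /andP[_ l3] := ctl_lam ctl.
apply: le_trans l2 _; apply: le_trans (_ : 3 / 2 * (1 + 4^-1) <= _).
  by apply: ler_pM; rewrite ?(ltW lam_gt0) ?addr_ge0 ?lerD2l.
lra.
Qed.
Let pow_le n : (n <= M.+1)%N -> lam' ^+ n <= 2 * lam ^+ n.
Proof.
move=> nM; apply: le_trans (_ : (lam * (1 + s)) ^+ n <= _).
  by apply: lerXn2r; rewrite ?nnegrE ?(andP lam'_near).2 // mulr_ge0 ?addr_ge0 // ltW.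
rewrite exprMn mulrC; apply: ler_wpM2r; first by rewrite exprn_ge0 // ltW.
apply: pow1D_le2 => //; apply: le_trans Ms; apply: ler_wpM2r => //.
by rewrite ler_nat.
Qed.
Let c1_ge0 n x : 0 <= c1 n x.
Proof. by rewrite scaleE mulr_ge0 // exprn_ge0. Qed.
Let c1_le n x : (n <= M)%N -> c1 n x <= 2 * (lam ^+ n * c n x).
Proof.
by move=> nM; rewrite scaleE mulrA; apply: ler_wpM2r => //; apply/pow_le/leqW.
Qed.
Local Hint Resolve c1_ge0 lam'_ge0 : core.

Let eps := beta * Ke.
Let eps_ge0 : 0 <= eps. Proof. by rewrite mulr_ge0. Qed.

Let D1_ge0 y : 0 <= D1 y. Proof. by rewrite mulr_ge0. Qed.
Let sig_ge0 : 0 <= 2 * K1 * beta. Proof. by rewrite !mulr_ge0. Qed.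
Let c1_sup n x : (0 < n <= M)%N -> c1 n x <= 2 * K1 * beta * om n.
Proof.
move=> nM; apply: le_trans (c1_le _ _) _; first by case/andP: nM.
by rewrite -!mulrA; apply: ler_wpM2l => //; rewrite !mulrA; apply: (ctl_sup ctl).
Qed.
Let c1_mass n : (n <= M)%N -> \sum_x c1 n x <= 4.
Proof.
move=> nM; apply: le_trans (_ : \sum_x 2 * (lam ^+ n * c n x) <= _).
  by apply: ler_sum => x _; apply: c1_le.
rewrite -mulr_sumr; have /andP[_ h] := ctl_mass ctl nM.
by apply: le_trans (ler_wpM2l _ h) _ => //; lra.
Qed.
Let c1_spread k n : (n <= M)%N ->
  \sum_x (1 - ck k x) * c1 n x <= 2 * K3 * n%:R * (1 - q k).
Proof.
move=> nM; apply: le_trans (_ : \sum_x 2 * ((1 - ck k x) * (lam ^+ n * c n x)) <= _).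
  apply: ler_sum => x _; rewrite mulrCA; apply: ler_wpM2l; last exact: c1_le.
  exact: (char_gap_ge0 (chi k)).
rewrite -mulr_sumr -!mulrA; apply: ler_wpM2l => //; rewrite !mulrA.
exact: (ctl_gap ctl).
Qed.
Let small1 : 96 * (2 * K1 * beta * 4 * Cd * Cw) <= 1.
Proof.
have [h _ _ _] := smalls; apply: le_trans h.
by rewrite le_eqVlt; apply/orP; left; apply/eqP; ring.
Qed.
Let D1_mass : \sum_y D1 y <= 2.
Proof. by rewrite -mulr_sumr D_mass mulr1. Qed.

Let K4_ge1 : 1 <= 4 :> R. Proof. by rewrite ler1n. Qed.

(** With the factor 2 the same bound serves [Dl], whose weights [1 - ck k x] reach 2. *)
Let lc_bound m : (1 < m <= M.+1)%N ->
  2 * \sum_x `|lace_coef D1 N m x| <= eps * om m.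
Proof.
move=> mM; have h := @lace_coef_bound R om Cd Cw omP G D1 D1_ge0 _ 4 M sig_ge0
  K4_ge1 c1_sup c1_mass small1 N D1_mass m mM.
apply: le_trans (ler_wpM2l (ler0n R 2) h) _.
have -> : 2 * (4 * (2 * K1 * beta) * Cd * om m) = beta * (16 * K1 * Cd) * om m by ring.
apply: ler_wpM2r => //; rewrite /eps /lace_const.
by apply: ler_wpM2l => //; rewrite lerDl.
Qed.

Let lc_spread k :
  \sum_(2 <= m < M.+2) \sum_x (1 - ck k x) * `|lace_coef D1 N m x| <= eps * (1 - q k).
Proof.
have K31 : 1 <= 2 * K3.
  rewrite /gap_const; have := C1_ge2; lra.
have h := @lace_coef_spread_sum R om Cd Cw omP G D1 D1_ge0 (2 * K1 * beta) 4 M sig_ge0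
  K4_ge1 c1_sup c1_mass small1 (fun x => 1 - ck k x) (1 - q k) (2 * K3)
  (char_gap_ge0 (chi k)) _ _ (char_gap_sub (chi k)) K31 (E_ge0 k) (c1_spread k) N D1_mass.
apply: le_trans (h _ _) _.
- by rewrite (char0 (chi k)) subrr.
- by move=> x; rewrite (charN (chi k)).
apply: ler_wpM2r => //; rewrite /eps /lace_const /spread_const.
have -> : 2 * (64 * (2 * K1 * beta * 4 * (2 * K3) * Cd * Cw ^+ 2)) =
  beta * (32 * 64 * (K1 * K3 * Cd * Cw ^+ 2)) by ring.
by apply: ler_wpM2l => //; rewrite lerDr.
Qed.

Let P m : R := if (1 < m <= M.+1)%N then \sum_x lace_coef D1 N m x else 0.
Let Dl k m : R := if (1 < m <= M.+1)%N then
  \sum_x (1 - ck k x) * lace_coef D1 N m x else 0.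
Let u k n : R := fourier (ck k) (c1 n).

Let P_le m : `|P m| <= eps * om m.
Proof.
rewrite /P; case: ifP => mM; last by rewrite normr0 mulr_ge0.
apply: le_trans (lc_bound mM); apply: le_trans (ler_norm_sum _ _ _) _.
by rewrite ler_peMl ?ler1n // sumr_ge0.
Qed.

Let Dl_le k m : `|Dl k m| <= eps * om m.
Proof.
rewrite /Dl; case: ifP => mM; last by rewrite normr0 mulr_ge0.
apply: le_trans (lc_bound mM); apply: le_trans (ler_norm_sum _ _ _) _.
rewrite mulr_sumr; apply: ler_sum => x _; rewrite normrM; apply: ler_wpM2r => //.
apply: le_trans (ler_normB _ _) _; rewrite normr1 (_ : 2 = 1 + 1) // lerD2l.
exact: (char_abs (chi k)).
Qed.

Let Dl_sum k L : \sum_(m < L) `|Dl k m| <= eps * (1 - q k).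
Proof.
rewrite (@sum_nat2_ord _ L (fun m => `|Dl k m|)) ?normr0 //.
apply: le_trans (lc_spread k).
apply: le_trans (_ : \sum_(2 <= m < maxn L M.+2) `|Dl k m| <= _).
  have [L2|L2] := leqP L 2; first by rewrite big_geq // sumr_ge0.
  rewrite [leRHS](@big_cat_nat _ _ _ L) ?leq_maxl ?(ltnW L2) //= lerDl.
  by rewrite sumr_ge0.
rewrite (@big_cat_nat _ _ _ M.+2) ?leq_maxr //= [X in _ + X]big_nat_cond.
rewrite [X in _ + X]big1 ?addr0; last first.
  move=> m /andP[/andP[mM _] _]; by rewrite /Dl (leqNgt m) mM andbF normr0.
apply: ler_sum_nat => m mM; rewrite /Dl ifT //.
apply: le_trans (ler_norm_sum _ _ _) _; apply: ler_sum => x _.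
by rewrite normrM ger0_norm // (char_gap_ge0 (chi k)).
Qed.

(** By criticality, the factor [1 - \sum P] of the scalar recursion is the fugacity [lam']. *)
Let sumP : \sum_(m < M.+2) P m = 1 - lam'.
Proof.
rewrite sum_nat2_ord // -lam'_eq addrC addKr; apply: eq_big_nat => m mM.
rewrite /P ifT // mulr_suml; apply: eq_bigr => x _.
by rewrite lace_coef_scale ?(ltn_trans _ (andP mM).1) // mulrC.
Qed.

Let c1_sym n x : c1 n (- x) = c1 n x.
Proof. by apply: saw_count_sym => y; rewrite D_sym. Qed.

Let u0 k : u k 0%N = 1.
Proof.
rewrite /u /fourier (bigD1 0) //= saw_count0 eqxx mulr1 (char0 (chi k)).
by rewrite big1 ?addr0 // => x x0; rewrite saw_count0 (negbTE x0) mulr0.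
Qed.

Let uS k n : (n < M.+1)%N -> u k n.+1 =
  (1 - \sum_(m < M.+2) P m) * q k * u k n + conv (fun m => P m - Dl k m) (u k) n.+1.
Proof.
move=> nM; rewrite sumP subKr.
have D10 : D1 0 = 0 by rewrite D0 mulr0.
have -> : u k n.+1 = fourier (ck k) (fun x => \sum_y D1 y * c1 n (x - y)) +
    \sum_(2 <= m < n.+2) fourier (ck k)
      (fun x => \sum_y lace_coef D1 N m y * c1 (n.+1 - m) (x - y)).
  rewrite /u /fourier [X in _ + X]exchange_big -big_split /=.
  apply: eq_bigr => x _; rewrite (lace_expansion (f := N) x D10); last first.
    by apply: leq_trans (ltnW MN); rewrite -ltnS.
  by rewrite mulrDr; congr (_ + _); rewrite mulr_sumr.
rewrite (fourier_conv (chi k)) // -/(u k n).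
have -> : fourier (ck k) D1 = lam' * q k.
  by rewrite /fourier mulr_sumr; apply: eq_bigr => x _; rewrite mulrCA.
congr (_ + _); rewrite /conv.
rewrite (@sum_nat2_ord _ n.+2 (fun m => (P m - Dl k m) * u k (n.+1 - m)%N)).
- apply: eq_big_nat => m /andP[m2 mn]; rewrite (fourier_conv (chi k)) //.
  congr (_ * _); rewrite /P /Dl m2 /=.
  rewrite (leq_trans (_ : m <= n.+1)%N nM) //.
  rewrite /fourier -sumrB; apply: eq_bigr => x _; rewrite mulrBl mul1r opprB addrC.
  by rewrite subrK.
- by rewrite /P /Dl /= subr0 mul0r.
- by rewrite /P /Dl /= subr0 mul0r.
Qed.

Let sc_eps : sc * eps <= 1.
Proof.
have [_ _ h _] := smalls; rewrite /eps; move: h.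
have : 0 <= sc * (beta * Ke) by apply: mulr_ge0.
by move: (sc * _) => z; lra.
Qed.

Let u_le k n : (n <= M.+1)%N -> `|u k n| <= 2 * C1 * phi theta (1 - `|q k|) n.
Proof.
exact: (scalar_recursion_le theta_gt2 Ceta_ge1 (q_abs k) (q_gap k) eps_ge0
  (erefl : P 0%N = 0) (erefl : Dl k 0%N = 0) P_le (Dl_le k) (Dl_sum k) (u0 k) (uS k) sc_eps).
Qed.

Let phi_1 k n : phi theta (1 - `|q k|) n <= 1.
Proof. by apply: phi_le1; rewrite // subr_ge0. Qed.

(* The trivial character, to which the scalar estimate also applies. *)
Let uhat n : R := \sum_x c1 n x.

Let uhatS n : (n < M.+1)%N -> uhat n.+1 = lam' * uhat n + conv P uhat n.+1.
Proof.
move=> nM; have D10 : D1 0 = 0 by rewrite D0 mulr0.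
have shift (g : G -> R) y : \sum_x g (x - y) = \sum_x g x.
  by rewrite [RHS](reindex_inj (addIr (- y))).
rewrite /uhat; under eq_bigr => x _.
  rewrite (lace_expansion (f := N) x D10); last first.
    by apply: leq_trans (ltnW MN); rewrite -ltnS.
over.
rewrite big_split /=; congr (_ + _).
  rewrite exchange_big /=; under eq_bigr do rewrite -mulr_sumr shift.
  by rewrite -mulr_suml -mulr_sumr D_mass mulr1.
rewrite exchange_big /conv.
rewrite (@sum_nat2_ord _ n.+2 (fun m => P m * \sum_x c1 (n.+1 - m)%N x)) ?mul0r //.
apply: eq_big_nat => m /andP[m2 mn]; rewrite exchange_big /=.
under eq_bigr do rewrite -mulr_sumr shift.
rewrite -mulr_suml; congr (_ * _); rewrite /P m2 /=.
by rewrite (leq_trans (_ : m <= n.+1)%N nM).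
Qed.

Let uhat0 : uhat 0 = 1.
Proof.
rewrite /uhat (bigD1 0) //= saw_count0 eqxx big1 ?addr0 // => x x0.
by rewrite saw_count0 (negbTE x0).
Qed.

(** The scalar estimate with [q = 1] and [Dl = 0]: the gap is zero, [phi] is 1, and
    [sc * eps <= 1/2]. *)
Let uhat_near n : (n <= M.+1)%N -> `|uhat n - 1| <= 2^-1.
Proof.
move=> nM.
have eqS i : (i < M.+1)%N -> uhat i.+1 =
    (1 - \sum_(m < M.+2) P m) * 1 * uhat i + conv (fun m => P m - 0) uhat i.+1.
  move=> iM; rewrite uhatS // sumP subKr mulr1; congr (_ + _).
  by apply: eq_conv => // m _; rewrite subr0.
have z L : \sum_(m < L) `|(fun=> 0 : R) m| <= eps * (1 - 1).
  by rewrite big1 ?subrr ?mulr0 // => m _; rewrite normr0.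
have := scalar_recursion theta_gt2 Ceta_ge1 (q := 1) (eps := eps) (N := M.+1) (P := P)
  (Dl := fun=> 0) (u := uhat) _ _ eps_ge0 erefl erefl P_le _ z uhat0 eqS sc_eps nM.
rewrite normr1 !subrr phi_0 mulr1 expr1n mulr0 => /(_ (lexx _) (lexx _) _).
move=> h; apply: le_trans (h _) _; first by move=> m; rewrite normr0 mulr_ge0.
by have [_ _ h3 _] := smalls; move: h3; rewrite /eps; lra.
Qed.

Let uhat_bd n : (n <= M.+1)%N -> 2^-1 <= uhat n <= 2.
Proof.
move=> nM; have := uhat_near nM; rewrite ler_norml => /andP[h1 h2].
by apply/andP; split; move: h1 h2; move: (uhat n) => z; lra.
Qed.

Let v k n : R := uhat n - u k n.
Let src k n : R := if n is j.+1 then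
  lam' * (1 - q k) * u k j + conv (Dl k) (u k) j.+1 else 0.
Let rr m : R := P m + lam' * (m == 1%N)%:R.

Let conv_delta1 (f : nat -> R) n : conv (fun m => lam' * (m == 1%N)%:R) f n.+1 = lam' * f n.
Proof.
rewrite /conv (bigD1 (inord 1)) //= inordK // eqxx mulr1 subn1 big1 ?addr0 //.
move=> i /eqP i1; have [e|] := eqVneq (i : nat) 1%N; last by rewrite mulr0 mul0r.
by case: i1; apply/val_inj; rewrite /= inordK.
Qed.

(** [v] solves the renewal equation of [uhat] with source [src], and [uhat] is the resolvent of that
    equation: [conv rr uhat = uhat - delta_0]. *)
Let v_conv k n : (n <= M.+1)%N -> v k n = conv uhat (src k) n.
Proof.
have rr0 : rr 0%N = 0 by rewrite /rr /P /= mulr0 addr0.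
have rru n' : (n' <= M.+1)%N -> conv rr uhat n' = uhat n' - (n' == 0%N)%:R.
  case: n' => [_|j jM]; first by rewrite /conv big_ord1 rr0 mul0r uhat0 subrr.
  by rewrite convDl conv_delta1 subr0 uhatS // addrC.
elim/ltn_ind: n => -[_ _|n IH nM].
  by rewrite /conv big_ord1 /v uhat0 u0 subrr /= mulr0.
have vS : v k n.+1 = conv rr (v k) n.+1 + src k n.+1.
  rewrite convDl conv_delta1 /v uhatS // uS // sumP subKr.
  have -> : conv (fun m => P m - Dl k m) (u k) n.+1 =
      conv P (u k) n.+1 - conv (Dl k) (u k) n.+1.
    by rewrite /conv -sumrB; apply: eq_bigr => i _; rewrite mulrBl.
  have -> : conv P (fun n => uhat n - u k n) n.+1 =
      conv P uhat n.+1 - conv P (u k) n.+1.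
    by rewrite /conv -sumrB; apply: eq_bigr => i _; rewrite mulrBr.
  rewrite /src; ring.
have -> : v k n.+1 = conv rr (conv uhat (src k)) n.+1 + src k n.+1.
  rewrite vS; congr (_ + _); rewrite /conv; apply: eq_bigr => -[i /= iN] _.
  case: i iN => [|i] iN; first by rewrite rr0 !mul0r.
  congr (_ * _); apply: IH; first by rewrite subSS ltnS leq_subr.
  by apply: leq_trans nM; rewrite subSS; apply: leq_trans (leq_subr _ _) _.
rewrite convA (@eq_conv _ (conv rr uhat) (fun m => uhat m - (m == 0%N)%:R)
   (src k) (src k)) //; last by move=> i iM; apply: rru; apply: leq_trans nM.
have -> : conv (fun m => uhat m - (m == 0%N)%:R) (src k) n.+1 =
   conv uhat (src k) n.+1 - src k n.+1.
  rewrite /conv !big_ord_recl mulrBl mul1r addrAC; congr (_ + _ - _).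
  by rewrite subr0; congr (_ + _); apply: eq_bigr => i _; rewrite subr0.
by rewrite subrK.
Qed.

Let src_le k n : (n <= M.+1)%N -> `|src k n| <= 6 * C1 * (1 - q k).
Proof.
have h0 : 0 <= 6 * C1 * (1 - q k) by rewrite !mulr_ge0.
case: n => [_|n nM]; first by rewrite normr0.
have ub j : (j <= M.+1)%N -> `|u k j| <= 2 * C1.
  move=> jM; apply: le_trans (u_le k jM) _; rewrite -[leRHS]mulr1.
  by apply: ler_wpM2l; rewrite ?mulr_ge0.
apply: le_trans (ler_normD _ _) _.
have -> : 6 * C1 * (1 - q k) = 2 * (1 - q k) * (2 * C1) + (1 - q k) * (2 * C1) by ring.
apply: lerD.
  rewrite normrM (ger0_norm (mulr_ge0 lam'_ge0 (E_ge0 k))).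
  apply: ler_pM; rewrite ?mulr_ge0 //.
    by apply: ler_wpM2r.
  by apply: ub; exact: ltnW.
apply: le_trans (norm_conv _ _ _) _.
apply: le_trans (_ : (\sum_(i < n.+2) `|Dl k i|) * (2 * C1) <= _).
  rewrite mulr_suml; apply: ler_sum => i _; apply: ler_wpM2l => //.
  by apply: ub; apply: leq_trans (leq_subr _ _) nM.
apply: ler_wpM2r; first by rewrite mulr_ge0.
apply: le_trans (Dl_sum k _) _; rewrite -[leRHS]mul1r; apply: ler_wpM2r => //.
by have [_ h _ _] := smalls; move: h eps_ge0; rewrite /eps; lra.
Qed.

(** In [v_conv] each source is at most [6 * C1 * (1 - q k)] and each mass at most 2, whence
    [gap_const]. As [src k 0 = 0], there are [n] terms and not [n.+1]. *)
Let gap_step k n : (n <= M.+1)%N ->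
  \sum_x (1 - ck k x) * c1 n x <= K3 * n%:R * (1 - q k).
Proof.
move=> nM; rewrite fourier_gap -/(u k n) -/(uhat n) -/(v k n) v_conv //.
apply: le_trans (ler_norm _) _; apply: le_trans (norm_conv _ _ _) _.
rewrite convC /conv big_ord_recl [X in X + _](_ : _ = 0) ?add0r; last first.
  by rewrite /= normr0 mul0r.
apply: le_trans (_ : \sum_(i < n) 6 * C1 * (1 - q k) * 2 <= _).
  apply: ler_sum => i _; apply: ler_pM; rewrite ?normr_ge0 //.
    by apply: src_le; rewrite lift0; apply: leq_trans nM.
  have /andP[h1 h2] : 2^-1 <= uhat (n - lift ord0 i) <= 2.
    by apply: uhat_bd; apply: leq_trans (leq_subr _ _) nM.
  by rewrite ger0_norm //; apply: le_trans h1; rewrite invr_ge0.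
rewrite sumr_const card_ord -[leLHS]mulr_natr /gap_const.
by rewrite le_eqVlt; apply/orP; left; apply/eqP; ring.
Qed.

Let c1_conv2 n x : c1 n.+2 x <=
  lam' ^+ 2 * \sum_y D y * \sum_z D z * c1 n (x - y - z).
Proof.
have one m z : c1 m.+1 z <= \sum_y D1 y * c1 m (z - y).
  have := @saw_count_add R G D1 D1_ge0 1 m z; rewrite add1n.
  by under eq_bigr do rewrite saw_count1 ?D0 ?mulr0 //.
apply: le_trans (one _ _) _; rewrite mulr_sumr; apply: ler_sum => y _.
rewrite mulrA expr2 -!mulrA; apply: ler_wpM2l => //; rewrite mulrCA.
apply: ler_wpM2l => //; apply: le_trans (one _ _) _.
by rewrite mulr_sumr; apply: ler_sum => z _; rewrite -mulrA.
Qed.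

(** Two steps are released from self-avoidance so that the transform carries [q k ^+ 2]: its mean
    over the modes is of order [beta], whereas [phi] alone has mean 1 at [n = 0]. One step is
    covered by [D_sup]. *)
Let sup_step n x : (0 < n <= M.+1)%N -> c1 n x <= K1 * beta * om n.
Proof.
have Cd2 : 2 * (2 * C1) * Cd * beta >= 0 by rewrite !mulr_ge0.
case: n => [//|[_|n /andP[_ nM]]].
  rewrite saw_count1 ?D0 ?mulr0 //.
  apply: le_trans (ler_pM _ _ lam'_le2 (D_sup x)) _ => //.
  have h : 1 <= Cd * om 1.
    by have := @decay_third _ _ _ _ omP 0 1 isT; rewrite (decay0 omP).
  have -> : K1 * beta * om 1 = 8 * C1 * beta * (Cd * om 1) by rewrite /sup_const; ring.
  apply: le_trans (_ : 8 * C1 * beta * 1 <= _); last first.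
    by apply: ler_wpM2l; rewrite ?mulr_ge0.
  rewrite mulr1; apply: ler_wpM2r => //.
  by have := C1_ge2; lra.
apply: le_trans (c1_conv2 n x) _.
pose g z := \sum_y D y * c1 n (z - y).
pose f z := \sum_y D y * g (z - y).
have ge z : g (- z) = g z.
  rewrite /g (reindex_inj (@oppr_inj G)); apply: eq_bigr => y _.
  by rewrite D_sym -opprD c1_sym.
have fe z : f (- z) = f z.
  rewrite /f (reindex_inj (@oppr_inj G)); apply: eq_bigr => y _.
  by rewrite D_sym -opprD ge.
have Fk k : fourier (ck k) f = q k * (q k * u k n).
  by rewrite /f (fourier_conv (chi k)) // /g (fourier_conv (chi k)).
have nM' : (n <= M.+1)%N by apply: leq_trans nM; apply: leqW.
have fx : #|I|%:R * f x <= #|I|%:R * (2 * C1 * (beta * om n)).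
  apply: le_trans (fourier_sup x chi ortho fe) _.
  rewrite mulrCA; apply: le_trans (ler_wpM2l _ (mode_decay (n := n) _)); last 2 first.
  - by rewrite mulr_ge0.
  - by apply: leq_trans MN; apply: leq_trans nM; apply: leqW.
  rewrite mulr_sumr; apply: ler_sum => k _; rewrite Fk mulrA -expr2 normrM.
  rewrite normrX real_normK ?num_real // mulrCA; apply: ler_wpM2l; first exact: sqr_ge0.
  exact: u_le.
have I0 : 0 < #|I|%:R :> R by rewrite ltr0n.
rewrite ler_pM2l // in fx.
apply: le_trans (_ : 2 ^+ 2 * (2 * C1 * (beta * om n)) <= _).
  apply: ler_pM => //; first exact: exprn_ge0.
    by apply: sumr_ge0 => y _; rewrite mulr_ge0 // sumr_ge0 // => z _; rewrite mulr_ge0.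
  by apply: lerXn2r; rewrite ?nnegrE.
have -> : K1 * beta * om n.+2 = 8 * C1 * beta * (Cd * om n.+2).
  by rewrite /sup_const; ring.
have -> : 2 ^+ 2 * (2 * C1 * (beta * om n)) = 8 * C1 * beta * om n by ring.
apply: ler_wpM2l; first by rewrite !mulr_ge0.
by apply: (decay_third omP); clear; lia.
Qed.

Lemma controlled_step : controlled M.+1 lam'.
Proof.
have e k n : fourier (ck k) (fun x => lam' ^+ n * c n x) = u k n.
  by rewrite /u /fourier; apply: eq_bigr => x _; rewrite scaleE.
split=> //.
- have : `|1 - lam'| <= 2^-1.
    rewrite -sumP; apply: le_trans (ler_norm_sum _ _ _) _.
    apply: le_trans (_ : eps * \sum_(m < M.+2) m.+1%:R * om m <= _).
      rewrite mulr_sumr; apply: ler_sum => m _; apply: le_trans (P_le m) _.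
      by apply: ler_wpM2l => //; rewrite ler_peMl // ler1n.
    apply: le_trans (ler_wpM2l eps_ge0 (decay_sum omP _)) _.
    have [_ _ _ h] := smalls; move: h; rewrite -/eps.
    have : 0 <= eps * Cw by rewrite mulr_ge0.
    by move: (eps * Cw) => z; lra.
  by rewrite ler_norml => /andP[h1 h2]; apply/andP; split; move: h1 h2; lra.
- by move=> n x nM; rewrite -scaleE; apply: sup_step.
- by move=> n nM; have := uhat_bd nM; rewrite /uhat; under eq_bigr do rewrite scaleE.
- by move=> k n nM; have := gap_step k nM; under eq_bigr do rewrite scaleE.
- by move=> k n nM; rewrite e; apply: u_le.
Qed.

End Step.

Lemma controlled0 : controlled 0 1.
Proof.
have c0E n : (n <= 0)%N -> (fun x => 1 ^+ n * c n x) =1 (fun x => (x == 0)%:R).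
  by rewrite leqn0 => /eqP-> x; rewrite mul1r saw_count0.
have sum0 (g : G -> R) : \sum_x g x * (x == 0)%:R = g 0.
  by rewrite (bigD1 0) //= eqxx mulr1 big1 ?addr0 // => x /negbTE->; rewrite mulr0.
split=> [|||n n0|k n n0|k n n0].
- by apply/andP; split; lra.
- by rewrite big_geq // addr0.
- by move=> n x /andP[]; case: n.
- under eq_bigr do rewrite c0E // -[_%:R]mul1r.
  by rewrite sum0; apply/andP; split; lra.
- under eq_bigr do rewrite c0E //.
  rewrite (sum0 (fun x => 1 - ck k x)) (char0 (chi k)) subrr.
  by rewrite !mulr_ge0.
- rewrite /fourier; under eq_bigr do rewrite c0E //.
  rewrite sum0 (char0 (chi k)) normr1.
  move: n0; rewrite leqn0 => /eqP->; rewrite phi0 mulr1.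
  by have := C1_ge2; lra.
Qed.

Lemma controlledN M : (M <= N)%N -> exists lam, controlled M lam.
Proof.
elim: M => [_|M IH MN]; first by exists 1; exact: controlled0.
have [lam ctl] := IH (ltnW MN).
have [lam' [s [s0 Ms near eq]]] := next_lam ctl.
by exists lam'; exact: controlled_step ctl MN s0 Ms near eq.
Qed.

(** The powers of [lam] cancel on both sides; the normalized mass is at least 1/2, which costs the
    factor 2. *)
Theorem saw_mode_bounds n : (n <= N)%N ->
  [/\ 0 < \sum_x c n x,
    forall k, \sum_x (1 - ck k x) * c n x <=
      2 * K3 * n%:R * (1 - q k) * \sum_x c n x &
    forall k, `|fourier (ck k) (c n)| <=
      4 * C1 * phi theta (1 - `|q k|) n * \sum_x c n x].
Proof.
move=> nN; have [lam ctl] := controlledN (leqnn N).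
have /andP[l1 l2] := ctl_lam ctl.
have l0 : 0 < lam ^+ n by rewrite exprn_gt0 //; apply: lt_le_trans l1.
have /andP[m1 m2] := ctl_mass ctl nN; rewrite -mulr_sumr in m1 m2.
have m0 : 1 <= 2 * (lam ^+ n * \sum_x c n x).
  by move: m1; move: (lam ^+ n * _) => z; lra.
split=> [|k|k].
- by rewrite -(pmulr_rgt0 _ l0); apply: lt_le_trans m1.
- rewrite -(ler_pM2l l0) mulr_sumr; under eq_bigr do rewrite mulrCA.
  apply: le_trans (ctl_gap ctl k nN) _.
  have -> : lam ^+ n * (2 * K3 * n%:R * (1 - q k) * \sum_x c n x) =
    K3 * n%:R * (1 - q k) * (2 * (lam ^+ n * \sum_x c n x)) by ring.
  by rewrite -[leLHS]mulr1; apply: ler_wpM2l; rewrite ?mulr_ge0.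
- rewrite -(ler_pM2l l0) -{1}(ger0_norm (ltW l0)) -normrM.
  have -> : lam ^+ n * fourier (ck k) (c n) =
      fourier (ck k) (fun x => lam ^+ n * c n x).
    by rewrite /fourier mulr_sumr; apply: eq_bigr => x _; rewrite mulrCA.
  apply: le_trans (ctl_mode ctl k nN) _.
  have -> : lam ^+ n * (4 * C1 * phi theta (1 - `|q k|) n * \sum_x c n x) =
    2 * C1 * phi theta (1 - `|q k|) n * (2 * (lam ^+ n * \sum_x c n x)) by ring.
  rewrite -[leLHS]mulr1; apply: ler_wpM2l; rewrite ?mulr_ge0 //.
  by apply/ltW/phi_gt0; rewrite subr_ge0.
Qed.

End SawCore.

(** * Spectral estimates on the torus *)

Section ScaleGap.
Variable R : realType.
Implicit Types (tau s : R) (e i j n : nat).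

Lemma sum_geometric_le s n : 0 <= s -> s < 1 -> \sum_(i < n) s ^+ i <= (1 - s)^-1.
Proof.
move=> s0 s1; rewrite -[leRHS]mul1r ler_pdivlMr ?subr_gt0 // mulrC.
have -> : (1 - s) * \sum_(i < n) s ^+ i = 1 - s ^+ n.
  by rewrite -[RHS]opprB (subrX1 s n); ring.
by rewrite gerBl exprn_ge0.
Qed.

Lemma sum_geometric2_le s n : 0 <= s -> s < 1 ->
  \sum_(i < n) i.+1%:R * s ^+ i <= (1 - s) ^- 2.
Proof.
move=> s0 s1; have s1' : 0 < 1 - s by rewrite subr_gt0.
rewrite -[leRHS]mul1r ler_pdivlMr ?exprn_gt0 //.
have -> : (\sum_(i < n) i.+1%:R * s ^+ i) * (1 - s) ^+ 2 =
    1 - s ^+ n - n%:R * s ^+ n * (1 - s).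
  elim: n => [|n IH]; first by rewrite big_ord0 !mul0r expr0 subrr subr0.
  by rewrite big_ord_recr /= mulrDl IH -[n.+1]addn1 natrD exprD; ring.
rewrite -[leRHS]subr0; apply: lerB; first by rewrite gerBl exprn_ge0.
by rewrite !mulr_ge0 ?exprn_ge0 // ltW.
Qed.

(* The order of [1 - q k] at the frequency [2 pi / 2 ^ e]. *)
Definition scale_gap tau e : R := \sum_(m < e.+1) tau ^+ m * 4^-1 ^+ (e - m).

Lemma scale_gap_ge tau e m : 0 < tau -> (m <= e)%N ->
  tau ^+ m * 4^-1 ^+ (e - m) <= scale_gap tau e.
Proof.
move=> t0; rewrite -ltnS => me; rewrite /scale_gap (bigD1 (Ordinal me)) //= lerDl.
by apply: sumr_ge0 => i _; rewrite mulr_ge0 ?exprn_ge0 // ltW.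
Qed.

Lemma scale_gap_gt0 tau e : 0 < tau -> 0 < scale_gap tau e.
Proof.
move=> t0; apply: lt_le_trans (scale_gap_ge t0 (leqnn e)).
by rewrite mulr_gt0 ?exprn_gt0.
Qed.

Lemma scale_gapS tau e : scale_gap tau e.+1 = 4^-1 * scale_gap tau e + tau ^+ e.+1.
Proof.
rewrite /scale_gap big_ord_recr /= subnn expr0 mulr1; congr (_ + _).
rewrite mulr_sumr; apply: eq_bigr => -[m me] _ /=.
by rewrite subSn // exprS; ring.
Qed.

(** Both geometric ratios are at most [sg]. The factor [i.+1] is needed at the resonance
    [tau = 4^-1], which is [alpha = 2]. *)
Lemma scale_gap_shift tau e i : 0 < tau ->
  scale_gap tau (e + i) <= i.+1%:R * Num.max tau 4^-1 ^+ i * scale_gap tau e.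
Proof.
move=> t0; set sg := Num.max _ _.
have ts : tau <= sg by rewrite le_max lexx.
have qs : 4^-1 <= sg by rewrite le_max lexx orbT.
have sg0 : 0 <= sg := le_trans (ltW t0) ts.
have te : tau ^+ e <= scale_gap tau e.
  by have := scale_gap_ge t0 (leqnn e); rewrite subnn mulr1.
have W0 := ltW (scale_gap_gt0 e t0).
elim: i => [|i IH]; first by rewrite addn0 !mul1r.
rewrite addnS scale_gapS -addnS exprD -[i.+2]addn1 natrD !mulrDl mul1r.
apply: lerD; last first.
  rewrite mulrC; apply: ler_pM; rewrite ?exprn_ge0 ?(ltW t0) //.
  by apply: lerXn2r; rewrite ?nnegrE // ltW.
apply: le_trans (ler_wpM2l _ IH) _; first by rewrite invr_ge0.
rewrite exprS !mulrA; apply: ler_wpM2r => //; rewrite (mulrC _ sg) -!mulrA.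
by apply: ler_wpM2r; rewrite ?mulr_ge0 ?exprn_ge0.
Qed.

Definition moment_const (B sg : R) (K Q : R) : R :=
  2 / (B - 1) + K * Q * (1 - B * sg) ^- 2.

(** Split at [e]. Below, the bound 2 leaves a geometric sum dominated by its end; above, the decay
    of [scale_gap] beats [B ^+ j]. With [B = 2 ^ r] the condition [B * sg < 1] is
    [r < min(alpha, 2)]. *)
Lemma moment_sum tau B K Q x e J : 0 < tau -> 1 < B ->
  B * Num.max tau 4^-1 < 1 -> 0 <= K -> 0 <= x -> x * scale_gap tau e <= Q ->
  \sum_(j < J) B ^+ j * Num.min 2 (K * (x * scale_gap tau j)) <=
  moment_const B (Num.max tau 4^-1) K Q * B ^+ e.
Proof.
move=> t0 B1 Bs K0 x0 xQ; set sg := Num.max _ _ in Bs *.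
have B0 : 0 < B := lt_trans ltr01 B1.
have sg0 : 0 <= sg by rewrite le_max (ltW t0).
have Q0 : 0 <= Q by apply: le_trans xQ; rewrite mulr_ge0 // ltW // scale_gap_gt0.
apply: le_trans (_ : \sum_(j < e + J) B ^+ j * Num.min 2 (K * (x * scale_gap tau j)) <= _).
  rewrite addnC big_split_ord /= lerDl; apply: sumr_ge0 => j _.
  by rewrite mulr_ge0 ?exprn_ge0 ?(ltW B0) // le_min ler0n /= !mulr_ge0 // ltW // scale_gap_gt0.
rewrite big_split_ord /= /moment_const mulrDl; apply: lerD.
  apply: le_trans (_ : \sum_(j < e) 2 * B ^+ j <= _).
    apply: ler_sum => j _; rewrite mulrC; apply: ler_wpM2r; first by rewrite exprn_ge0 // ltW.
    by rewrite ge_min lexx.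
  rewrite -mulr_sumr -mulrA; apply: ler_wpM2l => //.
  rewrite mulrC ler_pdivlMr ?subr_gt0 // mulrC -subrX1.
  by rewrite gerBl.
have -> : K * Q * (1 - B * sg) ^- 2 * B ^+ e = K * Q * B ^+ e * (1 - B * sg) ^- 2 by ring.
apply: le_trans (_ : \sum_(i < J) K * Q * B ^+ e * (i.+1%:R * (B * sg) ^+ i) <= _); last first.
  rewrite -mulr_sumr; apply: ler_wpM2l; first by rewrite !mulr_ge0 // exprn_ge0 // ltW.
  by apply: sum_geometric2_le => //; rewrite mulr_ge0 // ltW.
apply: ler_sum => i _.
apply: le_trans (_ : B ^+ (e + i) * (K * (x * (i.+1%:R * sg ^+ i * scale_gap tau e))) <= _).
  apply: ler_wpM2l; first by rewrite exprn_ge0 // ltW.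
  apply: le_trans (_ : K * (x * scale_gap tau (e + i)) <= _); first by rewrite ge_min lexx orbT.
  by do 2![apply: ler_wpM2l => //]; apply: scale_gap_shift.
rewrite exprD exprMn.
have -> : B ^+ e * B ^+ i * (K * (x * (i.+1%:R * sg ^+ i * scale_gap tau e))) =
  B ^+ e * B ^+ i * (K * (i.+1%:R * sg ^+ i)) * (x * scale_gap tau e) by ring.
have -> : K * Q * B ^+ e * (i.+1%:R * (B ^+ i * sg ^+ i)) =
  B ^+ e * B ^+ i * (K * (i.+1%:R * sg ^+ i)) * Q by ring.
by apply: ler_wpM2l; rewrite ?mulr_ge0 ?exprn_ge0 // ltW.
Qed.

(* Tails of the spread-out kernel against the quadratic bound of [1 - cos]. *)
Lemma shell_sum_le tau K n e : 0 < tau -> tau < 1 -> 0 <= K ->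
  \sum_(m < n) tau ^+ m * Num.min 2 (K * 4 ^+ m * 4^-1 ^+ e) <=
  (K + 2 / (1 - tau)) * scale_gap tau e.
Proof.
move=> t0 t1 K0.
have W0 := ltW (scale_gap_gt0 e t0).
apply: le_trans (_ : \sum_(m < e.+1 + n) tau ^+ m * Num.min 2 (K * 4 ^+ m * 4^-1 ^+ e) <= _).
  rewrite addnC big_split_ord /= lerDl; apply: sumr_ge0 => j _.
  by rewrite mulr_ge0 ?exprn_ge0 ?(ltW t0) // le_min ler0n /= !mulr_ge0 ?exprn_ge0.
rewrite big_split_ord /= mulrDl; apply: lerD.
  rewrite /scale_gap mulr_sumr; apply: ler_sum => -[m me] _ /=.
  rewrite mulrCA; apply: ler_wpM2l; first by rewrite exprn_ge0 // ltW.
  rewrite ge_min; apply/orP; right; rewrite -mulrA; apply: ler_wpM2l => //.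
  by rewrite -{1}(subnKC (me : m <= e)%N) exprD mulrA -exprMn mulfV ?pnatr_eq0 // expr1n mul1r.
apply: le_trans (_ : \sum_(i < n) 2 * tau ^+ e * tau ^+ i <= _).
  apply: ler_sum => i _; apply: le_trans (_ : tau ^+ (e.+1 + i) * 2 <= _).
    by apply: ler_wpM2l; rewrite ?exprn_ge0 ?(ltW t0) // ge_min lexx.
  rewrite mulrC -mulrA; apply: ler_wpM2l => //.
  by rewrite -exprD; apply: ler_wiXn2l; rewrite ?(ltW t0) ?(ltW t1) // leq_add2r.
rewrite -mulr_sumr -!mulrA; apply: ler_wpM2l => //; rewrite mulrC.
apply: ler_pM; rewrite ?exprn_ge0 ?(ltW t0) //.
- by apply: sumr_ge0 => i _; rewrite exprn_ge0 // ltW.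
- by apply: sum_geometric_le => //; exact: ltW.
by have := scale_gap_ge t0 (leqnn e); rewrite subnn mulr1.
Qed.

End ScaleGap.

(** * Elementary bounds on the cosine *)

Section Trigonometry.
Variable R : realType.
Implicit Types (x y t r : R).

Lemma norm_sin_le x : `|sin x| <= `|x|.
Proof.
wlog x0 : x / 0 <= x => [hw|].
  have [/hw//|/ltW x0] := leP 0 x.
  by rewrite -(normrN x) -(normrN (sin x)) -sinN; apply: hw; rewrite oppr_ge0.
have [->|xn0] := eqVneq x 0; first by rewrite sin0 normr0.
have xp : 0 < x by rewrite lt_neqAle eq_sym xn0.
have [z _] := @MVT R sin cos 0 x xp (fun z _ => is_derive_sin z)
  (continuous_subspaceT (@continuous_sin R)).
rewrite sin0 !subr0 => ->; rewrite normrM -[leRHS]mul1r; apply: ler_wpM2r => //.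
exact: cos_max.
Qed.

Lemma one_sub_cos x : 1 - cos x = 2 * sin (x / 2) ^+ 2.
Proof.
have -> : cos x = cos ((x / 2) *+ 2) by congr cos; rewrite -mulr_natr divfK.
by rewrite cos_mulr2n cos2sin2 mulr2n; ring.
Qed.

Lemma one_sub_cos_ge0 x : 0 <= 1 - cos x.
Proof. by rewrite subr_ge0 cos_le1. Qed.

Lemma one_sub_cos_le2 x : 1 - cos x <= 2.
Proof. by rewrite lerBlDr -lerBlDl; have := cos_geN1 x; lra. Qed.

Lemma one_sub_cos_sqr x : 1 - cos x <= x ^+ 2 / 2.
Proof.
rewrite one_sub_cos -[sin _ ^+ 2]real_normK ?num_real //.
apply: le_trans (_ : 2 * `|x / 2| ^+ 2 <= _).
  by apply: ler_wpM2l => //; apply: lerXn2r; rewrite ?nnegrE ?norm_sin_le.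
rewrite real_normK ?num_real // le_eqVlt; apply/orP; left; apply/eqP.
by rewrite exprMn; field.
Qed.

(** Interpolation between the bound 2 and the quadratic bound. *)
Lemma one_sub_cos_powR x r : 0 < r -> r <= 2 -> 1 - cos x <= 2 * `|x| `^ r.
Proof.
move=> r0 r2; have [x1|x1] := leP 1 `|x|.
  apply: le_trans (one_sub_cos_le2 x) _; rewrite -[leLHS]mulr1 ler_wpM2l //.
  by rewrite -(powRr0 `|x|); apply: ler_powR => //; exact: ltW.
apply: le_trans (one_sub_cos_sqr x) _; have [->|xn0] := eqVneq x 0.
  by rewrite expr0n /= mul0r mulr_ge0 ?powR_ge0.
have xp : 0 < `|x| by rewrite normr_gt0.
apply: le_trans (_ : `|x| ^+ 2 <= _).
  by rewrite real_normK ?num_real // ler_pdivrMr // ler_peMr ?sqr_ge0 // ler1n.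
rewrite -powR_mulrn // -[leLHS]mul1r; apply: ler_pM; rewrite ?powR_ge0 //.
  by rewrite ler1n.
have e z : `|x| `^ z = (`|x|^-1) `^ (- z).
  by rewrite -powR_inv1 // -powRrM mulN1r opprK.
rewrite !e; apply: ler_powR; last by rewrite lerN2.
by rewrite invf_ge1 // ltW.
Qed.

Lemma cos_le0 x : pi / 2 <= x <= pi -> cos x <= 0.
Proof.
move=> /andP[x1 x2]; rewrite -cos_pihalf.
have p0 := pi_ge0 R.
rewrite leNgt; apply/negP => h; move: (h).
rewrite ltr_cos ?in_itv /= ?divr_ge0 //=; last 2 first.
- by apply/andP; split; first by apply: le_trans x1; rewrite divr_ge0.
- by rewrite ler_pdivrMr // ler_peMr // ler1n.
by move=> h2; have := lt_le_trans h2 x1; rewrite ltxx.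
Qed.

End Trigonometry.

(** * Characters of the discrete torus *)

Section TorusCharacters.
Variables (R : realType) (d T : nat).
Local Notation N := T.+1.
Local Notation torus := 'rV['I_N]_d.
Implicit Types (k x y : torus) (n m : nat).

Definition angle n : R := 2 * pi * n%:R / N%:R.

Lemma angleD n m : angle (n + m) = angle n + angle m.
Proof. by rewrite /angle natrD mulrDr mulrDl. Qed.

Lemma angle_period n : angle (n * N) = (pi *+ 2) *+ n.
Proof.
by rewrite /angle natrM mulrA mulfK ?pnatr_eq0 // -[RHS]mulr_natr -[pi *+ 2]mulr_natl.
Qed.

Lemma cos_sin_angle_mod n m : n = m %[mod N] ->
  cos (angle n) = cos (angle m) /\ sin (angle n) = sin (angle m).
Proof.
have red i : cos (angle i) = cos (angle (i %% N)) /\ sin (angle i) = sin (angle (i %% N)).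
  rewrite {1 3}(divn_eq i N) addnC angleD angle_period.
  by split; [rewrite (periodicn (@cosD2pi R))|rewrite (periodicn (@sinD2pi R))].
by move=> e; have [-> ->] := red n; have [-> ->] := red m; rewrite e.
Qed.

Definition dotn k x : nat := (\sum_i (k 0%R i * x 0%R i))%N.
Definition tcos k x : R := cos (angle (dotn k x)).
Definition tsin k x : R := sin (angle (dotn k x)).

Lemma dotnD k x y : dotn k (x + y) = dotn k x + dotn k y %[mod N].
Proof.
rewrite /dotn -big_split /=.
apply: (big_ind2 (fun a b => a = b %[mod N])) => // [a b a' b' e e'|i _].
  by rewrite -modnDm e e' modnDm.
by rewrite mxE /= modnMmr mulnDr.
Qed.

Lemma dotnC k x : dotn k x = dotn x k.
Proof. by apply: eq_bigr => i _; rewrite mulnC. Qed.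

Lemma dotn0 k : dotn k 0 = 0%N.
Proof. by rewrite /dotn big1 // => i _; rewrite mxE muln0. Qed.

Lemma tcosD k x y : tcos k (x + y) = tcos k x * tcos k y - tsin k x * tsin k y.
Proof.
by rewrite /tcos; have [-> _] := cos_sin_angle_mod (dotnD k x y); rewrite angleD cosD.
Qed.

Lemma tsinD k x y : tsin k (x + y) = tsin k x * tcos k y + tcos k x * tsin k y.
Proof.
by rewrite /tsin; have [_ ->] := cos_sin_angle_mod (dotnD k x y); rewrite angleD sinD.
Qed.

Lemma tcos0 k : tcos k 0 = 1.
Proof. by rewrite /tcos dotn0 /angle mulr0 mul0r cos0. Qed.

Lemma tsin0 k : tsin k 0 = 0.
Proof. by rewrite /tsin dotn0 /angle mulr0 mul0r sin0. Qed.

Lemma tchar_norm k x : tcos k x ^+ 2 + tsin k x ^+ 2 = 1.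
Proof. exact: cos2Dsin2. Qed.

Lemma torus_character k : character (tcos k) (tsin k).
Proof.
split=> [|x y|x|x]; [exact: tcos0|exact: tcosD| |].
- have e1 := tcosD k x (- x); have e2 := tsinD k x (- x); have := tchar_norm k x.
  rewrite subrr tcos0 in e1; rewrite subrr tsin0 in e2.
  move: e1 e2; set a := tcos k x; set b := tsin k x; set a' := tcos k _; set b' := tsin k _.
  move=> e1 e2 e3; have : a' * (a ^+ 2 + b ^+ 2) = a * (a * a' - b * b') + b * (b * a' + a * b') by ring.
  by rewrite e3 mulr1 -e1 -e2 => ->; ring.
- have e1 := tcosD k x (- x); have e2 := tsinD k x (- x); have := tchar_norm k x.
  rewrite subrr tcos0 in e1; rewrite subrr tsin0 in e2.
  move: e1 e2; set a := tcos k x; set b := tsin k x; set a' := tcos k _; set b' := tsin k _.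
  move=> e1 e2 e3; have : b' * (a ^+ 2 + b ^+ 2) = a * (b * a' + a * b') - b * (a * a' - b * b') by ring.
  by rewrite e3 mulr1 -e1 -e2 => ->; ring.
Qed.

Definition basis (i : 'I_d) n : torus := \row_j (if j == i then inZp n else 0).

Lemma basisD i n m : basis i (n + m) = basis i n + basis i m.
Proof.
apply/rowP => j; rewrite !mxE; case: ifP => _; last by rewrite addr0.
by apply/val_inj; rewrite /= modnDm.
Qed.

Lemma dotn_basis k i n : dotn k (basis i n) = (k 0%R i * n)%N %[mod N].
Proof.
rewrite /dotn (bigD1 i) //= mxE eqxx big1 ?addn0 ?modnMmr // => j /negbTE ji.
by rewrite mxE ji muln0.
Qed.

Lemma tcos_basis k i n : tcos k (basis i n) = cos (angle (k 0 i * n)).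
Proof. by rewrite /tcos; have [-> _] := cos_sin_angle_mod (dotn_basis k i n). Qed.

Lemma tcos_sym k x : tcos k x = tcos x k.
Proof. by rewrite /tcos dotnC. Qed.

Lemma angle_lt n : (n < N)%N -> 0 <= angle n < 2 * pi.
Proof.
have p0 := pi_gt0 R.
move=> nN; rewrite /angle divr_ge0 ?mulr_ge0 ?(ltW p0) //=.
by rewrite ltr_pdivrMr ?ltr0n // ltr_pM2l ?mulr_gt0 // ltr_nat.
Qed.

Lemma cos_lt1 (y : R) : 0 < y -> y < 2 * pi -> cos y < 1.
Proof.
move=> y0 y2; rewrite lt_neqAle cos_le1 andbT; apply/eqP => c1.
have : sin (y / 2) = 0.
  have := one_sub_cos y; rewrite c1 subrr => /esym/eqP.
  by rewrite mulf_eq0 pnatr_eq0 /= sqrf_eq0 => /eqP.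
have : 0 < sin (y / 2).
  by apply: sin_gt0_pi; rewrite divr_gt0 //= ltr_pdivrMr // mulrC.
by move=> h e; rewrite e ltxx in h.
Qed.

(** The sum over [k] is invariant under [k -> k + basis i 1]. The sine part vanishes by oddness, so
    the sum equals its own multiple by [tcos x (basis i 1)], a cosine other than 1 when
    [x 0 i != 0]. *)
Lemma torus_ortho x : \sum_k tcos k x = #|{: torus}|%:R * (x == 0)%:R.
Proof.
have [->|x0] := eqVneq x 0.
  by under eq_bigr do rewrite tcos0; rewrite sumr_const mulr1.
rewrite mulr0.
have [i xi] : exists i, x 0 i != 0.
  apply/existsP; apply: contraR x0 => /existsPn h; apply/eqP/rowP => i.
  by rewrite mxE; apply/eqP; rewrite -[_ == _]negbK h.
have N1 : (1 < N)%N.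
  by rewrite ltnS lt0n; apply: contra xi => /eqP T0; case: (x 0 i) => m mN; apply/eqP/val_inj => /=; move: mN; rewrite T0; case: m.
have symc k y : tcos k y = tcos y k by rewrite /tcos dotnC.
have syms k y : tsin k y = tsin y k by rewrite /tsin dotnC.
have S0 : \sum_k tsin k x = 0.
  under eq_bigr do rewrite syms -[tsin _ _]mulr1.
  by apply: (sum_odd (torus_character x)).
have : \sum_k tcos k x = tcos x (basis i 1) * \sum_k tcos k x.
  rewrite {1}(reindex_inj (addIr (basis i 1))) /=.
  under eq_bigr => k _ do rewrite symc tcosD -symc -syms.
  rewrite sumrB -!mulr_suml S0 mul0r subr0 mulrC.
  by [].
move/eqP; rewrite -subr_eq0 -{1}[\sum_k _]mul1r -mulrBl mulf_eq0 => /orP[|/eqP//].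
rewrite tcos_basis muln1 subr_eq0 => /eqP c1.
have /andP[_ a2] := angle_lt (ltn_ord (x 0 i)).
have a1 : 0 < angle (x 0 i).
  rewrite /angle divr_gt0 ?ltr0n // !mulr_gt0 ?pi_gt0 ?ltr0n //.
  by rewrite lt0n; apply: contra xi => /eqP e; apply/eqP/val_inj.
by have := cos_lt1 a1 a2; rewrite -c1 ltxx.
Qed.

(* Distance to [0] in the cyclic group. *)
Definition cabs (v : 'I_N) : nat := minn v (N - v).

Lemma cos_cabs (v : 'I_N) g : cos (angle (v * g)) = cos (angle (cabs v * g)).
Proof.
rewrite /cabs; case: leqP => // h.
have e : angle ((N - v) * g) = (pi *+ 2) *+ g - angle (v * g).
  apply/eqP; rewrite eq_sym subr_eq -angleD -mulnDl subnK; last exact/ltnW/ltn_ord.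
  by rewrite mulnC angle_period.
by rewrite e addrC (periodicn (@cosD2pi R)) cosN.
Qed.

Lemma cabsN (v : 'I_N) : cabs (- v) = cabs v.
Proof.
have vN := ltn_ord v; rewrite /cabs.
have -> : nat_of_ord (- v) = ((N - v) %% N)%N by [].
move: (nat_of_ord v) vN => n nN; have [->|n0] := posnP n.
  by rewrite subn0 modnn subn0.
rewrite modn_small; last by rewrite ltn_subrL n0.
by rewrite subKn ?(ltnW nN) // minnC.
Qed.

Definition supn x : nat := \max_i cabs (x 0%R i).

Lemma supnN x : supn (- x) = supn x.
Proof. by apply: eq_bigr => i _; rewrite mxE cabsN. Qed.

Lemma card_torus_box (P : pred 'I_N) :
  #|[set x : torus | [forall i, P (x 0 i)]]%SET| = (#|P| ^ d)%N.
Proof.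
rewrite -[in RHS](card_ord d) -card_ffun_on.
rewrite -(card_imset (ffun_on P) (f := fun f : {ffun 'I_d -> 'I_N} => \row_i f i : torus)).
  apply: eq_card => x; rewrite !inE; apply/forallP/imsetP => [Px|[f /ffun_onP Pf ->] i].
    exists [ffun i => x 0 i]; first by apply/ffun_onP => i; rewrite ffunE; apply: Px.
    by apply/rowP => i; rewrite mxE ffunE.
  by rewrite mxE; apply: Pf.
by move=> f f' /rowP e; apply/ffunP => i; have := e i; rewrite !mxE.
Qed.

Lemma card_interval lo hi : (lo <= hi <= N)%N ->
  #|[pred v : 'I_N | lo <= v < hi]%N| = (hi - lo)%N.
Proof.
move=> /andP[lh hN]; rewrite -sum1_card.
transitivity (\sum_(lo <= i < hi) 1)%N; last by rewrite sum_nat_const_nat muln1.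
rewrite big_geq_mkord (big_ord_widen_cond N (fun i => true && (lo <= i)%N) (fun=> 1%N)) //.
Qed.

End TorusCharacters.

(** This is the inequality of [char_gap_sub] with both angles shifted by pi, which leaves the cosine
    of their sum unchanged. *)
Lemma two_rotations (R : realFieldType) (a b c e : R) :
  b ^+ 2 + e ^+ 2 = 1 -> a ^+ 2 + c ^+ 2 = 1 ->
  2 <= 2 * (1 + a) + 2 * (1 + b) + (1 + (a * b - c * e)).
Proof.
have : 0 <= (c - e) ^+ 2 + (2 + a + b) ^+ 2 by rewrite addr_ge0 ?sqr_ge0.
nra.
Qed.

(** * Spectral gap of a spread-out kernel *)

Section TorusKernel.
Variables (R : realType) (d T J : nat).
Hypothesis TJ : T.+1 = (2 ^ J)%N.
Hypothesis d_gt0 : (0 < d)%N.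
Local Notation N := T.+1.
Local Notation torus := 'rV['I_N]_d.
Variables (rho A0 A1 vol : R) (l0 m1 M : nat).
Local Notation m0 := (m1 + l0)%N.
Local Notation tau := (2 ^+ d * rho).
Implicit Types (k x y : torus) (i : 'I_d) (m n : nat).

(** Consecutive boxes overlap, so that the lower half [small_box m] can be shifted by up to
    [2 ^ (m + m0)] along an axis without leaving the box. *)
Definition dyadic_box m : {set torus} :=
  [set x : torus | [forall i, (2 ^ (m + m0 + 1) <= x 0%R i < 2 ^ (m + m0 + 3))%N]]%SET.

(* A kernel at scale [2 ^ l0] with tail exponent encoded by [rho]; the lower
   bound is only required on dyadic boxes of the positive orthant. *)
Record torus_kernel (D : torus -> R) : Prop := TorusKernel {
  tk_ge0 : forall x, 0 <= D x;
  tk_sum : \sum_x D x = 1;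
  tk_sym : forall x, D (- x) = D x;
  tk_0 : D 0 = 0;
  tk_sup : forall x, D x <= A0 * vol;
  tk_tail : forall m x, (2 ^ (m + l0) <= supn x)%N -> D x <= A0 * vol * rho ^+ m;
  tk_range : forall x, (2 ^ (M + m0 + 3) < supn x)%N -> D x = 0;
  tk_low : forall m x, (m <= M)%N -> x \in dyadic_box m ->
    A1 * vol * rho ^+ m <= D x }.

(** The least dyadic shell containing [x] is taken. By minimality [x] is outside the previous one,
    where the tail bound applies; shell 0 uses the global bound. *)
Lemma shell_exists (F : torus -> R) (C : R) x :
  (forall y, F y <= C) ->
  (forall m y, (2 ^ (m + l0) <= supn y)%N -> F y <= C * rho ^+ m) ->
  (forall y, (2 ^ (M + m0 + 3) < supn y)%N -> F y = 0) ->
  F x != 0 -> exists m,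
  [/\ (m < M + m1 + 4)%N, (supn x <= 2 ^ (m.+1 + l0))%N & F x <= C * rho ^+ m].
Proof.
move=> sup tail range Fx; have xM : (supn x <= 2 ^ (M + m0 + 3))%N.
  by rewrite leqNgt; apply: contra Fx => /range ->.
have ex : exists m, (supn x <= 2 ^ (m.+1 + l0))%N.
  exists (M + m1 + 3)%N; apply: leq_trans xM _; rewrite leq_exp2l //; clear; lia.
case: (ex_minnP ex) => m h hmin; exists m; split => //.
  have : (m <= M + m1 + 3)%N.
    by apply: hmin; apply: leq_trans xM _; rewrite leq_exp2l //; clear; lia.
  by clear; lia.
case: m h hmin => [|m] h hmin; first by rewrite expr0 mulr1.
apply: tail; rewrite leqNgt; apply/negP => /ltnW /hmin.
by rewrite ltnn.
Qed.

Hypothesis rho_gt0 : 0 < rho.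
Hypothesis tau_lt1 : tau < 1.
Hypothesis A0_gt0 : 0 < A0.
Hypothesis A1_gt0 : 0 < A1.
Hypothesis vol_E : vol * (2 ^ l0)%:R ^+ d = 1.
Hypothesis MJ : (M + m0 + 5 <= J)%N.
Variable D : torus -> R.
Hypothesis DP : torus_kernel D.
Local Notation q k := (fourier (tcos R k) D).
Local Notation w k x := (1 - tcos R k x).

Let vol_gt0 : 0 < vol.
Proof.
have e0 : 0 < (2 ^ l0)%:R ^+ d :> R by rewrite exprn_gt0 // ltr0n expn_gt0.
by rewrite -(pmulr_lgt0 _ e0) vol_E.
Qed.
Let tau_gt0 : 0 < tau. Proof. by rewrite mulr_gt0 // exprn_gt0. Qed.
Let w_ge0 k x : 0 <= w k x.
Proof. exact: (char_gap_ge0 (torus_character R k)). Qed.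
Let w_sub k x y : w k (x + y) <= 2 * w k x + 2 * w k y.
Proof. exact: (char_gap_sub (torus_character R k)). Qed.
Let wN k x : w k (- x) = w k x.
Proof. by rewrite (charN (torus_character R k)). Qed.
Let D_ge0 x : 0 <= D x. Proof. exact: tk_ge0 DP x. Qed.
Local Hint Resolve D_ge0 : core.

Let gapE k : 1 - q k = \sum_x w k x * D x.
Proof. by rewrite fourier_gap (tk_sum DP). Qed.

Lemma pow2_le_N m : (m <= J)%N -> (2 ^ m <= N)%N.
Proof. by move=> mJ; rewrite TJ leq_exp2l. Qed.

Definition small_box m : {set torus} :=
  [set x : torus | [forall i, (2 ^ (m + m0 + 1) <= x 0%R i < 2 ^ (m + m0 + 2))%N]]%SET.

Lemma card_small_box m : (m <= M)%N -> #|small_box m| = ((2 ^ (m + m0 + 1)) ^ d)%N.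
Proof.
move=> mM; rewrite /small_box.
rewrite (card_torus_box d (fun v : 'I_N => 2 ^ (m + m0 + 1) <= v < 2 ^ (m + m0 + 2))%N).
rewrite (@card_interval T) ?leq_exp2l ?leq_add2l //=; last first.
  by apply: pow2_le_N; move: mM MJ; clear; lia.
by rewrite (addnS _ 1) expnS mul2n -addnn addnK.
Qed.

Lemma small_boxP m x : x \in small_box m -> x \in dyadic_box m.
Proof.
rewrite !inE => /forallP h; apply/forallP => i; have /andP[-> h2] := h i.
by apply: ltn_trans h2 _; rewrite ltn_exp2l // ltn_add2l.
Qed.

Lemma small_box_shift m x i g : (m <= M)%N -> (g <= 2 ^ (m + m0))%N ->
  x \in small_box m -> x + basis T i g \in dyadic_box m.
Proof.
move=> mM gm; rewrite !inE => /forallP h; apply/forallP => j; have /andP[h1 h2] := h j.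
rewrite !mxE; case: ifP => _; last first.
  rewrite /= addn0 modn_small // h1 /=.
  by apply: ltn_trans h2 _; rewrite ltn_exp2l // ltn_add2l.
have e3 : (2 ^ (m + m0 + 3) = 8 * 2 ^ (m + m0))%N by rewrite expnD mulnC.
have e2 : (2 ^ (m + m0 + 2) = 4 * 2 ^ (m + m0))%N by rewrite expnD mulnC.
have gN : (g < N)%N.
  apply: leq_ltn_trans gm _; rewrite TJ ltn_exp2l //.
  by move: mM MJ; clear; lia.
have bN : (2 ^ (m + m0 + 3) <= N)%N by apply: pow2_le_N; move: mM MJ; clear; lia.
rewrite /= (modn_small gN) modn_small.
  apply/andP; split; first exact: leq_trans h1 (leq_addr _ _).
  by rewrite e2 in h2; rewrite e3; move: h2 gm; move: (2 ^ (m + m0))%N => z; clear; lia.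
apply: leq_trans bN; rewrite e2 in h2; rewrite e3; move: h2 gm.
by move: (2 ^ (m + m0))%N => z; clear; lia.
Qed.

(** Of the 1/8, a factor 1/4 is the cost of [w_sub] in the pairing and 1/2 that of the double
    covering by boxes. The power of 2 is the volume of a small box relative to its scale. *)
Definition gap_low : R := A1 * 2 ^+ (d * (m1 + 1)) / 8.

Lemma gap_low_gt0 : 0 < gap_low.
Proof. by rewrite /gap_low !mulr_gt0 ?exprn_gt0 ?invr_gt0. Qed.

(** One coordinate decides: its binary logarithm is [m + m0 + 1] or [m + m0 + 2]. *)
Lemma box_multiplicity x M' :
  \sum_(m < M') (x \in dyadic_box m)%:R <= 2 :> R.
Proof.
pose i := Ordinal d_gt0; pose e := trunc_log 2 (x 0 i).
have key m : x \in dyadic_box m -> (m + m0 + 1 <= e < m + m0 + 3)%N.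
  rewrite inE => /forallP/(_ i)/andP[h1 h2]; apply/andP; split.
    exact: trunc_log_max.
  rewrite -(ltn_exp2l _ _ (isT : 1 < 2)%N); apply: leq_ltn_trans h2.
  by apply: trunc_logP => //; apply: leq_trans h1; rewrite expn_gt0.
apply: le_trans (_ : \sum_(m < M') (((m + m0 + 1 == e)%N)%:R +
    ((m + m0 + 2 == e)%N)%:R) <= _).
  apply: ler_sum => m _; rewrite -natrD ler_nat.
  case xm: (x \in dyadic_box m) => //; have := key _ xm; clear -m1 l0; lia.
rewrite big_split (_ : 2 = 1 + 1) //; apply: lerD.
  by apply: (@sum_unique_le1 _ _ (fun m => m + m0 + 1 == e)%N) => a b /eqP h1 /eqP h2; lia.
by apply: (@sum_unique_le1 _ _ (fun m => m + m0 + 2 == e)%N) => a b /eqP h1 /eqP h2; lia.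
Qed.

(* Pairing [x] with [x + g e_i] inside each box. *)
Lemma gap_lower k i M' (g : nat -> nat) : (M' <= M)%N ->
  (forall m, (m <= M')%N -> (g m <= 2 ^ (m + m0))%N) ->
  gap_low * \sum_(m < M'.+1) tau ^+ m * w k (basis T i (g m)) <= 1 - q k.
Proof.
move=> MM gm.
have h2 : \sum_(m < M'.+1) \sum_(x in dyadic_box m) w k x * D x <= 2 * (1 - q k).
  rewrite gapE mulr_sumr.
  under eq_bigr do rewrite big_mkcond /=.
  rewrite exchange_big; apply: ler_sum => x _ /=.
  apply: le_trans (ler_wpM2r _ (box_multiplicity x M'.+1)); last exact: mulr_ge0.
  rewrite mulr_suml; apply: ler_sum => m _.
  by case: ifP => _; rewrite ?mul1r ?mulr0n ?mul0r.
rewrite -(ler_pM2l (ltr0n R 2)); apply: le_trans h2.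
rewrite mulrA mulr_sumr; apply: ler_sum => -[m /= mM'] _.
have mM : (m <= M)%N by apply: leq_trans MM.
set B := A1 * vol * rho ^+ m.
have B0 : 0 <= B by rewrite /B !mulr_ge0 ?exprn_ge0 // ltW.
have S1 : B * \sum_(x in small_box m) w k x <= \sum_(x in dyadic_box m) w k x * D x.
  rewrite mulr_sumr big_mkcond [leRHS]big_mkcond /=; apply: ler_sum => x _.
  case: ifP => [xs|_]; last by case: ifP => // _; rewrite mulr_ge0.
  by rewrite (small_boxP xs) mulrC; apply: ler_wpM2l => //; apply: (tk_low DP) (small_boxP xs).
have S2 : B * \sum_(x in small_box m) w k (x + basis T i (g m)) <=
    \sum_(x in dyadic_box m) w k x * D x.
  rewrite mulr_sumr big_mkcond [leRHS]big_mkcond /=.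
  rewrite [leRHS](reindex_inj (addIr (basis T i (g m)))); apply: ler_sum => x _ /=.
  case: ifP => [xs|_]; last by case: ifP => // _; rewrite mulr_ge0.
  have xd := small_box_shift i mM (gm _ mM') xs.
  by rewrite xd mulrC; apply: ler_wpM2l => //; apply: (tk_low DP) xd.
set Sm := \sum_(x in dyadic_box m) _ in S1 S2 *.
have S3 : (#|small_box m|)%:R * w k (basis T i (g m)) <=
   2 * (\sum_(x in small_box m) w k x) + 2 * \sum_(x in small_box m) w k (x + basis T i (g m)).
  rewrite -sumr_const !mulr_sumr mulr_suml -big_split /=; apply: ler_sum => x _.
  by have := w_sub k (- x) (x + basis T i (g m)); rewrite addKr wN mul1r.
apply: le_trans (_ : 4^-1 * (B * ((#|small_box m|)%:R * w k (basis T i (g m)))) <= _); last first.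
  have := ler_wpM2l B0 S3; move: S1 S2.
  set X := \sum_(x in small_box m) w k x; set Y := \sum_(x in _) w k (x + _).
  have -> : B * (2 * X + 2 * Y) = 2 * (B * X) + 2 * (B * Y) by ring.
  by move: (B * X) (B * Y) (B * (_ * _)) => a b c; lra.
rewrite card_small_box // natrX.
have -> : (2 ^ (m + m0 + 1))%:R = 2 ^+ m * 2 ^+ (m1 + 1) * (2 ^ l0)%:R :> R.
  by rewrite !natrX -!exprD; congr (_ ^+ _); nlia.
rewrite !exprMn /B /gap_low.
have -> : 4^-1 * (A1 * vol * rho ^+ m * ((2 ^+ m) ^+ d * (2 ^+ (m1 + 1)) ^+ d *
    (2 ^ l0)%:R ^+ d * w k (basis T i (g m)))) =
    (vol * (2 ^ l0)%:R ^+ d) * (4^-1 * (A1 * rho ^+ m * ((2 ^+ m) ^+ d *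
    (2 ^+ (m1 + 1)) ^+ d * w k (basis T i (g m))))) by ring.
rewrite vol_E mul1r -!exprM (mulnC d (m1 + 1)) (mulnC m d) -(mulrA A1).
by rewrite le_eqVlt; apply/orP; left; apply/eqP; field.
Qed.

Lemma w_double k i e j : w k (basis T i (2 ^ (e + j))) <= 4 ^+ j * w k (basis T i (2 ^ e)).
Proof.
elim: j => [|j IH]; first by rewrite addn0 mul1r.
rewrite addnS expnS mul2n -addnn basisD exprS -mulrA.
apply: le_trans (w_sub _ _ _) _; rewrite -mulrDl; apply: ler_pM => //.
by rewrite -natrD.
Qed.

(** The hypothesis places the angle between [pi / 2] and [pi]. *)
Lemma gap_half k i e : (2 ^ (J - 2) <= 2 ^ e * cabs (k 0%R i) <= 2 ^ (J - 1))%N ->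
  1 <= w k (basis T i (2 ^ e)).
Proof.
move=> /andP[h1 h2]; rewrite lerDl oppr_ge0 tcos_basis cos_cabs; apply: cos_le0.
have J2 : (2 <= J)%N by move: MJ; clear; lia.
have p0 := pi_gt0 R; have N0 : 0 < N%:R :> R by rewrite ltr0n.
have e4 : N%:R = 4 * (2 ^ (J - 2))%:R :> R.
  by rewrite TJ -{1}(subnKC J2) expnD natrM.
have e2 : N%:R = 2 * (2 ^ (J - 1))%:R :> R.
  by rewrite TJ -{1}(subnKC (ltnW J2)) expnD natrM.
rewrite /angle mulnC; apply/andP; split.
  rewrite ler_pdivlMr // e4.
  apply: le_trans (_ : 2 * pi * (2 ^ (J - 2))%:R <= _); first by lra.
  by rewrite ler_wpM2l ?ler_nat // mulr_ge0 // ltW.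
rewrite ler_pdivrMr // e2.
apply: le_trans (_ : 2 * pi * (2 ^ (J - 1))%:R <= _); last by lra.
by rewrite ler_wpM2l ?ler_nat // mulr_ge0 // ltW.
Qed.

Lemma mode_scale (K : nat) : (0 < K)%N -> (K <= 2 ^ (J - 1))%N ->
  exists e, (2 ^ (J - 2) <= 2 ^ e * K <= 2 ^ (J - 1))%N.
Proof.
move=> K0 KJ.
have ex : exists e, (2 ^ e * K <= 2 ^ (J - 1))%N by exists 0%N; rewrite mul1n.
have bd e : (2 ^ e * K <= 2 ^ (J - 1))%N -> (e <= J)%N.
  move=> h; rewrite -(leq_exp2l _ _ (isT : 1 < 2)%N).
  apply: leq_trans (_ : 2 ^ e * K <= _)%N; first exact: leq_pmulr.
  by apply: leq_trans h _; rewrite leq_exp2l // leq_subr.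
case: (ex_maxnP ex bd) => e h1 h2.
exists e; rewrite h1 andbT leqNgt; apply/negP => h3.
suff : (e.+1 <= e)%N by rewrite ltnn.
apply: h2; rewrite expnS -mulnA.
have J2 : (2 <= J)%N by move: MJ; clear; lia.
have -> : (2 ^ (J - 1) = 2 * 2 ^ (J - 2))%N by rewrite -expnS; congr expn; lia.
by rewrite leq_pmul2l // ltnW.
Qed.

Lemma cabs_le (v : 'I_N) : (cabs v <= 2 ^ (J - 1))%N.
Proof.
have J1 : (1 <= J)%N by move: MJ; clear; lia.
rewrite /cabs; have := ltn_ord v; move: (nat_of_ord v) => a; rewrite TJ.
have -> : (2 ^ J = 2 * 2 ^ (J - 1))%N by rewrite -expnS; congr expn; nlia.
by move: (2 ^ (J - 1))%N => b; clear; lia.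
Qed.

Lemma supn_attained k : exists i, supn k = cabs (k 0 i).
Proof.
have d0 : (0 < #|'I_d|)%N by rewrite card_ord.
have [i e] := @bigop.eq_bigmax _ (fun i : 'I_d => cabs (k 0%R i)) d0.
by exists i.
Qed.

Definition sigma : R := Num.max tau 4^-1.

Lemma sigma_gt0 : 0 < sigma.
Proof. by rewrite /sigma lt_max tau_gt0. Qed.
Lemma sigma_le1 : sigma <= 1.
Proof. by rewrite /sigma ge_max (ltW tau_lt1) invf_le1 // ler1n. Qed.

(** For [j = 0] a shift of at most [2 ^ m0], available in box 0, turns the mode by a quarter.
    Otherwise, at the first [j] for which the shift [2 ^ (m0 + j)] does so, it is made either in box
    [j], at the price [tau ^+ j], or by doublings from a shift in box 0, at the price [4^-1 ^+ j];
    [sigma] is the better ratio. *)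
Lemma gap_power k j : (j <= M)%N -> (2 ^ (J - 2) < 2 ^ (m0 + j) * supn k)%N ->
  gap_low * sigma ^+ j <= 1 - q k.
Proof.
have s0 := ltW sigma_gt0; have gl := ltW gap_low_gt0.
elim: j => [|j IH] jM hj.
  have [i ki] := supn_attained k; rewrite ki addn0 in hj.
  have K0 : (0 < cabs (k 0%R i))%N by move: hj; case: (cabs _) => //; rewrite muln0.
  have [e /andP[e1 e2]] := mode_scale K0 (cabs_le _).
  have em : (e <= m0)%N.
    rewrite -ltnS -(ltn_exp2l _ _ (isT : 1 < 2)%N) -(ltn_pmul2r K0).
    apply: leq_ltn_trans e2 _; rewrite expnS -mulnA.
    have -> : (2 ^ (J - 1) = 2 * 2 ^ (J - 2))%N by rewrite -expnS; congr expn; move: MJ; clear; lia.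
    by rewrite ltn_pmul2l.
  have := @gap_lower k i 0 (fun=> 2 ^ e)%N (leq0n _).
  rewrite big_ord1 expr0 mul1r => h; apply: le_trans (h _); last first.
    by move=> m; rewrite leqn0 => /eqP->; rewrite leq_exp2l.
  by apply: ler_wpM2l => //; rewrite ?expr0; apply: gap_half; rewrite e1.
have [h|h] := ltnP (2 ^ (J - 2)) (2 ^ (m0 + j) * supn k).
  apply: le_trans (IH (ltnW jM) h); rewrite exprS mulrCA.
  by rewrite ler_piMl ?sigma_le1 // mulr_ge0 // exprn_ge0.
have [i ki] := supn_attained k; rewrite ki in h hj.
have e1 : (2 ^ (J - 2) <= 2 ^ (m0 + j.+1) * cabs (k 0%R i) <= 2 ^ (J - 1))%N.
  rewrite (ltnW hj) addnS expnS -mulnA.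
  have -> : (2 ^ (J - 1) = 2 * 2 ^ (J - 2))%N by rewrite -expnS; congr expn; move: MJ; clear; lia.
  by rewrite leq_pmul2l.
have w1 := gap_half e1.
have [t4|t4] := leP tau 4^-1.
  have -> : sigma = 4^-1 by rewrite /sigma max_r.
  have := @gap_lower k i 0 (fun=> 2 ^ m0)%N (leq0n _).
  rewrite big_ord1 expr0 mul1r => h'; apply: le_trans (h' _); last first.
    by move=> m; rewrite leqn0 => /eqP->.
  apply: ler_wpM2l => //; have := w_double k i m0 j.+1.
  move/(le_trans w1) => w2; rewrite exprVn -[leLHS]mulr1 mulrC ler_pdivrMr ?exprn_gt0 //.
  by rewrite mulrC.
have -> : sigma = tau by rewrite /sigma max_l // ltW.
have := @gap_lower k i j.+1 (fun m => if m == j.+1 then 2 ^ (m0 + j.+1) else 0)%N jM.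
move=> h'; apply: le_trans (h' _); last first.
  by move=> m mj; case: eqP => [->|//]; rewrite leq_exp2l // addnC.
apply: ler_wpM2l => //; rewrite big_ord_recr /= eqxx -[leLHS]add0r; apply: lerD.
  by apply: sumr_ge0 => m _; rewrite mulr_ge0 // exprn_ge0 // ltW.
by rewrite -[leLHS]mulr1; apply: ler_wpM2l; rewrite ?exprn_ge0 ?(ltW tau_gt0).
Qed.

Definition eta : R := 2 / 5 * A1 * 2 ^+ (d * (m1 + 1)).
Lemma eta_gt0 : 0 < eta. Proof. by rewrite /eta !mulr_gt0 ?exprn_gt0. Qed.

(* If [cos] is near [-1] at [x] and [y], then it is near [1] at [x + y]. *)
Lemma q_lower k : eta <= 1 + q k.
Proof.
pose v x := 1 + tcos R k x.
have v0 x : 0 <= v x.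
  have := char_abs (torus_character R k) x; rewrite ler_norml => /andP[h _].
  by rewrite /v -lerBlDl sub0r.
have vq : 1 + q k = \sum_x v x * D x.
  by rewrite -(tk_sum DP) -big_split /=; apply: eq_bigr => x _; rewrite mulrDl mul1r.
set B := A1 * vol; have Bp : 0 < B by rewrite mulr_gt0.
have low x : x \in dyadic_box 0 -> B <= D x.
  by move=> xd; have := tk_low DP (leq0n M) xd; rewrite mulr1.
set Q := small_box 0.
have S1 : B * \sum_(x in Q) v x <= 1 + q k.
  rewrite vq mulr_sumr big_mkcond /=; apply: ler_sum => x _.
  case: ifP => [xQ|_]; last exact: mulr_ge0.
  by rewrite mulrC; apply: ler_wpM2l => //; apply/low/small_boxP.
have S2 y : y \in Q -> B * \sum_(x in Q) v (x + y) <= 1 + q k.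
  move=> yQ; rewrite vq mulr_sumr big_mkcond [leRHS](reindex_inj (addIr y)).
  apply: ler_sum => x _ /=; case: ifP => [xQ|_]; last exact: mulr_ge0.
  rewrite mulrC; apply: ler_wpM2l => //; apply: low.
  move: xQ yQ; rewrite /Q !inE !add0n => /forallP xQ /forallP yQ; apply/forallP => i.
  have /andP[x1 x2] := xQ i; have /andP[y1 y2] := yQ i; rewrite mxE /=.
  have e3 : (2 ^ (m0 + 3) = 8 * 2 ^ m0)%N by rewrite expnD mulnC.
  have e2 : (2 ^ (m0 + 2) = 4 * 2 ^ m0)%N by rewrite expnD mulnC.
  have bN : (2 ^ (m0 + 3) <= N)%N by apply: pow2_le_N; move: MJ; clear; lia.
  rewrite e2 in x2 y2.
  have lt8 : (x 0%R i + y 0%R i < 2 ^ (m0 + 3))%N.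
    rewrite e3; move: x2 y2; move: (2 ^ m0)%N => z.
    by move: (nat_of_ord (x 0 i)) (nat_of_ord (y 0 i)) => a b; clear; lia.
  rewrite modn_small ?lt8 ?andbT; last exact: leq_trans lt8 bN.
  exact: leq_trans x1 (leq_addr _ _).
have key x y : 2 <= 2 * v x + 2 * v y + v (x + y).
  rewrite /v tcosD; have := tchar_norm R k x; have := tchar_norm R k y.
  set a := tcos _ _ x; set b := tcos _ _ y; set c := tsin _ _ x; set e := tsin _ _ y => h1 h2.
  exact: two_rotations.
set NQ : R := #|Q|%:R.
have cst (a : R) : \sum_(x in Q) a = NQ * a by rewrite sumr_const mulr_natl.
have S3 y : y \in Q -> NQ * (2 * B) <= 3 * (1 + q k) + (2 * NQ * B) * v y.
  move=> yQ; have h : B * \sum_(x in Q) 2 <= B * \sum_(x in Q) (2 * v x + 2 * v y + v (x + y)).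
    by apply: ler_wpM2l; [exact: ltW|apply: ler_sum => x _; exact: key].
  have e : \sum_(x in Q) (2 * v x + 2 * v y + v (x + y)) =
      2 * (\sum_(x in Q) v x) + NQ * (2 * v y) + \sum_(x in Q) v (x + y).
    by rewrite 2!big_split /= (cst (2 * v y)) -mulr_sumr.
  rewrite e (cst 2) in h.
  move: (S2 y yQ) S1 h.
  set X := \sum_(x in Q) v x; set Y := \sum_(x in Q) v (x + y).
  have -> : B * (2 * X + NQ * (2 * v y) + Y) = 2 * (B * X) + 2 * NQ * B * v y + B * Y by ring.
  have -> : B * (NQ * 2) = NQ * (2 * B) by ring.
  by move: (B * X) (B * Y) (NQ * _) (_ * v y) (1 + q k) => a b c e' f; lra.
have Qc : 0 < NQ by rewrite ltr0n card_small_box // expn_gt0 expn_gt0.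
have S4 : 2 / 5 * (B * NQ) <= 1 + q k.
  have h : NQ * (NQ * (2 * B)) <= NQ * (3 * (1 + q k)) + 2 * NQ * B * \sum_(y in Q) v y.
    rewrite -(cst (NQ * (2 * B))) -(cst (3 * (1 + q k))) mulr_sumr -big_split /=.
    by apply: ler_sum => y; exact: S3.
  have e : 2 * NQ * B * \sum_(y in Q) v y = NQ * (2 * (B * \sum_(y in Q) v y)) by ring.
  rewrite e -mulrDr ler_pM2l // in h; move: S1 h.
  have -> : NQ * (2 * B) = 2 * (B * NQ) by ring.
  by move: (B * NQ) (1 + q k) (B * _) => a b c; lra.
apply: le_trans S4; rewrite /NQ card_small_box // add0n natrX.
have -> : (2 ^ (m0 + 1))%:R = 2 ^+ (m1 + 1) * (2 ^ l0)%:R :> R.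
  by rewrite !natrX -!exprD; congr (_ ^+ _); nlia.
rewrite exprMn /B /eta.
have -> : 2 / 5 * (A1 * vol * ((2 ^+ (m1 + 1)) ^+ d * (2 ^ l0)%:R ^+ d)) =
  (vol * (2 ^ l0)%:R ^+ d) * (2 / 5 * A1 * (2 ^+ (m1 + 1)) ^+ d) by ring.
by rewrite vol_E mul1r -exprM mulnC.
Qed.

Definition gap_ratio : R := 1 + 2 / eta.

Lemma gap_ratio_ge1 : 1 <= gap_ratio.
Proof. by rewrite lerDl divr_ge0 // ltW // eta_gt0. Qed.

(** If [q k < 0], then [1 - |q k| = 1 + q k >= eta], while [1 - q k] is at most 2. *)
Lemma q_gap_ratio k : 1 - q k <= gap_ratio * (1 - `|q k|).
Proof.
have e0 := eta_gt0; have ql := q_lower k.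
have q1 : 0 <= 1 - q k by rewrite gapE sumr_ge0 // => x _; rewrite mulr_ge0.
have [q0|q0] := leP 0 (q k).
  by rewrite ger0_norm // ler_peMl // gap_ratio_ge1.
rewrite ltr0_norm // opprK /gap_ratio mulrDl mul1r.
have h : 2 <= 2 / eta * (1 + q k).
  rewrite -mulrA ler_peMr // mulrC ler_pdivlMr // mul1r //.
by move: h ql; move: (2 / eta * _) => z; lra.
Qed.

(** Parseval: the mean of [q ^+ 2] is the return probability after two steps, at most the supremum
    of [D]. *)
Lemma mean_q2 : \sum_k q k ^+ 2 <= #|{: torus}|%:R * (A0 * vol).
Proof.
have e : \sum_k q k ^+ 2 = #|{: torus}|%:R * \sum_y D y * D (0 - y).
  transitivity (\sum_k fourier (tcos R k) (fun x => \sum_y D y * D (x - y))).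
    apply: eq_bigr => k _; rewrite (fourier_conv (torus_character R k)) //.
    exact: (tk_sym DP).
  rewrite /fourier exchange_big /= (bigD1 0) //= -mulr_suml torus_ortho eqxx mulr1.
  rewrite [X in _ + X = _]big1 ?addr0 // => x x0.
  by rewrite -mulr_suml torus_ortho (negbTE x0) mulr0 mul0r.
rewrite e; apply: ler_wpM2l => //; rewrite -[leRHS]mul1r -(tk_sum DP) mulr_suml.
by apply: ler_sum => y _; apply: ler_wpM2l => //; exact: (tk_sup DP).
Qed.

Lemma card_supn_le Z : (0 < Z)%N ->
  (#|[set k : torus | (supn k <= Z)%N]%SET| <= (3 * Z) ^ d)%N.
Proof.
move=> Z0.
have -> : [set k : torus | (supn k <= Z)%N]%SET =
    [set k : torus | [forall i, (cabs (k 0%R i) <= Z)%N]]%SET.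
  apply/setP => k; rewrite !inE; apply/bigmax_leqP/forallP => [h i|h i _]; exact: h.
rewrite (card_torus_box d (fun v : 'I_N => cabs v <= Z)%N) leq_exp2r //.
pose P1 := [pred v : 'I_N | 0 <= v < minn Z.+1 N]%N.
pose P2 := [pred v : 'I_N | N - Z <= v < N]%N.
have c1 : #|P1| = minn Z.+1 N by rewrite (@card_interval T) ?subn0 // geq_minr.
have c2 : #|P2| = (N - (N - Z))%N by rewrite (@card_interval T) // leq_subr leqnn.
apply: leq_trans (_ : #|[predU P1 & P2]| <= _)%N.
  apply: subset_leq_card; apply/fintype.subsetP => v; rewrite !inE /cabs unfold_in.
  by have := ltn_ord v; move: (nat_of_ord v) => a; clear; lia.
rewrite -(leq_add2r #|[predI P1 & P2]|) cardUI c1 c2.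
by move: #|_| => z; move: Z0; clear; lia.
Qed.

Lemma card_supn_shell m : \sum_(x : torus) ((supn x <= 2 ^ (m.+1 + l0))%N)%:R <=
    6 ^+ d * (2 ^+ d) ^+ m * (2 ^ l0)%:R ^+ d :> R.
Proof.
apply: le_trans (_ : (((3 * 2 ^ (m.+1 + l0)) ^ d)%N)%:R <= _).
  apply: le_trans (_ : #|[set k : torus | (supn k <= 2 ^ (m.+1 + l0))%N]%SET|%:R <= _).
    rewrite -sumr_const [leRHS]big_mkcond /=.
    by apply: ler_sum => x _; rewrite inE; case: ifP.
  by rewrite ler_nat card_supn_le // expn_gt0.
have e : (2 ^+ d) ^+ m = (2 ^+ m) ^+ d :> R by rewrite -!exprM mulnC.
rewrite natrX e -!exprMn le_eqVlt; apply/orP; left; apply/eqP; congr (_ ^+ _).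
by rewrite expnD expnS !natrM natrX; ring.
Qed.

Lemma card_torus : #|{: torus}|%:R = (2 ^ J)%:R ^+ d :> R.
Proof. by rewrite card_mx card_ord mul1n natrX TJ. Qed.

Lemma card_low_modes j : (j <= M)%N ->
  (#|[set k : torus | (2 ^ (m0 + j) * supn k <= 2 ^ (J - 2))%N]%SET|)%:R <=
  #|{: torus}|%:R * (vol * (2 ^+ d)^-1 ^+ j) :> R.
Proof.
move=> jM; have jJ : (m0 + j <= J - 2)%N by move: jM MJ; clear; lia.
have -> : [set k : torus | (2 ^ (m0 + j) * supn k <= 2 ^ (J - 2))%N]%SET =
    [set k : torus | (supn k <= 2 ^ (J - 2 - (m0 + j)))%N]%SET.
  by apply/setP => k; rewrite !inE -{1}(subnKC jJ) (expnD 2 (m0 + j)) leq_pmul2l // expn_gt0.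
set Z := (2 ^ (J - 2 - (m0 + j)))%N; have Z0 : (0 < Z)%N by rewrite expn_gt0.
apply: le_trans (_ : ((3 * Z)%:R : R) ^+ d <= _).
  by rewrite -natrX ler_nat card_supn_le.
have e : (2 ^ J)%:R = 4 * Z%:R * (2 ^+ j * 2 ^+ m1 * (2 ^ l0)%:R) :> R.
  rewrite /Z !natrX (_ : 4 = 2 ^+ 2) -?natrX // !natrX -!exprD; congr (_ ^+ _).
  by move: jJ MJ; clear; lia.
rewrite card_torus e !exprMn -exprVn -exprM (mulnC d j) exprM.
have -> : (4 ^+ d * Z%:R ^+ d * ((2 ^+ j) ^+ d * (2 ^+ m1) ^+ d * (2 ^ l0)%:R ^+ d) *
    (vol * (2^-1 ^+ j) ^+ d)) = (vol * (2 ^ l0)%:R ^+ d) * ((2 ^+ j * 2^-1 ^+ j) ^+ d) *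
    ((2 ^+ m1) ^+ d * (4 ^+ d * Z%:R ^+ d)) by rewrite !exprMn; ring.
rewrite vol_E -exprMn mulfV ?pnatr_eq0 // expr1n expr1n !mul1r natrM exprMn.
rewrite -[leLHS]mul1r; apply: ler_pM; rewrite ?mulr_ge0 ?exprn_ge0 //.
  by rewrite !exprn_ege1 // ler1n.
by apply: ler_wpM2r; rewrite ?exprn_ge0 //; apply: lerXn2r; rewrite ?nnegrE ?ler_nat.
Qed.

(** * Averaging the decay over the modes *)

Section ModeDecay.
Variable theta : R.
Hypothesis theta_gt2 : 2 < theta.
Hypothesis sigma_theta : sigma^-1 `^ theta < 2 ^+ d.

Definition mode_floor : R := Num.min 1 (gap_low / gap_ratio).
Local Notation ct := (mode_floor^-1 `^ theta).
Local Notation st := (sigma^-1 `^ theta).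
Definition mode_decay_const : R := A0 * ct + ct * st / (1 - st / 2 ^+ d) + 1.

Let gr0 : 0 < gap_ratio. Proof. exact: lt_le_trans ltr01 gap_ratio_ge1. Qed.

Lemma mode_floor_gt0 : 0 < mode_floor.
Proof. by rewrite lt_min ltr01 divr_gt0 // gap_low_gt0. Qed.

Lemma mode_floor_gap k t : 0 <= t -> gap_low * t <= 1 - q k ->
  mode_floor * t <= 1 - `|q k|.
Proof.
move=> t0 h; have g := le_trans h (q_gap_ratio k).
apply: le_trans (_ : gap_low / gap_ratio * t <= _).
  by apply: ler_wpM2r => //; rewrite ge_min lexx orbT.
by rewrite mulrAC ler_pdivrMr // [leRHS]mulrC.
Qed.

Lemma phi_le_om (t x : R) n : 0 < x -> x <= 1 -> x <= t ->
  phi theta t n <= x^-1 `^ theta * phi theta 1 n.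
Proof.
move=> x0 x1 xt; have t0 := lt_le_trans x0 xt.
apply: (powRN_le theta_gt2).
- by rewrite ltr_pwDl // mulr_ge0 // ltW.
- by rewrite ltr_pwDl // mulr_ge0.
- by rewrite invr_ge0 ltW.
rewrite mul1r mulrDr mulr1; apply: lerD; first by rewrite invf_ge1.
by rewrite mulrA -[leLHS]mul1r; apply: ler_wpM2r => //; rewrite ler_pdivlMl // mulr1.
Qed.

Lemma abs_q_le1 k : `|q k| <= 1.
Proof.
apply: le_trans (fourier_abs (torus_character R k) _) _.
by rewrite -(tk_sum DP); apply: ler_sum => x _; rewrite ger0_norm.
Qed.

Lemma q2_le1 k : q k ^+ 2 <= 1.
Proof. by rewrite -real_normK ?num_real // exprn_ile1 // abs_q_le1. Qed.

Lemma phi_ge0 t n : 0 <= phi theta t n. Proof. exact: powR_ge0. Qed.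

(** Modes are sorted by the least [j] to which [gap_power] applies: [j = 0], then [0 < j <= M], then
    the modes too low to be resolved. Only the first class keeps [q ^+ 2], for [mean_q2]; the others
    are few and will be counted. *)
Lemma mode_pointwise k n :
  q k ^+ 2 * phi theta (1 - `|q k|) n <=
  ct * phi theta 1 n * q k ^+ 2 +
  \sum_(j < M) (ct * st ^+ j.+1 * phi theta 1 n) *
     ((2 ^ (m0 + j) * supn k <= 2 ^ (J - 2))%N)%:R +
  ((2 ^ (m0 + M) * supn k <= 2 ^ (J - 2))%N)%:R.
Proof.
set P := (2 ^ (J - 2))%N.
have om0 := phi_ge0 1 n; have ct0 : 0 <= ct := powR_ge0 _ _.
have st0 : 0 <= st := powR_ge0 _ _.
have T2 : 0 <= \sum_(j < M) (ct * st ^+ j.+1 * phi theta 1 n) * ((2 ^ (m0 + j) * supn k <= P)%N)%:R.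
  by apply: sumr_ge0 => j _; rewrite !mulr_ge0 ?exprn_ge0.
have T1 : 0 <= ct * phi theta 1 n * q k ^+ 2 by rewrite mulr_ge0 ?sqr_ge0 // mulr_ge0.
have pos (x : R) : 0 < x -> x <= 1 -> 0 < mode_floor * x <= 1.
  move=> x0 x1; rewrite mulr_gt0 ?mode_floor_gt0 //= mulr_ile1 ?(ltW x0) ?(ltW mode_floor_gt0) //.
  by rewrite ge_min lexx.
have [h0|h0] := ltnP P (2 ^ (m0 + 0) * supn k).
  have g := gap_power (leq0n M) h0; have := mode_floor_gap ler01 g.
  have /andP[p1 p2] := pos 1 ltr01 (lexx 1); rewrite mulr1 in p1 p2 *.
  move=> /(phi_le_om n p1 p2) h.
  rewrite -[leLHS]addr0 -[leLHS]addr0; apply: lerD => //; apply: lerD => //.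
  by rewrite mulrC; apply: ler_wpM2r => //; rewrite sqr_ge0.
have [hM|hM] := leqP (2 ^ (m0 + M) * supn k) P.
  rewrite -[leLHS]add0r; apply: lerD; first exact: addr_ge0.
  rewrite mulr1n -[leRHS]mulr1; apply: ler_pM; rewrite ?sqr_ge0 ?q2_le1 ?phi_ge0 //.
  by have := @phi_le1 R theta; apply => //; rewrite subr_ge0 abs_q_le1.
have ex : exists j, (P < 2 ^ (m0 + j) * supn k)%N by exists M.
case: (ex_minnP ex) => j hj jmin.
have jM : (j <= M)%N by apply: jmin.
case: j hj jmin jM => [|j] hj jmin jM; first by rewrite ltnNge h0 in hj.
have hj' : (2 ^ (m0 + j) * supn k <= P)%N.
  by rewrite leqNgt; apply/negP => /jmin; rewrite ltnn.
have sj0 : 0 < sigma ^+ j.+1 by rewrite exprn_gt0 // sigma_gt0.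
have sj1 : sigma ^+ j.+1 <= 1 by rewrite exprn_ile1 ?sigma_le1 // ltW // sigma_gt0.
have /andP[p1 p2] := pos _ sj0 sj1.
have := mode_floor_gap (ltW sj0) (gap_power jM hj).
move=> /(phi_le_om n p1 p2) h.
rewrite -[leLHS]addr0; apply: lerD => //; rewrite -[leLHS]add0r; apply: lerD => //.
rewrite (bigD1 (Ordinal jM)) //= hj' mulr1 -[leLHS]addr0; apply: lerD; last first.
  by apply: sumr_ge0 => i _; rewrite !mulr_ge0 ?exprn_ge0.
apply: le_trans (_ : phi theta (1 - `|q k|) n <= _).
  by rewrite -[leRHS]mul1r; apply: ler_wpM2r; rewrite ?phi_ge0 ?q2_le1.
apply: le_trans h _; apply: ler_wpM2r => //.
rewrite invfM powRM ?invr_ge0 ?(ltW mode_floor_gt0) ?(ltW sj0) // -exprVn.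
have si0 : 0 <= sigma^-1 by rewrite invr_ge0 ltW // sigma_gt0.
by rewrite -(powR_mulrn j.+1 si0) -(powR_mulrn j.+1 (powR_ge0 sigma^-1 theta)) powRAC.
Qed.

(** The low modes at level [j] are a fraction [vol * 2 ^ - (d * j)] of all, at a price growing like
    [st ^+ j], so [sigma_theta], that is [theta * min(alpha, 2) < d] for the profile, makes the sum
    geometric. The condition on [M] puts the unresolved modes below [om]. *)
Lemma mode_decay n Nh : (n <= Nh)%N -> (2 ^+ d)^-1 ^+ M <= phi theta 1 Nh ->
  \sum_k q k ^+ 2 * phi theta (1 - `|q k|) n <=
  #|{: torus}|%:R * (vol * mode_decay_const * phi theta 1 n).
Proof.
move=> nN hM; set om := phi theta 1 n; set G := #|{: torus}|%:R.
have om0 : 0 <= om := phi_ge0 1 n; have ct0 : 0 <= ct := powR_ge0 _ _.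
have st0 : 0 <= st := powR_ge0 _ _; have d2 : 0 < 2 ^+ d :> R by rewrite exprn_gt0.
have G0 : 0 <= G := ler0n _ _.
apply: le_trans (ler_sum _ (fun k _ => mode_pointwise k n)) _.
rewrite big_split big_split /= -/om -mulr_sumr exchange_big /=.
have S1 : ct * om * \sum_k q k ^+ 2 <= G * (vol * (A0 * ct) * om).
  apply: le_trans (ler_wpM2l (mulr_ge0 ct0 om0) mean_q2) _.
  by rewrite le_eqVlt -/G; apply/orP; left; apply/eqP; ring.
have cnt j : (j <= M)%N -> \sum_(k : torus) (((2 ^ (m0 + j) * supn k <= 2 ^ (J - 2))%N)%:R : R) <=
    G * (vol * (2 ^+ d)^-1 ^+ j).
  move=> jM; apply: le_trans (card_low_modes jM).
  rewrite -sumr_const [leRHS]big_mkcond /=.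
  by apply: ler_sum => k _; rewrite inE; case: ifP.
have S3 : \sum_(k : torus) (((2 ^ (m0 + M) * supn k <= 2 ^ (J - 2))%N)%:R : R) <= G * (vol * 1 * om).
  apply: le_trans (cnt _ (leqnn M)) _; apply: ler_wpM2l => //; rewrite mulr1.
  apply: ler_wpM2l; first exact: ltW.
  by apply: le_trans hM _; apply: phi_anti.
set s := st / 2 ^+ d.
have s0 : 0 <= s by rewrite divr_ge0 // ltW.
have s1 : s < 1 by rewrite ltr_pdivrMr // mul1r.
have S2 : \sum_(j < M) \sum_(k : torus) (ct * st ^+ j.+1 * om) * ((2 ^ (m0 + j) * supn k <= 2 ^ (J - 2))%N)%:R
    <= G * (vol * (ct * st / (1 - s)) * om).
  apply: le_trans (_ : \sum_(j < M) G * vol * om * ct * st * s ^+ j <= _).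
    apply: ler_sum => j _; rewrite -mulr_sumr.
    apply: le_trans (ler_wpM2l _ (cnt j (ltnW (ltn_ord j)))) _.
      by rewrite !mulr_ge0 ?exprn_ge0.
    rewrite le_eqVlt /s exprMn exprS; apply/orP; left; apply/eqP; ring.
  rewrite -mulr_sumr.
  have -> : G * (vol * (ct * st / (1 - s)) * om) = G * vol * om * ct * st * (1 - s)^-1 by ring.
  apply: ler_wpM2l; first by rewrite !mulr_ge0 // ltW.
  exact: sum_geometric_le.
apply: le_trans (lerD (lerD S1 S2) S3) _.
rewrite /mode_decay_const -/s le_eqVlt; apply/orP; left; apply/eqP; ring.
Qed.

End ModeDecay.

(** * Moments on the torus at a fixed time *)

Section Displacement.
Variables (theta : R) (Nh : nat).
Hypothesis theta_gt2 : 2 < theta.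
Hypothesis sigma_theta : sigma^-1 `^ theta < 2 ^+ d.
Hypothesis horizon : (2 ^+ d)^-1 ^+ M <= phi theta 1 Nh.
Hypothesis spread : vol * mode_decay_const theta * small_const theta gap_ratio <= 1.
Local Notation c := (saw_count D).
Local Notation Chat n := (\sum_x c n x).

Lemma mode_decay_const_ge : A0 <= mode_decay_const theta.
Proof.
have ct1 : 1 <= mode_floor^-1 `^ theta.
  rewrite -(powRr0 mode_floor^-1); apply: ler_powR; last by apply: ltW; apply: lt_trans theta_gt2.
  by rewrite invf_ge1 ?mode_floor_gt0 // ge_min lexx.
have ct0 := le_trans ler01 ct1.
rewrite /mode_decay_const -addrA -[leLHS]addr0; apply: lerD.
  by rewrite ler_peMr // ltW.
rewrite addr_ge0 // mulr_ge0 // ?mulr_ge0 ?powR_ge0 //.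
by rewrite invr_ge0 subr_ge0 ler_pdivrMr ?exprn_gt0 // mul1r ltW.
Qed.

(** The bootstrap is run with [beta = vol * mode_decay_const]; the range of the kernel enters
    [spread] through [vol] only. *)
Lemma torus_modes n : (n <= Nh)%N ->
  [/\ 0 < Chat n,
    forall k, \sum_x w k x * c n x <= 2 * gap_const theta * n%:R * (1 - q k) * Chat n &
    forall k, `|fourier (tcos R k) (c n)| <=
      4 * mode_const theta * phi theta (1 - `|q k|) n * Chat n].
Proof.
move=> nN.
have B0 : 0 <= mode_decay_const theta := le_trans (ltW A0_gt0) mode_decay_const_ge.
have I0 : (0 < #|{: torus}|)%N by apply/card_gt0P; exists 0.
have sup y : D y <= vol * mode_decay_const theta.
  apply: le_trans (tk_sup DP y) _; rewrite mulrC.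
  by apply: ler_wpM2l; [exact: ltW|exact: mode_decay_const_ge].
have beta0 : 0 <= vol * mode_decay_const theta by rewrite mulr_ge0 // ltW.
exact: (saw_mode_bounds theta_gt2 gap_ratio_ge1 D_ge0 (tk_sym DP) (tk_0 DP) (tk_sum DP)
  (@torus_character R d T) I0 (@torus_ortho R d T) q_gap_ratio beta0 sup
  (fun m mN => mode_decay theta_gt2 sigma_theta mN horizon) spread nN).

Qed.

Definition axis_mode i j : torus := basis T i (2 ^ (J - j)).

Lemma angle_pow z j : (j <= J)%N -> angle R T (z * 2 ^ (J - j)) = 2 * pi * z%:R / 2 ^+ j.
Proof.
move=> jJ; rewrite /angle natrM.
have -> : N%:R = 2 ^+ j * (2 ^ (J - j))%:R :> R.
  by rewrite TJ -{1}(subnKC jJ) expnD natrM natrX.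
have p1 : (2 ^ (J - j))%:R != 0 :> R by rewrite pnatr_eq0 -lt0n expn_gt0.
by field; rewrite p1 expf_neq0.
Qed.

Lemma tcos_axis i j x : (j <= J)%N ->
  tcos R (axis_mode i j) x = cos (2 * pi * (cabs (x 0 i))%:R / 2 ^+ j).
Proof. by move=> jJ; rewrite tcos_sym tcos_basis cos_cabs angle_pow. Qed.

Definition gap_up : R := A0 * 6 ^+ d * (32 * 4 * 4 ^+ l0 + 2 / (1 - tau)).

Lemma gap_up_ge0 : 0 <= gap_up.
Proof.
rewrite /gap_up !mulr_ge0 ?exprn_ge0 ?(ltW A0_gt0) // addr_ge0 ?mulr_ge0 ?exprn_ge0 //.
by rewrite invr_ge0 subr_ge0 ltW.
Qed.

(** The 32 bounds [2 * pi ^+ 2], and the next 4 comes from the outer radius [2 ^ (m.+1 + l0)]. *)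
Lemma axis_gap_shell i j m x : (j <= J)%N -> (supn x <= 2 ^ (m.+1 + l0))%N ->
  w (axis_mode i j) x <= Num.min 2 (32 * 4 * 4 ^+ l0 * 4 ^+ m * 4^-1 ^+ j).
Proof.
move=> jJ xm; rewrite tcos_axis // le_min one_sub_cos_le2 /=.
apply: le_trans (one_sub_cos_sqr _) _; set z := cabs _.
have zm : (z <= 2 ^ (m.+1 + l0))%N.
  exact: leq_trans (leq_bigmax i) xm.
have -> : (2 * pi * z%:R / 2 ^+ j) ^+ 2 / 2 = 2 * pi ^+ 2 * (z%:R ^+ 2 * 4^-1 ^+ j) :> R.
  have -> : 4^-1 ^+ j = ((2 ^+ j) ^+ 2)^-1 :> R.
    by rewrite exprVn -exprM mulnC exprM; congr (_ ^+ j)^-1; rewrite expr2; ring.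
  by field; rewrite expf_neq0.
have p4 : pi <= 4 :> R by have := @pihalf_lt2 R; lra.
have p2 : pi ^+ 2 <= 16 :> R.
  rewrite (_ : 16 = 4 ^+ 2); last by rewrite expr2; ring.
  by apply: lerXn2r; rewrite ?nnegrE ?pi_ge0.
have -> : 32 * 4 * 4 ^+ l0 * 4 ^+ m * 4^-1 ^+ j =
    2 * 16 * ((4 * 4 ^+ m * 4 ^+ l0) * 4^-1 ^+ j) :> R by ring.
apply: ler_pM; rewrite ?mulr_ge0 ?exprn_ge0 ?pi_ge0 //.
  by apply: ler_wpM2l.
apply: ler_wpM2r; first by rewrite exprn_ge0.
rewrite -exprS -exprD (_ : 4 = 2 ^+ 2 :> R); last by rewrite expr2; ring.
rewrite -exprM mulnC exprM -(natrX _ 2).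
by apply: lerXn2r; rewrite ?nnegrE ?ler_nat.
Qed.

Lemma gap_upper i j : (j <= J)%N ->
  1 - q (axis_mode i j) <= gap_up * scale_gap tau j.
Proof.
move=> jJ; rewrite gapE; set k := axis_mode i j.
set mn := fun m => Num.min 2 (32 * 4 * 4 ^+ l0 * 4 ^+ m * 4^-1 ^+ j) : R.
have mn0 m : 0 <= mn m by rewrite le_min ler0n /= !mulr_ge0 ?exprn_ge0.
have r0 := ltW rho_gt0; have a0 := ltW A0_gt0; have v0 := ltW vol_gt0.
apply: le_trans (_ : \sum_(x : torus) \sum_(m < M + m1 + 4)
    (A0 * vol * rho ^+ m * mn m) * ((supn x <= 2 ^ (m.+1 + l0))%N)%:R <= _).
  apply: ler_sum => x _.
  have S0 : 0 <= \sum_(m < M + m1 + 4) (A0 * vol * rho ^+ m * mn m) *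
      ((supn x <= 2 ^ (m.+1 + l0))%N)%:R.
    by apply: sumr_ge0 => m _; rewrite !mulr_ge0 ?exprn_ge0.
  have [->|/(shell_exists (tk_sup DP) (tk_tail DP) (tk_range DP))[m [mM xm Dm]]] :=
    eqVneq (D x) 0; first by rewrite mulr0.
  rewrite (bigD1 (Ordinal mM)) //= xm mulr1 -[leLHS]addr0; apply: lerD.
    by rewrite mulrC; apply: ler_pM => //; exact: axis_gap_shell.
  by apply: sumr_ge0 => m' _; rewrite !mulr_ge0 ?exprn_ge0.
rewrite exchange_big /=.
apply: le_trans (_ : \sum_(m < M + m1 + 4) A0 * 6 ^+ d * (tau ^+ m * mn m) <= _).
  apply: ler_sum => m _; rewrite -mulr_sumr.
  apply: le_trans (ler_wpM2l _ (card_supn_shell m)) _; first by rewrite !mulr_ge0 ?exprn_ge0.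
  rewrite exprMn.
  have -> : A0 * vol * rho ^+ m * mn m * (6 ^+ d * (2 ^+ d) ^+ m * (2 ^ l0)%:R ^+ d) =
    (vol * (2 ^ l0)%:R ^+ d) * (A0 * 6 ^+ d * ((2 ^+ d) ^+ m * rho ^+ m * mn m)) by ring.
  by rewrite vol_E mul1r.
rewrite -mulr_sumr /gap_up -(mulrA (A0 * 6 ^+ d)); apply: ler_wpM2l.
  by rewrite mulr_ge0 ?exprn_ge0.
by apply: shell_sum_le => //; rewrite !mulr_ge0 ?exprn_ge0.
Qed.

(** The shift [2 ^ (m + m0)] of box [m] becomes [2 ^ (e + m0)] after [e - m] doublings. That is half
    a period of the mode, whence the offset [m0 + 1]. *)
Lemma gap_scale i e : (e <= M)%N ->
  gap_low * scale_gap tau e <= 1 - q (axis_mode i (e + m0 + 1)).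
Proof.
move=> eM; set k := axis_mode _ _.
have := @gap_lower k i e (fun m => 2 ^ (m + m0))%N eM (fun m _ => leqnn _).
apply: le_trans; apply: ler_wpM2l; first exact: ltW gap_low_gt0.
apply: ler_sum => -[m /= me] _; apply: ler_wpM2l; first by rewrite exprn_ge0 // ltW.
have := w_double k i (m + m0) (e - m).
have -> : (m + m0 + (e - m) = e + m0)%N by move: me; clear; lia.
have h1 : 1 <= w k (basis T i (2 ^ (e + m0))).
  apply: gap_half; rewrite /k /axis_mode mxE eqxx /cabs /=.
  have lt1 : (2 ^ (J - (e + m0 + 1)) < N)%N.
    by rewrite TJ ltn_exp2l //; move: eM MJ; clear; lia.
  rewrite modn_small // TJ.
  have jJ : (e + m0 + 1 <= J)%N by move: eM MJ; clear; lia.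
  have -> : minn (2 ^ (J - (e + m0 + 1))) (2 ^ J - 2 ^ (J - (e + m0 + 1))) = (2 ^ (J - (e + m0 + 1)))%N.
    apply/minn_idPl; rewrite leq_subRL ?leq_exp2l ?leq_subr //.
    rewrite addnn -mul2n -expnS leq_exp2l //; move: jJ; clear; lia.
  rewrite -expnD !leq_exp2l //; move: jJ; clear; lia.
move=> /(le_trans h1) h; rewrite exprVn -[leLHS]mulr1 mulrC ler_pdivrMr ?exprn_gt0 //.
by rewrite mulrC.
Qed.

(** A single term suffices: for [2 * z <= 2 ^ j <= 4 * z] the angle lies between [pi / 2] and [pi],
    so the cosine weight is at least 1, and [(2 ^ j) ^ r >= z ^ r]. *)
Lemma dyadic_moment (r : R) z : 0 < r -> (z <= 2 ^ (J - 1))%N ->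
  z%:R `^ r <= \sum_(j < J.+1) (2 `^ r) ^+ j * (1 - cos (2 * pi * z%:R / 2 ^+ j)).
Proof.
move=> r0 zJ.
have J2 : (2 <= J)%N by move: MJ; clear; lia.
have B0 : 0 <= 2 `^ r :> R := powR_ge0 _ _.
have t0 j : 0 <= (2 `^ r) ^+ j * (1 - cos (2 * pi * z%:R / 2 ^+ j)).
  by rewrite mulr_ge0 ?exprn_ge0 ?one_sub_cos_ge0.
have [->|z0] := posnP z; first by rewrite powR0 ?gt_eqF //; apply: sumr_ge0.
have [j [j1 jJ jl ju]] : exists j, [/\ (1 <= j)%N, (j <= J)%N, (2 ^ j <= 4 * z)%N & (2 * z <= 2 ^ j)%N].
  have /andP[t1 t2] := trunc_log_bounds (isT : (1 < 2)%N) z0.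
  have e4 : (2 ^ (trunc_log 2 z + 2) = 4 * 2 ^ trunc_log 2 z)%N by rewrite expnD mulnC.
  rewrite expnS in t2; have [h|h] := leqP (trunc_log 2 z + 2) J.
    exists (trunc_log 2 z + 2)%N; rewrite e4 leq_pmul2l //; split => //; first by rewrite addn2.
    by move: t2; move: (2 ^ _)%N => u; clear; lia.
  exists J; split => //; first exact: ltnW.
    apply: leq_trans (_ : 2 ^ (trunc_log 2 z + 2) <= _)%N; first by rewrite leq_exp2l // ltnW.
    by rewrite e4 leq_pmul2l.
  by rewrite -{1}(subnKC (ltnW J2)) expnD leq_pmul2l.
have p0 := pi_gt0 R; have d0 : 0 < 2 ^+ j :> R by rewrite exprn_gt0.
have jl' : 2 ^+ j <= 4 * z%:R :> R by rewrite -natrX -natrM ler_nat.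
have ju' : 2 * z%:R <= 2 ^+ j :> R by rewrite -natrX -natrM ler_nat.
rewrite (bigD1 (Ordinal (jJ : (j < J.+1)%N))) //= -[leLHS]addr0; apply: lerD; last exact: sumr_ge0.
rewrite -[leLHS]mulr1; apply: ler_pM; rewrite ?powR_ge0 //.
  rewrite -(powR_mulrn j B0) -powRrM mulrC powRrM powR_mulrn //.
  apply: ge0_ler_powR; rewrite ?nnegrE ?exprn_ge0 //; first exact: ltW.
  by apply: le_trans ju'; rewrite ler_peMl // ler1n.
rewrite lerBrDl -lerBrDr subrr; apply: cos_le0; apply/andP; split.
  rewrite ler_pdivlMr //; apply: le_trans (_ : pi / 2 * (4 * z%:R) <= _).
    by apply: ler_wpM2l => //; rewrite divr_ge0 // ltW.
  by rewrite le_eqVlt; apply/orP; left; apply/eqP; field.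
rewrite ler_pdivrMr //; apply: le_trans (ler_wpM2l (ltW p0) ju').
by rewrite le_eqVlt; apply/orP; left; apply/eqP; ring.
Qed.

Lemma moment_up n i (r : R) e Q : (n <= Nh)%N -> 0 < r -> 2 `^ r * sigma < 1 ->
  n%:R * scale_gap tau e <= Q ->
  \sum_(x : torus) (cabs (x 0 i))%:R `^ r * c n x <=
  moment_const (2 `^ r) sigma (2 * gap_const theta * gap_up) Q * (2 `^ r) ^+ e * Chat n.
Proof.
move=> nN r0 rs nQ; have [C0 gap _] := torus_modes nN.
have c0 x : 0 <= c n x by apply: wsum_ge0.
apply: le_trans (_ : \sum_(j < J.+1) (2 `^ r) ^+ j *
   (\sum_x w (axis_mode i j) x * c n x) <= _).
  under [leRHS]eq_bigr do rewrite mulr_sumr.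
  rewrite exchange_big; apply: ler_sum => x _ /=.
  apply: le_trans (ler_wpM2r (c0 x) (dyadic_moment r0 (cabs_le _))) _.
  rewrite mulr_suml; apply: ler_sum => -[j jJ] _ /=.
  by rewrite tcos_axis // mulrA.
have gc0 : 0 <= gap_const theta by rewrite mulr_ge0 // powR_ge0.
have K0 : 0 <= 2 * gap_const theta * gap_up by rewrite mulr_ge0 ?gap_up_ge0 // mulr_ge0.
have B1 : 1 < 2 `^ r.
  have := @gt0_ltr_powR R r r0 1 2; rewrite powR1; apply; rewrite ?nnegrE ?ler0n //.
  by rewrite ltr1n.
apply: le_trans (ler_wpM2r (ltW C0) (moment_sum J.+1 tau_gt0 B1 rs K0 (ler0n R n) nQ)).
rewrite mulr_suml; apply: ler_sum => -[j jJ] _ /=.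
rewrite -[leRHS]mulrA; apply: ler_wpM2l; first by rewrite exprn_ge0 ?powR_ge0.
rewrite minr_pMl ?(ltW C0) // le_min; apply/andP; split.
  rewrite mulr_sumr; apply: ler_sum => x _; apply: ler_wpM2r => //.
  by rewrite tcos_axis // one_sub_cos_le2.
apply: le_trans (gap _) _; apply: ler_wpM2r; first exact: ltW.
have -> : 2 * gap_const theta * gap_up * (n%:R * scale_gap tau j) =
   2 * gap_const theta * n%:R * (gap_up * scale_gap tau j) by ring.
by apply: ler_wpM2l; [rewrite mulr_ge0 // mulr_ge0|exact: gap_upper].
Qed.

(** The smallness hypothesis makes the transform at this mode at most half of the mass, so the
    weight [1 - cos] collects at least the other half. It is then bounded by an [r]-th power, with
    [2 * pi <= 8]. *)
Lemma moment_low n i (r : R) e : (n <= Nh)%N -> 0 < r -> r <= 2 -> (e <= M)%N ->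
  4 * mode_const theta * phi theta (mode_floor * scale_gap tau e) n <= 2^-1 ->
  Chat n <= 4 * (8 / 2 ^+ (e + m0 + 1)) `^ r * \sum_(x : torus) (cabs (x 0 i))%:R `^ r * c n x.
Proof.
move=> nN r0 r2 eM small; have [C0 _ mode] := torus_modes nN.
have c0 x : 0 <= c n x by apply: wsum_ge0.
have jJ : (e + m0 + 1 <= J)%N by move: eM MJ; clear; lia.
set j := (e + m0 + 1)%N in jJ *; set k := axis_mode i j.
have W0 := ltW (scale_gap_gt0 e tau_gt0).
have g : mode_floor * scale_gap tau e <= 1 - `|q k|.
  exact: mode_floor_gap W0 (gap_scale i eM).
have mf : 0 <= mode_floor * scale_gap tau e by rewrite mulr_ge0 // ltW // mode_floor_gt0.
have fk : `|fourier (tcos R k) (c n)| <= 2^-1 * Chat n.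
  apply: le_trans (mode k) _; apply: ler_wpM2r; first exact: ltW.
  apply: le_trans small; apply: ler_wpM2l; first by rewrite mulr_ge0 ?powR_ge0.
  exact: phi_mono_t.
have half : Chat n <= 2 * \sum_x w k x * c n x.
  rewrite fourier_gap; move: fk; rewrite ler_norml => /andP[_].
  by move: (Chat n) (fourier _ _) => a b; lra.
apply: le_trans half _; set X := _ `^ r; set S := \sum_(x : torus) _ * _.
have -> : 4 * X * S = 2 * (2 * X * S) by ring.
apply: ler_wpM2l => //; rewrite /S mulr_sumr; apply: ler_sum => x _.
rewrite !mulrA; apply: ler_wpM2r => //; rewrite tcos_axis //.
apply: le_trans (one_sub_cos_powR _ r0 r2) _; rewrite /X -[leRHS]mulrA; apply: ler_wpM2l => //.
rewrite -powRM ?divr_ge0 ?exprn_ge0 //.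
have p0 := pi_ge0 R; have d0 : 0 < 2 ^+ j :> R by rewrite exprn_gt0.
apply: ge0_ler_powR; rewrite ?nnegrE ?(ltW r0) //.
rewrite ger0_norm ?mulr_ge0 ?invr_ge0 ?(ltW d0) //.
rewrite [leRHS]mulrAC; apply: ler_wpM2r; first by rewrite invr_ge0 ltW.
by apply: ler_wpM2r => //; have := @pihalf_lt2 R; lra.
Qed.

End Displacement.

End TorusKernel.

(** * Normalizing a truncated kernel *)

Section KernelNormalization.
Variables (R : realType) (d T J : nat).
Hypothesis TJ : T.+1 = (2 ^ J)%N.
Hypothesis d_gt0 : (0 < d)%N.
Local Notation N := T.+1.
Local Notation torus := 'rV['I_N]_d.
Variables (rho b0 b1 : R) (l0 m1 M : nat).
Local Notation m0 := (m1 + l0)%N.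
Local Notation tau := (2 ^+ d * rho).
Local Notation vol := ((2 ^ l0)%:R ^- d).
Implicit Types (x y : torus) (m n : nat).

Record raw_kernel (F : torus -> R) : Prop := RawKernel {
  rk_ge0 : forall x, 0 <= F x;
  rk_sym : forall x, F (- x) = F x;
  rk_sup : forall x, F x <= b0;
  rk_tail : forall m x, (2 ^ (m + l0) <= supn x)%N -> F x <= b0 * rho ^+ m;
  rk_range : forall x, (2 ^ (M + m0 + 3) < supn x)%N -> F x = 0;
  rk_low : forall m x, (m <= M)%N -> x \in dyadic_box d T l0 m1 m ->
    b1 * rho ^+ m <= F x }.

Hypothesis rho_gt0 : 0 < rho.
Hypothesis tau_lt1 : tau < 1.
Hypothesis b0_gt0 : 0 < b0.
Hypothesis b1_gt0 : 0 < b1.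
Hypothesis MJ : (M + m0 + 5 <= J)%N.
Variable F : torus -> R.
Hypothesis FP : raw_kernel F.

Definition mass_low : R := b1 * 2 ^+ (d * (m1 + 1)).
Definition mass_up : R := b0 * 6 ^+ d / (1 - tau).

Let vol_gt0 : 0 < (2 ^ l0)%:R ^+ d :> R.
Proof. by rewrite exprn_gt0 // ltr0n expn_gt0. Qed.
Let tau_gt0 : 0 < tau. Proof. by rewrite mulr_gt0 // exprn_gt0. Qed.

Lemma mass_low_gt0 : 0 < mass_low.
Proof. by rewrite mulr_gt0 ?exprn_gt0. Qed.

Lemma mass_up_gt0 : 0 < mass_up.
Proof. by rewrite divr_gt0 ?mulr_gt0 ?exprn_gt0 ?subr_gt0. Qed.

Lemma raw_mass_low : mass_low * (2 ^ l0)%:R ^+ d <= \sum_x F x.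
Proof.
apply: le_trans (_ : \sum_(x in small_box d T l0 m1 0) b1 <= _); last first.
  rewrite big_mkcond; apply: ler_sum => x _; case: ifP => [xs|_]; last exact: rk_ge0 FP x.
  by have := rk_low FP (leq0n M) (small_boxP xs); rewrite mulr1.
rewrite sumr_const (card_small_box _ TJ MJ) // add0n -[leRHS]mulr_natl (natrX _ (2 ^ (m0 + 1))).
have -> : (2 ^ (m0 + 1))%:R = 2 ^+ (m1 + 1) * (2 ^ l0)%:R :> R.
  by rewrite !natrX -!exprD; congr (_ ^+ _); nlia.
rewrite exprMn /mass_low mulnC exprM le_eqVlt; apply/orP; left; apply/eqP; ring.
Qed.

Lemma raw_mass_up : \sum_x F x <= mass_up * (2 ^ l0)%:R ^+ d.
Proof.
have r0 := ltW rho_gt0; have a0 := ltW b0_gt0.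
apply: le_trans (_ : \sum_(x : torus) \sum_(m < M + m1 + 4)
    (b0 * rho ^+ m) * ((supn x <= 2 ^ (m.+1 + l0))%N)%:R <= _).
  apply: ler_sum => x _.
  have [->|/(shell_exists (rk_sup FP) (rk_tail FP) (rk_range FP))[m [mM xm Dm]]] :=
    eqVneq (F x) 0.
    by apply: sumr_ge0 => m _; rewrite !mulr_ge0 ?exprn_ge0.
  rewrite (bigD1 (Ordinal mM)) //= xm mulr1 -[leLHS]addr0; apply: lerD => //.
  by apply: sumr_ge0 => m' _; rewrite !mulr_ge0 ?exprn_ge0.
rewrite exchange_big /=.
apply: le_trans (_ : \sum_(m < M + m1 + 4) b0 * 6 ^+ d * (2 ^ l0)%:R ^+ d * tau ^+ m <= _).
  apply: ler_sum => m _; rewrite -mulr_sumr.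
  apply: le_trans (ler_wpM2l _ (card_supn_shell R T d_gt0 l0 m)) _; first by rewrite mulr_ge0 ?exprn_ge0.
  by rewrite exprMn le_eqVlt; apply/orP; left; apply/eqP; ring.
rewrite -mulr_sumr /mass_up.
have -> : b0 * 6 ^+ d / (1 - tau) * (2 ^ l0)%:R ^+ d =
  b0 * 6 ^+ d * (2 ^ l0)%:R ^+ d * (1 - tau)^-1 by ring.
apply: ler_wpM2l; first by rewrite !mulr_ge0 ?exprn_ge0.
by apply: sum_geometric_le => //; exact: ltW.
Qed.

(** The total mass is of order [2 ^ (l0 * d)] from both sides, which turns bounds of order one into
    bounds of order [vol]. *)
Lemma raw_normalize : F 0 = 0 -> torus_kernel rho (b0 / mass_low) (b1 / mass_up) vol l0 m1 M
  (fun x => F x / \sum_y F y).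
Proof.
move=> F0; have lo := raw_mass_low; have up := raw_mass_up.
have ml := mass_low_gt0; have mu := mass_up_gt0.
set S := \sum_y F y in lo up *.
have S0 : 0 < S by apply: lt_le_trans lo; rewrite mulr_gt0.
have ub x (z : R) : 0 <= z -> F x <= b0 * z -> F x / S <= b0 / mass_low * vol * z.
  move=> z0 h; rewrite ler_pdivrMr //; apply: le_trans h _.
  have -> : b0 / mass_low * vol * z * S = b0 * z * (S / (mass_low * (2 ^ l0)%:R ^+ d)).
    by rewrite (invfM mass_low); move: (_ ^- d) => X; ring.
  by rewrite ler_peMr ?mulr_ge0 ?(ltW b0_gt0) // ler_pdivlMr ?mul1r // mulr_gt0.
split.
- by move=> x; rewrite divr_ge0 ?(ltW S0) //; exact: (rk_ge0 FP).
- by rewrite -mulr_suml divff // gt_eqF.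
- by move=> x; rewrite (rk_sym FP).
- by rewrite F0 mul0r.
- by move=> x; have := ub x 1 ler01; rewrite !mulr1; apply; exact: (rk_sup FP).
- by move=> m x h; apply: ub; [rewrite exprn_ge0 // ltW|exact: (rk_tail FP)].
- by move=> x h; rewrite (rk_range FP) ?mul0r.
move=> m x mM xb; rewrite ler_pdivlMr //; apply: le_trans (rk_low FP mM xb).
have -> : b1 / mass_up * vol * rho ^+ m * S = b1 * rho ^+ m * (S / (mass_up * (2 ^ l0)%:R ^+ d)).
  by rewrite (invfM mass_up); move: (_ ^- d) => X; ring.
rewrite ler_piMr ?mulr_ge0 ?exprn_ge0 ?(ltW b1_gt0) ?(ltW rho_gt0) //.
by rewrite ler_pdivrMr ?mul1r // mulr_gt0.
Qed.

End KernelNormalization.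

(** * From the torus to the lattice *)

Section FiniteExhaustion.
Variables (R : realType) (S : choiceType) (a : S -> R).
Hypothesis a_ge0 : forall s, 0 <= a s.

Lemma esum_subset (A B : set S) : A `<=` B ->
  (\esum_(s in A) (a s)%:E <= \esum_(s in B) (a s)%:E)%E.
Proof.
move=> AB; rewrite [leRHS](esumID A B); last by move=> s _; rewrite lee_fin.
rewrite (setIidr AB) leeDl //; apply: esum_ge0 => s _; by rewrite lee_fin.
Qed.

Lemma esum_finType (K : finType) (P : pred K) (e : K -> S) :
  {in P &, injective e} ->
  \esum_(s in e @` [set k | P k]) (a s)%:E = (\sum_(k | P k) a (e k))%:E.
Proof.
move=> inj; rewrite esum_image; last by move=> x y /set_mem xP /set_mem yP; apply: inj.
have -> : [set k | P k] = [set` enum P].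
  by apply/seteqP; split=> k /=; rewrite mem_enum.
rewrite esum_fset ?finite_finset //; last by move=> k _; rewrite lee_fin.
by rewrite -fsbig_seq ?enum_uniq // -sumEFin big_enum.
Qed.

Lemma esum_ge_finType (I : set S) (K : finType) (P : pred K) (e : K -> S) :
  {in P &, injective e} -> (forall k, P k -> I (e k)) ->
  ((\sum_(k | P k) a (e k))%:E <= \esum_(s in I) (a s)%:E)%E.
Proof.
move=> inj PI; rewrite -esum_finType //; apply: esum_subset.
by move=> s [k /PI Ik <-].
Qed.

(** An unrestricted sum is a supremum over finite sets. Each of these may be covered by a different
    finite type, later a torus chosen large enough for it. *)
Lemma esum_le_finType (I : set S) (B : \bar R) :
  (forall X : seq S, {in X, forall s, I s} ->
    exists (K : finType) (P : pred K) (e : K -> S),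
    [/\ {in P &, injective e}, {in X, forall s, exists2 k, P k & e k = s} &
      ((\sum_(k | P k) a (e k))%:E <= B)%E]) ->
  (\esum_(s in I) (a s)%:E <= B)%E.
Proof.
move=> H; apply: ge_ereal_sup => _ [X [finX XI]] <-.
have [X' XX'] := (finite_seqP X).1 finX; rewrite XX' in finX XI *.
have [K [P [e [inj XP le]]]] := H X' XI.
apply: le_trans le; rewrite -esum_finType // -esum_fset //; last first.
  by move=> s _; rewrite lee_fin.
by apply: esum_subset => s /XP [k Pk <-]; exists k.
Qed.

End FiniteExhaustion.

Section TupleSum.
Variables (R : realType) (G : finZmodType) (D : G -> R).

Lemma wsum_tuple n (Phi : seq G -> R) :
  wsum D n Phi = \sum_(t : n.-tuple G) (\prod_(y <- t) D y) * Phi t.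
Proof.
elim: n Phi => [|n IH] Phi /=.
  rewrite (big_pred1 [tuple]) ?big_nil ?mul1r // => t.
  by rewrite [t]tuple0; apply/esym/eqP.
under eq_bigr do rewrite IH mulr_sumr.
rewrite pair_big /=.
rewrite (reindex (fun p : G * n.-tuple G => [tuple of p.1 :: p.2])) /=.
  by apply: eq_bigr => -[y t] _ /=; rewrite big_cons mulrA.
exists (fun t : n.+1.-tuple G => (thead t, [tuple of behead t])) => [[y t] _|t _] /=.
  by congr pair; apply/val_inj.
by rewrite -tuple_eta.
Qed.

End TupleSum.

(** * Lattice representatives of torus points *)

Section Lift.
Variables (d T : nat).
Local Notation N := T.+1.
Local Notation torus := 'rV['I_N]_d.
Implicit Types (x y : torus) (z : int) (u : 'rV[int]_d).

(* The representative of least absolute value. *)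
Definition lift1 (v : 'I_N) : int := if (v.*2 <= T)%N then v%:Z else v%:Z - N%:Z.
Definition red1 z : 'I_N := inZp 1 *~ z.
Definition vlift x : 'rV[int]_d := \row_i lift1 (x 0 i).
Definition vred u : torus := \row_i red1 (u 0 i).

Lemma red1D z z' : red1 (z + z') = red1 z + red1 z'.
Proof. exact: mulrzDr. Qed.

Lemma red1_nat (n : nat) : red1 n = inZp n.
Proof.
elim: n => [|n IH]; first by apply/val_inj; rewrite /= mod0n.
have -> : Posz n.+1 = n%:Z + 1%:Z by rewrite -PoszD addn1.
by rewrite red1D IH; apply/val_inj; rewrite /= modnDm addn1.
Qed.

Lemma red1N z : red1 (- z) = - red1 z.
Proof. exact: mulrNz. Qed.

Lemma vredD u u' : vred (u + u') = vred u + vred u'.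
Proof. by apply/rowP => i; rewrite !mxE red1D. Qed.

Lemma vredB u u' : vred (u - u') = vred u - vred u'.
Proof. by apply/rowP => i; rewrite !mxE red1D red1N. Qed.

Lemma vred0 : vred 0 = 0.
Proof. by apply/rowP => i; rewrite !mxE. Qed.

Lemma inZp_ord (v : 'I_N) : inZp v = v.
Proof. by apply/val_inj; rewrite /= modn_small. Qed.

Lemma lift1K v : red1 (lift1 v) = v.
Proof.
rewrite /lift1; case: ifP => _; first by rewrite red1_nat inZp_ord.
rewrite red1D red1N !red1_nat inZp_ord.
have -> : inZp N = 0 :> 'I_N by apply/val_inj; rewrite /= modnn.
by rewrite subr0.
Qed.

Lemma vliftK x : vred (vlift x) = x.
Proof. by apply/rowP => i; rewrite !mxE lift1K. Qed.

Lemma absz_lift1 v : `|lift1 v|%N = cabs v.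
Proof.
rewrite /lift1 /cabs; have := ltn_ord v; move: (nat_of_ord v) => a.
by case: ifP => h1 h2; lia.
Qed.

Lemma cabs_red1 z : (2 * `|z| < N)%N -> cabs (red1 z) = `|z|%N.
Proof.
wlog z0 : z / 0 <= z => [hw|].
  have [/hw//|/ltW z0 h] := leP 0 z.
  by rewrite -[red1 z]opprK -red1N cabsN hw ?abszN // oppr_ge0.
case: z z0 => // n _ /= h.
rewrite red1_nat /cabs /= modn_small; lia.
Qed.

Lemma red1_eq0 z : (`|z| < N)%N -> red1 z = 0 -> z = 0.
Proof.
wlog z0 : z / 0 <= z => [hw|].
  have [/hw//|/ltW z0 h] := leP 0 z.
  move/eqP; rewrite -oppr_eq0 -red1N => /eqP /hw e.
  by apply/eqP; rewrite -oppr_eq0 e ?abszN // oppr_ge0.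
case: z z0 => // n _ /= h; rewrite red1_nat => /(congr1 (@nat_of_ord _)) /=.
by rewrite modn_small // => ->.
Qed.

Lemma red1K z : (2 * `|z| < N)%N -> lift1 (red1 z) = z.
Proof.
move=> h; apply/eqP; rewrite -subr_eq0; apply/eqP; apply: red1_eq0.
  have := absz_lift1 (red1 z); rewrite cabs_red1 // => e.
  move: h e; move: (lift1 _) => w; lia.
by rewrite red1D red1N lift1K subrr.
Qed.

End Lift.

(** * Lattice moments as sums over walks *)

Section WalkSums.
Variables (R : realType) (d : nat).
Implicit Types (D H : 'rV[int]_d -> R) (Phi : 'rV[int]_d -> R).

Lemma esumZl (S : choiceType) (I : set S) (a : S -> R) (c : R) :
  (forall s, 0 <= a s) -> 0 <= c ->
  (c%:E * \esum_(s in I) (a s)%:E)%E = \esum_(s in I) (c * a s)%:E.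
Proof.
have ub (b : S -> R) (k : R) : (forall s, 0 <= b s) -> 0 <= k ->
    (\esum_(s in I) (k * b s)%:E <= k%:E * \esum_(s in I) (b s)%:E)%E.
  move=> b0 k0; apply: ge_ereal_sup => _ [X [finX XI] <-].
  under eq_fsbigr do rewrite EFinM.
  rewrite -ge0_mule_fsumr; last by move=> s; rewrite lee_fin.
  by apply: lee_wpmul2l; rewrite ?lee_fin //; apply: esum_ge; exists X.
move=> a0 c0; apply/eqP; rewrite eq_le ub // andbT.
have [->|cn0] := eqVneq c 0.
  by rewrite mul0e; apply: esum_ge0 => s _; rewrite mul0r.
have cp : 0 < c by rewrite lt_neqAle eq_sym cn0.
have ca0 s : 0 <= c * a s by rewrite mulr_ge0.
have := ub (fun s => c * a s) c^-1 ca0; rewrite invr_ge0 => /(_ c0).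
under eq_esum => s _ do rewrite mulKf //.
move=> h; apply: le_trans (lee_wpmul2l _ h) _; first by rewrite lee_fin.
by rewrite muleA -EFinM divff // mul1e.
Qed.

Definition weighted_walk D Phi n (w : {ffun 'I_n.+1 -> 'rV[int]_d}) : R :=
  Phi (w ord_max) * (walk_weight D w * (injectiveb w)%:R).

Lemma walk_weight_ge0 D n (w : {ffun 'I_n.+1 -> 'rV[int]_d}) :
  (forall z, 0 <= D z) -> 0 <= walk_weight D w.
Proof. by move=> D0; apply: prodr_ge0. Qed.

(** The endpoint is absorbed into the walk. Time 0 is excluded because [saw_two_point] is not a sum
    over walks there. *)
Lemma esum_two_point D Phi n : (0 < n)%N ->
  (forall z, 0 <= D z) -> (forall z, 0 <= Phi z) ->
  (\esum_(x in [set: 'rV[int]_d]) ((Phi x)%:E * saw_two_point D n x))%E =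
  \esum_(w in [set w : {ffun 'I_n.+1 -> 'rV[int]_d} | w ord0 = 0])
     (weighted_walk D Phi w)%:E.
Proof.
case: n => // n _ D0 P0.
have ww0 (w : {ffun 'I_n.+2 -> 'rV[int]_d}) : 0 <= walk_weight D w * (injectiveb w)%:R.
  by rewrite mulr_ge0 // walk_weight_ge0.
transitivity (\esum_(x in [set: 'rV[int]_d]) \esum_(w in walks n.+1 x)
    (weighted_walk D Phi w)%:E).
  apply: eq_esum => x _; rewrite /saw_two_point esumZl //.
  by apply: eq_esum => w [_ wx]; rewrite /weighted_walk wx.
rewrite esum_esum; last by move=> x w _ _; rewrite lee_fin mulr_ge0.
apply: (@reindex_esum _ _ _ [set w : {ffun 'I_n.+2 -> 'rV[int]_d} | w ord0 = 0] _
  (fun w => (w ord_max, w))).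
split => [w w0|w w' _ _ []//|[x w] [/= _ [w0 wx]]]; first by split.
by exists w => //=; rewrite wx.
Qed.

End WalkSums.

(** * Torus walks that do not wrap around *)

Section TorusWalks.
Variables (R : realType) (d T n ran : nat).
Hypothesis no_wrap : (2 * (n * ran) < T.+1)%N.
Hypothesis n_gt0 : (0 < n)%N.
Local Notation N := T.+1.
Local Notation torus := 'rV['I_N]_d.
Implicit Types (t : n.-tuple torus) (x y : torus) (u : 'rV[int]_d).

Definition zwalk t : {ffun 'I_n.+1 -> 'rV[int]_d} :=
  [ffun i => \sum_(y <- take (i : 'I_n.+1) t) vlift y].
Definition short t := all (fun y : torus => supn y <= ran)%N t.

Lemma vred_sum (s : seq torus) : vred T (\sum_(y <- s) vlift y) = ssum s.
Proof.
elim: s => [|y s IH]; first by rewrite /ssum !big_nil vred0.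
by rewrite /ssum !big_cons vredD vliftK IH.
Qed.

Lemma vred_zwalk t i : vred T (zwalk t i) = pos t i.
Proof. by rewrite ffunE vred_sum. Qed.

Lemma sum_vlift_le (s : seq torus) k : all (fun y : torus => supn y <= ran)%N s ->
  (`|(\sum_(y <- s) vlift y)%R 0%R k| <= size s * ran)%N.
Proof.
elim: s => [|y s IH] /=; first by rewrite big_nil mxE.
move=> /andP[ys /IH h]; rewrite big_cons !mxE mulSn.
have c := absz_lift1 (y 0 k).
have : (cabs (y 0%R k) <= ran)%N by apply: leq_trans ys; exact: (leq_bigmax k).
move: h c; set e := (\sum_(y0 <- s) vlift y0) 0 k; move: e (cabs _) (lift1 _) => e a b; lia.
Qed.

Lemma zwalk_le t i k : short t -> (`|zwalk t i 0%R k| <= n * ran)%N.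
Proof.
move=> st; rewrite ffunE; apply: leq_trans (sum_vlift_le k _) _.
  by apply/allP => y /mem_take; move: y; apply/allP.
by rewrite leq_mul2r size_take size_tuple; case: ifP => [/ltnW->|_]; rewrite ?leqnn orbT.
Qed.

(** Two positions that coincide on the torus have lifts whose coordinates differ by at most
    [2 * (n * ran) < N], so the lifts coincide too. *)
Lemma saw_zwalk t : short t -> saw t = injectiveb (zwalk t).
Proof.
move=> st; rewrite /saw size_tuple /injectiveb /dinjectiveb.
have -> : [seq pos t i | i <- iota 0 n.+1] = map (vred T) [seq zwalk t j | j <- enum 'I_n.+1].
  rewrite -val_enum_ord -!map_comp; apply: eq_map => i /=.
  by rewrite vred_zwalk.
apply: map_inj_in_uniq => _ _ /mapP[i _ ->] /mapP[j _ ->] e.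
apply/eqP; rewrite -subr_eq0; apply/eqP/rowP => k; rewrite [RHS]mxE.
apply: (@red1_eq0 T).
  rewrite mxE mxE; have := zwalk_le i k st; have := zwalk_le j k st.
  by move: (zwalk t i _ _) (zwalk t j _ _) no_wrap => a b; move: (n * ran)%N => c; lia.
have /rowP/(_ k) : vred T (zwalk t i - zwalk t j) = 0 by rewrite vredB e subrr.
by rewrite !mxE.
Qed.

Lemma zwalk_step t (i : 'I_n) :
  zwalk t (lift ord0 i) - zwalk t (widen_ord (leqnSn n) i) = vlift (tnth t i).
Proof.
rewrite !ffunE /= /bump /= add1n (take_nth 0) ?size_tuple //.
by rewrite -cats1 big_cat big_seq1 /= addrAC subrr add0r (tnth_nth 0).
Qed.

Lemma walk_weight_zwalk (H : 'rV[int]_d -> R) t :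
  walk_weight H (zwalk t) = \prod_(y <- t) H (vlift y).
Proof. by rewrite big_tuple; apply: eq_bigr => i _; rewrite zwalk_step. Qed.

Lemma zwalk_inj : injective zwalk.
Proof.
move=> t t' e; apply: eq_from_tnth => i.
by rewrite -[LHS]vliftK -[RHS]vliftK -!zwalk_step e.
Qed.

Lemma zwalk0 t : zwalk t ord0 = 0.
Proof. by rewrite ffunE /= take0 big_nil. Qed.

Lemma zwalk_end t : short t -> zwalk t ord_max = vlift (ssum t).
Proof.
move=> st; apply/rowP => k.
have <- : vred T (zwalk t ord_max) = ssum t by rewrite vred_zwalk /pos /= take_oversize ?size_tuple.
rewrite !mxE red1K //; apply: leq_ltn_trans no_wrap.
by rewrite leq_pmul2l // zwalk_le.
Qed.

Lemma zwalk_exhaust (w : {ffun 'I_n.+1 -> 'rV[int]_d}) : w ord0 = 0 ->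
  (forall (i : 'I_n) k,
    `|((w (lift ord0 i) - w (widen_ord (leqnSn n) i))%R 0%R k)| <= ran)%N ->
  exists2 t, short t & zwalk t = w.
Proof.
move=> w0 ws.
pose st i := w (lift ord0 i) - w (widen_ord (leqnSn n) i).
pose t := [tuple vred T (st i) | i < n].
have small z : (z <= ran)%N -> (2 * z < N)%N.
  move=> zr; apply: leq_ltn_trans no_wrap; rewrite leq_pmul2l //.
  by apply: leq_trans zr _; rewrite leq_pmull.
have tl i : vlift (tnth t i) = st i.
  rewrite tnth_mktuple; apply/rowP => k; rewrite !mxE red1K //.
  by apply: small; have := ws i k; rewrite !mxE.
exists t.
  apply/allP => y /tnthP[i ->]; rewrite tnth_mktuple; apply/bigmax_leqP => k _.
  rewrite mxE cabs_red1; first by have := ws i k; rewrite !mxE.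
  by apply: small; have := ws i k; rewrite !mxE.
apply/ffunP => -[i]; elim: i => [|i IH] im.
  by rewrite (_ : Ordinal im = ord0) ?zwalk0 ?w0 //; apply/val_inj.
have iN : (i < n)%N by [].
have e1 : Ordinal im = lift ord0 (Ordinal iN) by apply/val_inj.
have e2 : widen_ord (leqnSn n) (Ordinal iN) = Ordinal (ltnW im) by apply/val_inj.
have := zwalk_step t (Ordinal iN); rewrite tl /st -e1 e2 IH => /eqP.
by rewrite subr_eq subrK => /eqP.
Qed.

Definition cut (H : 'rV[int]_d -> R) x : R := H (vlift x) * (supn x <= ran)%N%:R.

(** [cut] gives weight zero to steps longer than [ran], so only short tuples contribute; the two
    normalizations differ by the factor [(S / Z) ^+ n]. *)
Lemma short_sum (H : 'rV[int]_d -> R) (Z : R) (Phi : 'rV[int]_d -> R) :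
  \sum_x cut H x != 0 ->
  \sum_(t | short t) weighted_walk (fun z => H z / Z) Phi (zwalk t) =
  ((\sum_x cut H x) / Z) ^+ n *
  \sum_x Phi (vlift x) * saw_count (fun x => cut H x / \sum_y cut H y) n x.
Proof.
set S := \sum_x cut H x => S0.
set D := fun x : torus => cut H x / S.
have -> : \sum_x Phi (vlift x) * saw_count D n x =
    wsum D n (fun s => (saw s)%:R * Phi (vlift (ssum s))).
  by rewrite (wsum_saw _ _ (fun x => Phi (vlift x))); apply: eq_bigr => x _; rewrite mulrC.
rewrite wsum_tuple mulr_sumr big_mkcond; apply: eq_bigr => t _.
have [st|nst] := boolP (short t); last first.
  have [y yt yn] : exists2 y, y \in (t : seq torus) & ~~ (supn y <= ran)%N.
    by move: nst => /allPn.
  have -> : \prod_(y0 <- t) D y0 = 0.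
    by apply/eqP; rewrite prodf_seq_eq0; apply/hasP; exists y; rewrite //= /D /cut (negbTE yn) mulr0 mul0r.
  by rewrite mul0r mulr0.
rewrite /weighted_walk zwalk_end // walk_weight_zwalk saw_zwalk //.
rewrite !big_tuple /D.
have -> : \prod_(i < n) (H (vlift (tnth t i)) / Z) = (\prod_(i < n) H (vlift (tnth t i))) / Z ^+ n.
  by rewrite prodf_div prodr_const card_ord.
have -> : \prod_(i < n) (cut H (tnth t i) / S) = (\prod_(i < n) H (vlift (tnth t i))) / S ^+ n.
  rewrite prodf_div prodr_const card_ord; congr (_ / _); apply: eq_bigr => i _.
  by rewrite /cut (allP st) ?mulr1 // mem_tnth.
have Sn : S ^+ n != 0 by rewrite expf_neq0.
rewrite expr_div_n; move: (Z ^- n) (S ^+ n) Sn (\prod_(i < n) _) (Phi _) (_%:R) => a b b0 c e f.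
by field.
Qed.

End TorusWalks.

(** * Step profiles *)

Section Enorm.
Variables (R : realType) (d : nat).
Implicit Types (x : 'rV[R]_d) (a : R).

Lemma enorm_ge0 x : 0 <= enorm x. Proof. exact: sqrtr_ge0. Qed.

Lemma enorm_coord x i : `|x 0 i| <= enorm x.
Proof.
rewrite -sqrtr_sqr ler_wsqrtr // (bigD1 i) //= lerDl.
by apply: sumr_ge0 => j _; exact: sqr_ge0.
Qed.

Lemma enorm_le x a : 0 <= a -> (forall i, `|x 0 i| <= a) -> enorm x <= d%:R * a.
Proof.
move=> a0 xa; rewrite -[leRHS]ger0_norm ?mulr_ge0 // -sqrtr_sqr ler_wsqrtr //.
apply: le_trans (_ : \sum_(i < d) a ^+ 2 <= _).
  apply: ler_sum => i _; rewrite -real_normK ?num_real //.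
  by apply: lerXn2r; rewrite ?nnegrE.
rewrite sumr_const card_ord -[leLHS]mulr_natl exprMn; apply: ler_wpM2r; first exact: sqr_ge0.
by rewrite -natrX ler_nat; case: (d) => // m; rewrite leq_pmulr.
Qed.

Lemma enormZ x a : 0 <= a -> enorm (a *: x) = a * enorm x.
Proof.
move=> a0; rewrite /enorm -{2}(ger0_norm a0) -sqrtr_sqr -sqrtrM ?sqr_ge0 //.
by congr Num.sqrt; rewrite mulr_sumr; apply: eq_bigr => i _; rewrite mxE exprMn.
Qed.

Lemma enorm_powR_le x r : 0 < r ->
  enorm x `^ r <= d%:R `^ r * \sum_(i < d) `|x 0 i| `^ r.
Proof.
move=> r0; have [d0|d0] := posnP d.
  have -> : enorm x = 0.
    rewrite /enorm big1 ?sqrtr0 // => i _; exfalso.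
    by have := ltn_ord i; rewrite [X in (_ < X)%N]d0.
  by rewrite powR0 ?gt_eqF // mulr_ge0 ?powR_ge0 // sumr_ge0 // => i _; rewrite powR_ge0.
have [i ix] : exists i, forall j, `|x 0 j| <= `|x 0 i|.
  pose i0 := Ordinal d0.
  have [i _ h] := @arg_maxP _ _ _ i0 xpredT (fun i => `|x 0 i|) isT.
  by exists i => j; exact: h.
apply: le_trans (_ : (d%:R * `|x 0 i|) `^ r <= _).
  apply: ge0_ler_powR; rewrite ?nnegrE ?mulr_ge0 ?enorm_ge0 ?(ltW r0) //.
  exact: enorm_le.
rewrite powRM //; apply: ler_wpM2l; first exact: powR_ge0.
by rewrite (bigD1 i) //= lerDl sumr_ge0 // => j _; rewrite powR_ge0.
Qed.

End Enorm.

Section Profile.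
Variables (R : realType) (d : nat) (alpha : R) (h : 'rV[R]_d -> R).
Hypothesis hP : step_profile alpha h.
Hypothesis alpha_gt0 : 0 < alpha.
Local Notation p := (d%:R + alpha).

Let p_ge0 : 0 <= p. Proof. by rewrite addr_ge0 // ltW. Qed.

Lemma powN_anti (x y : R) : 0 < x -> x <= y -> y `^ (- p) <= x `^ (- p).
Proof.
move=> x0 xy; have y0 := lt_le_trans x0 xy.
rewrite !powRN lef_pV2 ?posrE ?powR_gt0 //.
by apply: ge0_ler_powR => //; rewrite nnegrE ltW.
Qed.

(** Beyond [M0] the ratio in the tail hypothesis is between 1/2 and 2. Between radius 1 and [M0]
    boundedness is used, at the price of the factor [M0 ^ p] in [A]. *)
Lemma profile_bounds : exists A c1 M0 : R,
  [/\ 0 < A /\ 0 < c1, 0 < M0, forall x, h x <= A,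
    forall x, 1 <= enorm x -> h x <= A * enorm x `^ (- p) &
    forall x, M0 <= enorm x -> c1 * enorm x `^ (- p) <= h x].
Proof.
have [ch ch0 tail] := profile_tail hP.
have [B hB] := profile_bounded hP.
have nb : nbhs (1 : R) [set y : R | 2^-1 <= y <= 2].
  exists 2^-1 => //= y; rewrite /ball_ /= ltr_norml => /andP[h1 h2].
  by apply/andP; split; lra.
have [M1 [_ far]] := tail _ nb.
pose M0 := Num.max 1 (M1 + 1).
have M01 : 1 <= M0 by rewrite le_max lexx.
have M00 : 0 < M0 := lt_le_trans ltr01 M01.
have far' x : M0 <= enorm x -> 2^-1 <= h x / (ch * enorm x `^ (- p)) <= 2.
  move=> Mx; have := far M0; rewrite lt_max ltrDl ltr01 orbT => /(_ isT x Mx) /=.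
  by rewrite opprD.
have pos x : M0 <= enorm x -> 0 < ch * enorm x `^ (- p).
  by move=> Mx; rewrite mulr_gt0 // powR_gt0 //; exact: lt_le_trans Mx.
pose A := Num.max 1 (Num.max B 0 * M0 `^ p + 2 * ch + Num.max B 0).
have B0 : 0 <= Num.max B 0 by rewrite le_max lexx orbT.
have hB' x : h x <= Num.max B 0 by rewrite le_max hB.
have t1 : 0 <= Num.max B 0 * M0 `^ p by rewrite mulr_ge0 ?powR_ge0.
exists A, (ch / 2), M0; split => //.
- by rewrite lt_max ltr01 divr_gt0.
- by move=> x; apply: le_trans (hB' x) _; rewrite le_max; apply/orP; right; lra.
- move=> x x1; have x0 := lt_le_trans ltr01 x1.
  have q0 := powR_gt0 (- p) x0.
  have [Mx|xM] := leP M0 (enorm x).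
    have /andP[_] := far' x Mx; rewrite ler_pdivrMr ?pos // mulrA => hx.
    apply: le_trans hx _; apply: ler_wpM2r; first exact: ltW.
    by rewrite le_max; apply/orP; right; lra.
  apply: le_trans (hB' x) _.
  apply: le_trans (_ : Num.max B 0 * M0 `^ p * enorm x `^ (- p) <= _).
    rewrite powRN -mulrA ler_peMr // ler_pdivlMr ?powR_gt0 // mul1r.
    by apply: ge0_ler_powR; rewrite ?nnegrE ?(ltW x0) ?(ltW M00) ?(ltW xM).
  apply: ler_wpM2r; first exact: ltW.
  by rewrite le_max; apply/orP; right; lra.
move=> x Mx; have /andP[hx _] := far' x Mx.
by move: hx; rewrite ler_pdivlMr ?pos // mulrC mulrAC.
Qed.

(** The map [x -> - x] is the composition of all coordinate reflections. *)
Lemma profile_even x : h (- x) = h x.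
Proof.
pose flip (s : seq 'I_d) : 'rV[R]_d := \row_k (if k \in s then - x 0 k else x 0 k).
have fl s : uniq s -> h (flip s) = h x.
  elim: s => [_|i s IH /= /andP[is_ us]]; first by congr h; apply/rowP => k; rewrite mxE.
  rewrite -(IH us) -(profile_reflection hP i (flip s)); congr h; apply/rowP => k.
  by rewrite !mxE in_cons; case: eqP => //= ->; rewrite (negbTE is_).
rewrite -(fl (enum 'I_d)) ?enum_uniq //; congr h; apply/rowP => k.
by rewrite !mxE mem_enum.
Qed.

End Profile.

Lemma pow2_bracket (R : realType) (L : R) : 1 <= L ->
  exists l, L <= (2 ^ l)%:R <= 2 * L.
Proof.
move=> L1; have ex : exists l, L <= (2 ^ l)%:R.
  exists (Num.bound L); have L0 : 0 <= L := le_trans ler01 L1.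
  apply: le_trans (ltW (archi_boundP L0)) _.
  by rewrite ler_nat ltnW // ltn_expl.
case: (ex_minnP ex) => l lL lmin; exists l; rewrite lL /=.
case: l lL lmin => [|l] lL lmin; first by move: L1; lra.
have : (2 ^ l)%:R < L by rewrite ltNge; apply/negP => /lmin; rewrite ltnn.
by rewrite expnS natrM; move: (_%:R) => z; lra.
Qed.

(** * The scaled profile as a torus kernel *)

Section ProfileKernel.
Variables (R : realType) (d : nat) (alpha : R) (h : 'rV[R]_d -> R).
Hypothesis hP : step_profile alpha h.
Hypothesis alpha_gt0 : 0 < alpha.
Hypothesis d_gt0 : (0 < d)%N.
Local Notation p := (d%:R + alpha).
Variables (A c1 M0 : R) (m1 : nat).
Hypotheses (A_gt0 : 0 < A) (c1_gt0 : 0 < c1).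
Hypothesis h_sup : forall x, h x <= A.
Hypothesis h_tail : forall x, 1 <= enorm x -> h x <= A * enorm x `^ (- p).
Hypothesis h_low : forall x, M0 <= enorm x -> c1 * enorm x `^ (- p) <= h x.
Hypothesis M0_m1 : M0 <= (2 ^ m1)%:R.
Variables (L : R) (l0 : nat).
Hypothesis L_ge1 : 1 <= L.
Hypothesis L_l0 : L <= (2 ^ l0)%:R <= 2 * L.

(** The factor lost by the tail when the distance doubles; with the volume factor [2 ^+ d] it
    becomes [2 ^ - alpha]. *)
Definition tail_ratio : R := 2 `^ (- p).
(** After scaling by [L], a point of box [m] has norm at most [d * 2 ^+ (m1 + 4) * 2 ^+ m]: three
    doublings come from the box, one from [2 ^ l0 <= 2 * L], and [d] from the sup norm. *)
Definition low_const : R := c1 * (d%:R * 2 ^+ (m1 + 4)) `^ (- p).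
Definition scaled (z : 'rV[int]_d) : R := h (L^-1 *: lattice_pt R z).

Let L_gt0 : 0 < L := lt_le_trans ltr01 L_ge1.

Lemma tail_ratio_gt0 : 0 < tail_ratio. Proof. by rewrite powR_gt0. Qed.
Lemma low_const_gt0 : 0 < low_const.
Proof. by rewrite mulr_gt0 // powR_gt0 // mulr_gt0 ?ltr0n ?exprn_gt0. Qed.

Lemma tail_ratio_tau : 2 ^+ d * tail_ratio = 2 `^ (- alpha).
Proof.
rewrite /tail_ratio -powR_mulrn // -powRD ?pnatr_eq0 ?implybT //.
by congr (_ `^ _); ring.
Qed.

Lemma tail_ratioX m : (2 ^+ m) `^ (- p) = tail_ratio ^+ m.
Proof. by rewrite -powR_mulrn // powRAC powR_mulrn ?powR_ge0. Qed.

Lemma scaled_sym z : scaled (- z) = scaled z.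
Proof.
rewrite /scaled -(profile_even hP); congr h; apply/rowP => k.
by rewrite !mxE rmorphN mulrN opprK.
Qed.

Lemma scaled_0 : scaled 0 = h 0.
Proof. by rewrite /scaled /lattice_pt raddf0 scaler0. Qed.

Lemma scaled_ge0 z : 0 <= scaled z. Proof. exact: profile_ge0 hP _. Qed.

Lemma enorm_scaled (z : 'rV[int]_d) : enorm (L^-1 *: lattice_pt R z) = L^-1 * enorm (lattice_pt R z).
Proof. by rewrite enormZ // invr_ge0 ltW. Qed.

Lemma lattice_pt_coord (z : 'rV[int]_d) i : `|lattice_pt R z 0 i| = (`|z 0%R i|%N)%:R.
Proof. by rewrite mxE -intr_norm natr_absz. Qed.

Lemma scaled_tail m (z : 'rV[int]_d) i : (2 ^ (m + l0) <= `|z 0%R i|)%N ->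
  scaled z <= A * tail_ratio ^+ m.
Proof.
move=> zi; have /andP[Ll _] := L_l0.
have e : 2 ^+ m <= enorm (L^-1 *: lattice_pt R z).
  rewrite enorm_scaled mulrC ler_pdivlMr //.
  apply: le_trans (enorm_coord _ i); rewrite lattice_pt_coord.
  apply: le_trans (_ : (2 ^ (m + l0))%:R <= _); last by rewrite ler_nat.
  by rewrite expnD natrM natrX; apply: ler_wpM2l; rewrite ?exprn_ge0.
have e1 : 1 <= enorm (L^-1 *: lattice_pt R z).
  by apply: le_trans e; rewrite exprn_ege1 // ler1n.
apply: le_trans (h_tail e1) _; apply: ler_wpM2l; first exact: ltW.
by rewrite -tail_ratioX; apply: powN_anti; rewrite ?exprn_gt0.
Qed.

Lemma scaled_low m (z : 'rV[int]_d) : (forall i, 2 ^ (m + (m1 + l0) + 1) <= `|z 0%R i| < 2 ^ (m + (m1 + l0) + 3))%N ->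
  low_const * tail_ratio ^+ m <= scaled z.
Proof.
move=> zi; have /andP[Ll lL] := L_l0; have l0_ge0 := ltW L_gt0.
have i0 := Ordinal d_gt0; have ler0n2 : 0 <= 2 :> R by [].
have up : enorm (L^-1 *: lattice_pt R z) <= (d%:R * 2 ^+ (m1 + 4)) * 2 ^+ m.
  rewrite enorm_scaled mulrC ler_pdivrMr // -!mulrA; apply: enorm_le.
    by rewrite !mulr_ge0 ?exprn_ge0.
  move=> i; rewrite lattice_pt_coord; have /andP[_ /ltnW z2] := zi i.
  apply: le_trans (_ : (2 ^ (m + (m1 + l0) + 3))%:R <= _); first by rewrite ler_nat.
  have -> : (m + (m1 + l0) + 3 = (m1 + 3 + m) + l0)%N by clear; lia.
  rewrite expnD natrM natrX; apply: le_trans (ler_wpM2l (exprn_ge0 _ ler0n2) lL) _.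
  by rewrite le_eqVlt; apply/orP; left; apply/eqP; rewrite !exprD; ring.
have low : M0 <= enorm (L^-1 *: lattice_pt R z).
  apply: le_trans M0_m1 _; rewrite enorm_scaled mulrC ler_pdivlMr //.
  apply: le_trans (enorm_coord _ i0); rewrite lattice_pt_coord.
  have /andP[z1 _] := zi i0.
  apply: le_trans (_ : (2 ^ m1 * 2 ^ l0)%:R <= _); first by rewrite natrM ler_wpM2l.
  rewrite ler_nat; apply: leq_trans z1; rewrite -expnD leq_exp2l //; clear; lia.
apply: le_trans (h_low low); rewrite /low_const -mulrA; apply: ler_wpM2l; first exact: ltW.
rewrite -tail_ratioX -powRM ?mulr_ge0 ?exprn_ge0 //.
apply: powN_anti => //; rewrite enorm_scaled mulr_gt0 ?invr_gt0 //.
apply: lt_le_trans (enorm_coord _ i0); rewrite lattice_pt_coord ltr0n.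
by have /andP[z1 _] := zi i0; apply: leq_trans z1; rewrite expn_gt0.
Qed.

Section Torus.
Variables (T J M : nat).
Hypothesis TJ : T.+1 = (2 ^ J)%N.
Hypothesis MJ : (M + (m1 + l0) + 5 <= J)%N.
Local Notation N := T.+1.
Local Notation ran := (2 ^ (M + (m1 + l0) + 3))%N.

Lemma ran_small : (2 * ran < N)%N.
Proof. by rewrite TJ -expnS ltn_exp2l //; move: MJ; clear; lia. Qed.

Lemma vliftN (x : 'rV['I_N]_d) : (supn x <= ran)%N -> vlift (- x) = - vlift x.
Proof.
move=> xr; apply/rowP => i; rewrite !mxE.
rewrite -{1}(lift1K (x 0 i)) -red1N red1K // abszN absz_lift1.
apply: leq_ltn_trans ran_small; rewrite leq_pmul2l //.
by apply: leq_trans xr; exact: (leq_bigmax i).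
Qed.

Lemma profile_raw_kernel :
  raw_kernel tail_ratio A low_const l0 m1 M (cut (T := T) ran scaled).
Proof.
have pos (x : 'rV['I_N]_d) : scaled (vlift x) * (supn x <= ran)%N%:R <= scaled (vlift x).
  by case: (supn x <= ran)%N; rewrite ?mulr1 // mulr0 scaled_ge0.
split.
- by move=> x; rewrite mulr_ge0 // scaled_ge0.
- move=> x; rewrite /cut supnN; case: leqP => [xr|_]; last by rewrite !mulr0.
  by rewrite vliftN // scaled_sym.
- by move=> x; apply: le_trans (pos x) _; exact: h_sup.
- move=> m x xm; apply: le_trans (pos x) _; have [i xi] := supn_attained d_gt0 x.
  by apply: (@scaled_tail _ _ i); rewrite mxE absz_lift1 -xi.
- by move=> x xr; rewrite /cut leqNgt xr mulr0.
move=> m x mM; rewrite inE => /forallP xb.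
have cx i : cabs (x 0 i) = x 0 i.
  have /andP[_ x2] := xb i; apply/minn_idPl.
  have : (2 ^ (m + (m1 + l0) + 3) <= ran)%N by rewrite leq_exp2l // !leq_add2r.
  move: x2 ran_small; move: (nat_of_ord _) (2 ^ _)%N (2 ^ _)%N => a b c; clear; lia.
have xr : (supn x <= ran)%N.
  apply/bigmax_leqP => i _; rewrite cx; have /andP[_ /ltnW x2] := xb i.
  by apply: leq_trans x2 _; rewrite leq_exp2l // !leq_add2r.
rewrite /cut xr mulr1; apply: scaled_low => i; rewrite mxE absz_lift1 cx; exact: xb.
Qed.

End Torus.
End ProfileKernel.

(** * Comparison of lattice and torus moments *)

Section Transfer.
Variables (R : realType) (d n : nat) (H : 'rV[int]_d -> R) (Z : R).
Hypothesis n_gt0 : (0 < n)%N.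
Hypothesis H_ge0 : forall z, 0 <= H z.
Hypothesis Z_gt0 : 0 < Z.
Local Notation D := (fun z => H z / Z).
Local Notation mass T ran := (\sum_(x : 'rV['I_T.+1]_d) cut ran H x).
Local Notation torus_moment T ran Phi := (\sum_(x : 'rV['I_T.+1]_d)
  Phi (vlift x) * saw_count (fun x => cut ran H x / mass T ran) n x).
Local Notation moment Phi :=
  (\esum_(x in [set: 'rV[int]_d]) ((Phi x)%:E * saw_two_point D n x))%E.
Implicit Type Phi : 'rV[int]_d -> R.

Let D_ge0 z : 0 <= D z. Proof. by rewrite divr_ge0 // ltW. Qed.

Let weighted_ge0 Phi (w : {ffun 'I_n.+1 -> 'rV[int]_d}) :
  (forall x, 0 <= Phi x) -> 0 <= weighted_walk D Phi w.
Proof. by move=> P0; rewrite mulr_ge0 // mulr_ge0 // walk_weight_ge0. Qed.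

Lemma moment_ge T ran Phi : (2 * (n * ran) < T.+1)%N -> mass T ran != 0 ->
  (forall x, 0 <= Phi x) ->
  (((mass T ran / Z) ^+ n * torus_moment T ran Phi)%:E <= moment Phi)%E.
Proof.
move=> nw S0 P0; rewrite -(short_sum nw n_gt0 Z Phi S0) esum_two_point //.
apply: esum_ge_finType => //.
- by move=> w; exact: weighted_ge0.
- by move=> t t' _ _; exact: zwalk_inj.
by move=> t _ /=; exact: zwalk0.
Qed.

(** Finitely many walks have bounded steps, so a single torus with a large cutoff contains them
    all. *)
Lemma moment_le Phi (B : \bar R) : (forall x, 0 <= Phi x) ->
  (forall m, exists T ran, [/\ (m <= ran)%N, (2 * (n * ran) < T.+1)%N, mass T ran != 0 &
    (((mass T ran / Z) ^+ n * torus_moment T ran Phi)%:E <= B)%E]) ->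
  (moment Phi <= B)%E.
Proof.
move=> P0 HB; rewrite esum_two_point //.
apply: esum_le_finType => [w|X XI]; first exact: weighted_ge0.
pose m := (\max_(w <- X) \max_(i < n) \max_(k < d)
  `|((w (lift ord0 i) - w (widen_ord (leqnSn n) i))%R 0%R k)|)%N.
have [T [ran [mr nw S0 SB]]] := HB m.
exists (n.-tuple 'rV['I_T.+1]_d : finType), (@short d T n ran), (@zwalk d T n).
split.
- by move=> t t' _ _; exact: zwalk_inj.
- move=> w wX.
  have ws (i : 'I_n) k : (`|((w (lift ord0 i) - w (widen_ord (leqnSn n) i))%R 0%R k)| <= ran)%N.
    apply: leq_trans mr; apply: leq_trans (leq_bigmax_seq w wX isT).
    by apply: leq_trans (leq_bigmax i); exact: (leq_bigmax k).
  by have [t st tw] := zwalk_exhaust nw n_gt0 (XI _ wX) ws; exists t.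
by rewrite (short_sum nw n_gt0 Z Phi S0).
Qed.

End Transfer.

Section Normalizer.
Variables (R : realType) (d : nat) (H : 'rV[int]_d -> R).
Hypothesis H_ge0 : forall z, 0 <= H z.
Local Notation mass T ran := (\sum_(x : 'rV['I_T.+1]_d) cut ran H x).

Lemma mass_cutE T ran : mass T ran = \sum_(x : 'rV['I_T.+1]_d | (supn x <= ran)%N) H (vlift x).
Proof.
rewrite [RHS]big_mkcond; apply: eq_bigr => x _; rewrite /cut.
by case: ifP; rewrite ?mulr1 ?mulr0.
Qed.

Lemma vlift_inj T : injective (@vlift d T).
Proof. exact: can_inj (@vliftK d T). Qed.

Lemma mass_le_esum T ran : ((mass T ran)%:E <= \esum_(y in [set: 'rV[int]_d]) (H y)%:E)%E.
Proof.
rewrite mass_cutE; apply: (@esum_ge_finType _ _ H) => // x y _ _; exact: vlift_inj.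
Qed.

Lemma esum_le_mass (B : \bar R) :
  (forall m, exists T ran, [/\ (m <= ran)%N, (2 * ran < T.+1)%N & ((mass T ran)%:E <= B)%E]) ->
  (\esum_(y in [set: 'rV[int]_d]) (H y)%:E <= B)%E.
Proof.
move=> HB; apply: esum_le_finType => // X _.
pose m := (\max_(u <- X) \max_(k < d) `|(u : 'rV[int]_d) 0%R k|)%N.
have [T [ran [mr nw SB]]] := HB m.
exists ('rV['I_T.+1]_d : finType), (fun x => supn x <= ran)%N, (@vlift d T).
split; last by rewrite -mass_cutE.
- by move=> x y _ _; exact: vlift_inj.
move=> u uX; have ur k : (`|u 0%R k| <= ran)%N.
  apply: leq_trans mr; apply: leq_trans (leq_bigmax_seq u uX isT).
  exact: (leq_bigmax k).
have us k : (2 * `|u 0%R k| < T.+1)%N by apply: leq_ltn_trans nw; rewrite leq_pmul2l.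
exists (vred T u); last by apply/rowP => k; rewrite !mxE red1K.
by apply/bigmax_leqP => k _; rewrite mxE cabs_red1.
Qed.

End Normalizer.

Section Comparison.
Variables (R : realType) (d n : nat) (H : 'rV[int]_d -> R) (Z : R).
Hypothesis n_gt0 : (0 < n)%N.
Hypothesis H_ge0 : forall z, 0 <= H z.
Hypothesis Z_gt0 : 0 < Z.
Hypothesis Z_E : \esum_(y in [set: 'rV[int]_d]) (H y)%:E = Z%:E.
Local Notation D := (fun z => H z / Z).
Local Notation mass T ran := (\sum_(x : 'rV['I_T.+1]_d) cut ran H x).
Local Notation torus_distr T ran := (fun x : 'rV['I_T.+1]_d => cut ran H x / mass T ran).
Variables (Phi : 'rV[int]_d -> R) (Cu Cl : R).
Hypothesis Phi_ge0 : forall x, 0 <= Phi x.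
Hypothesis (Cu_ge0 : 0 <= Cu) (Cl_ge0 : 0 <= Cl).
Hypothesis torus_bounds : forall m, exists T ran,
  [/\ (m <= ran)%N, (2 * (n * ran) < T.+1)%N, 0 < mass T ran &
    [/\ 0 < \sum_x saw_count (torus_distr T ran) n x,
     \sum_x Phi (vlift x) * saw_count (torus_distr T ran) n x <=
       Cu * \sum_x saw_count (torus_distr T ran) n x &
     \sum_x saw_count (torus_distr T ran) n x <=
       Cl * \sum_x Phi (vlift x) * saw_count (torus_distr T ran) n x]].
Local Notation num := (\esum_(x in [set: 'rV[int]_d]) ((Phi x)%:E * saw_two_point D n x))%E.
Local Notation den := (saw_total D n).

Lemma saw_totalE :
  den = (\esum_(x in [set: 'rV[int]_d]) (((fun=> 1) x : R)%:E * saw_two_point D n x))%E.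
Proof. by apply: eq_esum => x _; rewrite mul1e. Qed.

Let one_ge0 (x : 'rV[int]_d) : 0 <= (fun=> 1) x :> R. Proof. by []. Qed.
Let sum1E T (f : 'rV['I_T.+1]_d -> R) :
  \sum_x (fun=> 1) (vlift x) * f x = \sum_x f x.
Proof. by apply: eq_bigr => x _; rewrite mul1r. Qed.

(** The factor [(mass / Z) ^+ n] is common to both moments on each torus, so its limit is
    irrelevant: a finite part of one moment is bounded on a torus by the other moment, which
    [moment_ge] bounds on the lattice. Finiteness starts from [den <= 1]. *)
Lemma moment_comparison : exists nu de : R,
  [/\ num = nu%:E, den = de%:E, 0 < de, nu <= Cu * de & de <= Cl * nu].
Proof.
have den_le1 : (den <= 1%:E)%E.
  rewrite saw_totalE; apply: moment_le => // m.
  have [T [ran [mr nw S0 [C0 _ _]]]] := torus_bounds m.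
  exists T, ran; split => //; first by rewrite gt_eqF.
  rewrite lee_fin sum1E.
  have k1 : mass T ran / Z <= 1.
    by rewrite ler_pdivrMr // mul1r -lee_fin -Z_E; exact: mass_le_esum.
  have k0 : 0 <= mass T ran / Z by rewrite divr_ge0 // ltW.
  rewrite -[leRHS]mulr1; apply: ler_pM; rewrite ?exprn_ge0 ?(ltW C0) ?exprn_ile1 //.
  have D0 (x : 'rV['I_T.+1]_d) : 0 <= torus_distr T ran x.
    by rewrite divr_ge0 ?(ltW S0) // mulr_ge0.
  have := wsum_saw (torus_distr T ran) n (fun=> 1).
  under [RHS]eq_bigr do rewrite mulr1.
  move=> <-.
  apply: le_trans (_ : wsum (torus_distr T ran) n (fun=> 1) <= _).
    by apply: le_wsum => // s; rewrite mulr1 lern1; case: (saw s).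
  have w1 k : wsum (torus_distr T ran) k (fun=> 1) = 1.
    elim: k => //= k IH; rewrite -mulr_suml IH mulr1 -mulr_suml divff // gt_eqF //.
  by rewrite w1.
have den_gt0 : (0 < den)%E.
  have [T [ran [mr nw S0 [C0 _ _]]]] := torus_bounds 0.
  rewrite saw_totalE; apply: lt_le_trans (moment_ge n_gt0 H_ge0 Z_gt0 nw _ one_ge0).
    by rewrite lte_fin sum1E mulr_gt0 // exprn_gt0 // divr_gt0.
  by rewrite gt_eqF.
have up : (num <= Cu%:E * den)%E.
  apply: moment_le => // m.
  have [T [ran [mr nw S0 [C0 Cup _]]]] := torus_bounds m.
  exists T, ran; split => //; first by rewrite gt_eqF.
  have S0' : mass T ran != 0 by rewrite gt_eqF.
  have := moment_ge n_gt0 H_ge0 Z_gt0 nw S0' one_ge0; rewrite -saw_totalE sum1E => h.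
  apply: le_trans (lee_wpmul2l _ h); last by rewrite lee_fin.
  rewrite -EFinM lee_fin mulrCA; apply: ler_wpM2l => //.
  by rewrite exprn_ge0 // divr_ge0 // ltW.
have lo : (den <= Cl%:E * num)%E.
  rewrite {1}saw_totalE; apply: moment_le => // m.
  have [T [ran [mr nw S0 [C0 _ Clo]]]] := torus_bounds m.
  exists T, ran; split => //; first by rewrite gt_eqF.
  have S0' : mass T ran != 0 by rewrite gt_eqF.
  have h := moment_ge n_gt0 H_ge0 Z_gt0 nw S0' Phi_ge0.
  apply: le_trans (lee_wpmul2l _ h); last by rewrite lee_fin.
  rewrite -EFinM lee_fin mulrCA sum1E; apply: ler_wpM2l => //.
  by rewrite exprn_ge0 // divr_ge0 // ltW.
have num0 : (0 <= num)%E.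
  rewrite esum_two_point //; last by move=> z; rewrite divr_ge0 // ltW.
  apply: esum_ge0 => w _; rewrite lee_fin mulr_ge0 // mulr_ge0 // walk_weight_ge0 //.
  by move=> z; rewrite divr_ge0 // ltW.
move: den_le1 den_gt0 up lo num0; case: den => [de| |] //.
rewrite -EFinM; case: num => [nu| |] // _ de0 up lo _.
by exists nu, de; split.
Qed.

End Comparison.

(** * Displacement asymptotics *)

Section ScaleChoice.
Variable R : realType.
Implicit Types (x B : R) (n e s : nat).

Lemma expr_unbounded x B : 1 < x -> exists s, B <= x ^+ s.
Proof.
move=> x1; have bern s : 1 + s%:R * (x - 1) <= x ^+ s.
  elim: s => [|s IH]; first by rewrite mul0r addr0.
  rewrite exprS -[s.+1]addn1 natrD mulrDl mul1r.
  apply: le_trans (_ : x * (1 + s%:R * (x - 1)) <= _); last first.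
    by apply: ler_wpM2l => //; apply: ltW; apply: lt_trans x1.
  have : 0 <= s%:R * (x - 1) ^+ 2 by rewrite mulr_ge0 // sqr_ge0.
  by rewrite expr2; move: s%:R => z; nra.
have x0 : 0 < x - 1 by rewrite subr_gt0.
exists (Num.bound `|B / (x - 1)|); apply: le_trans (bern _).
have := archi_boundP (normr_ge0 `|B / (x - 1)|); rewrite normr_id => h.
have : B / (x - 1) <= (Num.bound `|B / (x - 1)|)%:R by apply: le_trans (ler_norm _) (ltW h).
rewrite ler_pdivrMr // => h'; apply: le_trans h' _.
by rewrite lerDr.
Qed.

Lemma dyadic_bracket x : 1 <= x -> exists e, 2 ^+ e <= x < 2 ^+ e.+1.
Proof.
move=> x1; have ex : exists k, x < 2 ^+ k.
  by have [s xs] := expr_unbounded (x + 1) (ltr1n R 2 : 1 < 2); exists s; apply: lt_le_trans xs; rewrite ltrDl.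
case: (ex_minnP ex) => -[|e] h hmin; first by rewrite expr0 ltNge x1 in h.
exists e; rewrite h andbT leNgt; apply/negP => /hmin; by rewrite ltnn.
Qed.

Lemma ln2_ge : 2^-1 <= ln 2 :> R.
Proof.
have := @le_ln1Dx R (- 2^-1); rewrite (_ : 1 + - 2^-1 = 2^-1); last by field.
rewrite lnV ?posrE // => h.
have : - ln 2 <= - 2^-1 :> R by apply: h; lra.
by rewrite lerN2.
Qed.

Lemma ln2_le : ln 2 <= 1 :> R.
Proof. by have := @le_ln1Dx R 1; apply; lra. Qed.

Lemma ln_ge_near B : exists n0 : nat, forall n, (n0 <= n)%N -> B <= ln n%:R.
Proof.
exists (Num.bound (expR B)) => n h.
have e : expR B <= n%:R.
  apply: le_trans (ltW (archi_boundP (expR_ge0 B))) _; by rewrite ler_nat.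
by rewrite -(expRK B) ler_ln ?posrE ?expR_gt0 //; exact: lt_le_trans (expR_gt0 B) e.
Qed.

Variable alpha : R.
Hypothesis alpha_gt0 : 0 < alpha.
Local Notation tau := (2 `^ (- alpha)).
Local Notation a := (Num.min alpha 2).
Local Notation sg := (Num.max tau 4^-1).

Definition displacement_scale (n : nat) : R :=
  if alpha == 2 then (n%:R * ln n%:R) `^ 2^-1 else n%:R `^ a^-1.
Local Notation b := displacement_scale.

Let a_gt0 : 0 < a. Proof. by rewrite lt_min alpha_gt0 ltr0n. Qed.
Let tau_gt0 : 0 < tau. Proof. by rewrite powR_gt0. Qed.

Lemma pow2N2 : 2 `^ (- 2) = 4^-1 :> R.
Proof. by rewrite powR_invn // expr2 -natrM. Qed.

Lemma ler_pow2 x y : x <= y -> 2 `^ x <= 2 `^ y.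
Proof. by apply: ler_powR; rewrite ler1n. Qed.

Lemma sigma_powR : sg = 2 `^ (- a).
Proof.
rewrite -pow2N2; have [h|h] := leP alpha 2.
  by rewrite max_l // ler_pow2 // lerN2.
by rewrite max_r // ler_pow2 // lerN2 ltW.
Qed.

Lemma tau_neq : alpha != 2 -> tau != 4^-1.
Proof.
move=> a2; rewrite -pow2N2; apply/eqP => /(congr1 (@ln R)); rewrite !ln_powR => /eqP.
have l2 : ln 2 != 0 :> R by rewrite gt_eqF // (lt_le_trans _ ln2_ge).
rewrite (inj_eq (mulIf l2)) eqr_opp => /eqP e.
by rewrite e eqxx in a2.
Qed.

Lemma scale_gap_le_pow e : alpha != 2 ->
  scale_gap tau e <= sg ^+ e.+1 / `|4^-1 - tau|.
Proof.
move=> a2; have t4 : 0 < `|4^-1 - tau| by rewrite normr_gt0 subr_eq0 eq_sym tau_neq.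
rewrite ler_pdivlMr // -[scale_gap _ _]ger0_norm ?(ltW (scale_gap_gt0 _ tau_gt0)) //.
rewrite -normrM mulrC.
have -> : (4^-1 - tau) * scale_gap tau e = 4^-1 ^+ e.+1 - tau ^+ e.+1.
  rewrite subrXX; congr (_ * _); apply: eq_bigr => i _; by rewrite mulrC.
have s0 : 0 <= sg by rewrite le_max (ltW tau_gt0).
have h1 : tau ^+ e.+1 <= sg ^+ e.+1.
  by apply: lerXn2r; rewrite ?nnegrE ?(ltW tau_gt0) // le_max lexx.
have h2 : 4^-1 ^+ e.+1 <= sg ^+ e.+1.
  by apply: lerXn2r; rewrite ?nnegrE // le_max lexx orbT.
have h3 : 0 <= tau ^+ e.+1 by rewrite exprn_ge0 // ltW.
have h4 : 0 <= 4^-1 ^+ e.+1 :> R by rewrite exprn_ge0.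
rewrite ler_norml; move: h1 h2 h3 h4; move: (tau ^+ _) (4^-1 ^+ _) (sg ^+ _) => u v w.
by move=> *; apply/andP; split; lra.
Qed.

Lemma scale_gap_quarter e : scale_gap 4^-1 e = e.+1%:R * 4^-1 ^+ e :> R.
Proof.
rewrite /scale_gap; under eq_bigr => i _ do rewrite -exprD subnKC -1?ltnS //.
by rewrite sumr_const card_ord mulr_natl.
Qed.

Lemma scale_gap_ge_sigma e : sg ^+ e <= scale_gap tau e.
Proof.
have [h|h] := leP tau 4^-1.
  by have := scale_gap_ge tau_gt0 (leq0n e); rewrite mul1r subn0.
by have := scale_gap_ge tau_gt0 (leqnn e); rewrite subnn mulr1.
Qed.

(** At the dyadic scale [e] of [b n], [n * scale_gap] is bounded, as the upper moment bound needs.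
    Moving down by [s] scales, at a cost that does not depend on [n], makes it exceed any [B], as
    the lower bound needs. *)
Lemma scale_choice : exists Q : R, forall B, exists s n0 : nat,
  forall n, (n0 <= n)%N -> exists e,
  [/\ (s <= e)%N, 2 ^+ e <= b n < 2 ^+ e.+1, n%:R * scale_gap tau e <= Q &
    B <= n%:R * scale_gap tau (e - s)].
Proof.
have [a2|a2] := eqVneq alpha 2.
  have t4 : tau = 4^-1 by rewrite a2 pow2N2.
  (* Product of 4 in [n * l <= 4 * 4 ^ e] and 3 in [e.+1 <= 3 * l], with [l = ln n]. *)
  exists 12 => B.
  have [s Bs] := expr_unbounded (4 * B) (ltr1n R 4 : 1 < 4).
  have [n0 hn0] := ln_ge_near (Num.max 1 (4 * s%:R)).
  exists s, (maxn 1 n0) => n; rewrite geq_max => /andP[n1 nn0].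
  have := hn0 n nn0; rewrite ge_max => /andP[l1 ls].
  have n0' : 0 < n%:R :> R by rewrite ltr0n.
  have n1' : 1 <= n%:R :> R by rewrite ler1n.
  set l := ln n%:R in l1 ls *; have l0 : 0 < l := lt_le_trans ltr01 l1.
  have nl : l <= n%:R.
    apply: le_trans (_ : ln (1 + n%:R) <= _); last by apply: le_ln1Dx; lra.
    by rewrite ler_ln ?posrE ?lerDr //; lra.
  have bE : b n = (n%:R * l) `^ 2^-1 by rewrite /b a2 eqxx.
  have nl0 : 0 <= n%:R * l by rewrite mulr_ge0 // ltW.
  have b2 : b n ^+ 2 = n%:R * l.
    by rewrite bE -powR_mulrn ?powR_ge0 // -powRrM mulVf // powRr1.
  have b0 : 0 <= b n by rewrite bE powR_ge0.
  have b1 : 1 <= b n.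
    rewrite -(@ler_pXn2r _ 2) ?nnegrE // expr1n b2.
    by apply: le_trans n1' _; rewrite ler_peMr // ltW.
  have [e /andP[e1 e2]] := dyadic_bracket b1.
  have p4 k : (2 ^+ k) ^+ 2 = 4 ^+ k :> R.
    by rewrite -exprM mulnC exprM; congr (_ ^+ _); rewrite expr2 -natrM.
  have u1 : 4 ^+ e <= n%:R * l.
    by rewrite -b2 -p4; apply: lerXn2r; rewrite ?nnegrE ?exprn_ge0.
  have u2 : n%:R * l <= 4 * 4 ^+ e.
    by rewrite -b2 -exprS -p4; apply: lerXn2r; rewrite ?nnegrE ?exprn_ge0 // ltW.
  have f0 k : 0 < 4 ^+ k :> R by rewrite exprn_gt0.
  have l4 : ln 4 = 2 * ln 2 :> R.
    have e4 : 4 = 2 * 2 :> R by rewrite -natrM.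
    by rewrite e4 lnM ?posrE //; ring.
  have lx k : ln (4 ^+ k) = k%:R * (2 * ln 2) :> R.
    by rewrite lnXn // l4 -[LHS]mulr_natl.
  (* Logarithms of [4 ^ e <= n * l <= 4 * 4 ^ e] make [e] and [l] comparable, since
     [1 <= l <= n]. *)
  have e_le : e%:R <= 2 * l.
    have : ln (4 ^+ e : R) <= ln (n%:R * n%:R : R).
      rewrite ler_ln ?posrE ?mulr_gt0 //; apply: le_trans u1 _.
      by apply: ler_wpM2l.
    rewrite lnM ?posrE // lx -/l; have := ln2_ge; have : 0 <= e%:R :> R by [].
    by move: (ln 2) => z; nra.
  have e_ge : l <= 2 * e.+1%:R.
    have : ln (n%:R : R) <= ln (4 ^+ e.+1 : R).
      rewrite ler_ln ?posrE // exprS; apply: le_trans u2.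
      by rewrite ler_peMr.
    rewrite lx -/l; have := ln2_le; have : 0 <= e.+1%:R :> R by [].
    by move: (ln 2) (e.+1%:R) => z y; nra.
  have se : (s <= e)%N.
    have : s%:R < e.+1%:R :> R by move: ls e_ge l1; move: (e.+1%:R) s%:R => y z; lra.
    by rewrite ltr_nat.
  exists e; split => //; first by rewrite e1.
    rewrite t4 scale_gap_quarter exprVn mulrA ler_pdivrMr // -(ler_pM2r l0).
    have e12 : e.+1%:R <= 3 * l by rewrite -addn1 natrD; lra.
    rewrite mulrAC.
    apply: le_trans (ler_pM _ _ u2 e12) _; rewrite ?mulr_ge0 ?(ltW l0) //.
    by rewrite le_eqVlt; apply/orP; left; apply/eqP; ring.
  rewrite t4 scale_gap_quarter exprVn.
  have -> : 4 ^+ (e - s) = 4 ^+ e / 4 ^+ s :> R.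
    by rewrite -{2}(subnK se) exprD mulfK // gt_eqF.
  rewrite invf_div mulrA mulrA ler_pdivlMr // -(ler_pM2r l0).
  have es : l <= 4 * (e - s).+1%:R.
    by rewrite -[(e - s).+1]addn1 natrD natrB //; move: e_ge ls; rewrite -[e.+1]addn1 natrD; move: e%:R s%:R => y z; lra.
  have [B0|B0] := leP B 0.
    apply: le_trans (_ : 0 <= _); last by rewrite !mulr_ge0 // ltW.
    by rewrite mulr_le0_ge0 ?(ltW l0) // mulr_le0_ge0 // ltW.
  apply: le_trans (_ : B * (n%:R * l) * l <= _).
    by apply: ler_wpM2r; rewrite ?(ltW l0) //; apply: ler_wpM2l; [exact: ltW|exact: u1].
  apply: le_trans (_ : B * (n%:R * l) * (4 * (e - s).+1%:R) <= _).
    by apply: ler_wpM2l => //; rewrite mulr_ge0 // ltW.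
  have -> : B * (n%:R * l) * (4 * (e - s).+1%:R) = (4 * B) * (n%:R * (e - s).+1%:R * l) by ring.
  have -> : n%:R * (e - s).+1%:R * 4 ^+ s * l = 4 ^+ s * (n%:R * (e - s).+1%:R * l) by ring.
  by apply: ler_wpM2r => //; rewrite !mulr_ge0 // ltW.
have t4 : 0 < `|4^-1 - tau| by rewrite normr_gt0 subr_eq0 eq_sym tau_neq.
exists (`|4^-1 - tau|^-1) => B.
have s0 : 0 < sg by rewrite sigma_powR powR_gt0.
have s1 : sg < 1.
  rewrite sigma_powR powRN invf_lt1 ?powR_gt0 //.
  have := @gt0_ltr_powR R a a_gt0 1 2; rewrite powR1; apply; rewrite ?nnegrE ?ler0n //.
  by rewrite ltr1n.
have [s Bs] : exists s, B <= sg^-1 ^+ s by apply: expr_unbounded; rewrite invf_gt1.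
have [n0 hn0] := ln_ge_near (a * s%:R).
exists s, (maxn 1 n0) => n; rewrite geq_max => /andP[n1 nn0].
have n0' : 0 < n%:R :> R by rewrite ltr0n.
have bE : b n = n%:R `^ a^-1 by rewrite /b (negbTE a2).
have b0 : 0 <= b n by rewrite bE powR_ge0.
have ba : b n `^ a = n%:R by rewrite bE -powRrM mulVf ?gt_eqF // powRr1.
have b1 : 1 <= b n.
  rewrite bE; apply: le_trans (_ : n%:R `^ 0 <= _); first by rewrite powRr0.
  apply: ler_powR; first by rewrite ler1n.
  by rewrite invr_ge0 ltW.
have [e /andP[e1 e2]] := dyadic_bracket b1.
have sgE k : sg ^+ k = ((2 ^+ k) `^ a)^-1.
  by rewrite sigma_powR powRN exprVn -(powR_mulrn k (powR_ge0 2 a)) -(powR_mulrn k (ler0n R 2)) powRAC.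
have g1 : 1 <= n%:R * sg ^+ e.
  rewrite sgE ler_pdivlMr ?powR_gt0 ?exprn_gt0 // mul1r -ba.
  by apply: ge0_ler_powR; rewrite ?nnegrE ?exprn_ge0 // ltW.
have g2 : n%:R * sg ^+ e.+1 <= 1.
  rewrite sgE ler_pdivrMr ?powR_gt0 ?exprn_gt0 // mul1r -ba.
  by apply: ge0_ler_powR; rewrite ?nnegrE ?exprn_ge0 // ltW.
have se : (s <= e)%N.
  have bs : 2 ^+ s <= b n.
    have h := hn0 n nn0.
    have l2s : ln (2 ^+ s : R) <= ln (b n).
      rewrite lnXn // bE ln_powR -[_ *+ s]mulr_natl ler_pdivlMl //.
      apply: le_trans h; rewrite mulrA; apply: ler_piMr; last exact: ln2_le.
      by rewrite mulr_ge0 // ltW.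
    by rewrite -ler_ln ?posrE ?exprn_gt0 // (lt_le_trans ltr01 b1).
  rewrite -ltnS -(ltn_exp2l _ _ (isT : 1 < 2)%N) -(ltr_nat R) !natrX.
  exact: le_lt_trans bs e2.
exists e; split => //; first by rewrite e1.
  apply: le_trans (ler_wpM2l (ltW n0') (scale_gap_le_pow e a2)) _.
  by rewrite mulrA ler_piMl // invr_ge0 ltW.
apply: le_trans Bs _.
apply: le_trans (_ : n%:R * sg ^+ (e - s) <= _); last first.
  by apply: ler_wpM2l; [exact: ltW|exact: scale_gap_ge_sigma].
have -> : sg ^+ (e - s) = sg ^+ e * sg^-1 ^+ s.
  by rewrite -{2}(subnK se) exprD exprVn mulfK // expf_neq0 // gt_eqF.
by rewrite mulrA ler_peMl // exprn_ge0 // invr_ge0 ltW.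
Qed.

End ScaleChoice.

(** * Displacement for a step profile *)

Section DisplacementAsymptotics.
Variables (R : realType) (d : nat) (alpha : R) (h : 'rV[R]_d -> R).
Hypothesis hP : step_profile alpha h.
Hypothesis alpha_gt0 : 0 < alpha.
Hypothesis d_gt0 : (0 < d)%N.
Local Notation p := (d%:R + alpha).
Variables (A c1 M0 : R) (m1 : nat).
Hypotheses (A_gt0 : 0 < A) (c1_gt0 : 0 < c1).
Hypothesis h_sup : forall x, h x <= A.
Hypothesis h_tail : forall x, 1 <= enorm x -> h x <= A * enorm x `^ (- p).
Hypothesis h_low : forall x, M0 <= enorm x -> c1 * enorm x `^ (- p) <= h x.
Hypothesis M0_m1 : M0 <= (2 ^ m1)%:R.
Variables (L : R) (l0 : nat).
Hypothesis L_ge1 : 1 <= L.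
Hypothesis L_l0 : L <= (2 ^ l0)%:R <= 2 * L.
Local Notation rho := (tail_ratio d alpha).
Local Notation b1 := (low_const d alpha c1 m1).
Local Notation H := (scaled h L).
Local Notation m0 := (m1 + l0)%N.
Local Notation raw := (profile_raw_kernel hP alpha_gt0 d_gt0 A_gt0 c1_gt0 h_sup h_tail
  h_low M0_m1 L_ge1 L_l0).

Let rho_gt0 : 0 < rho. Proof. exact: tail_ratio_gt0. Qed.
Let tau_lt1 : 2 ^+ d * rho < 1.
Proof.
rewrite tail_ratio_tau powRN invf_lt1 ?powR_gt0 //.
have := @gt0_ltr_powR R alpha alpha_gt0 1 2; rewrite powR1; apply; rewrite ?nnegrE ?ler0n //.
by rewrite ltr1n.
Qed.
Let b1_gt0 : 0 < b1. Proof. exact: low_const_gt0. Qed.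
Let H_ge0 z : 0 <= H z. Proof. exact: scaled_ge0 hP _ _. Qed.

Lemma torus_size J : exists T, T.+1 = (2 ^ J)%N.
Proof. by exists (2 ^ J).-1; rewrite prednK // expn_gt0. Qed.

Lemma raw_mass_gt0 T J M : T.+1 = (2 ^ J)%N -> (M + m0 + 5 <= J)%N ->
  0 < \sum_(x : 'rV['I_T.+1]_d) cut (2 ^ (M + m0 + 3)) H x.
Proof.
move=> TJ MJ; apply: lt_le_trans (raw_mass_low TJ d_gt0 MJ (raw TJ MJ)).
by rewrite mulr_gt0 ?mass_low_gt0 // exprn_gt0 // ltr0n expn_gt0.
Qed.

Lemma normalizer_finite :
  exists2 Z : R, 0 < Z & \esum_(y in [set: 'rV[int]_d]) (H y)%:E = Z%:E.
Proof.
have up : (\esum_(y in [set: 'rV[int]_d]) (H y)%:E <=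
    (mass_up d rho A * (2 ^ l0)%:R ^+ d)%:E)%E.
  apply: esum_le_mass => // m; have [T TJ] := torus_size (m + m0 + 5).
  have MJ := leqnn (m + m0 + 5).
  exists T, (2 ^ (m + m0 + 3))%N; split; last 1 first.
  - by rewrite lee_fin; exact: (raw_mass_up d_gt0 rho_gt0 tau_lt1 A_gt0 (raw TJ MJ)).
  - apply: leq_trans (ltnW (ltn_expl m (isT : 1 < 2)%N)) _.
    by rewrite leq_exp2l // -addnA leq_addr.
  - exact: (ran_small TJ MJ).
have [T TJ] := torus_size (0 + m0 + 5); have MJ := leqnn (0 + m0 + 5).
have S0 := raw_mass_gt0 TJ MJ.
have := mass_le_esum H_ge0 T (2 ^ (0 + m0 + 3)).
move: up; case: (\esum_(y in _) _) => [Z| |] // _.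
by rewrite lee_fin => /(lt_le_trans S0) Z0; exists Z.
Qed.

Local Notation A0 := (A / mass_low d b1 m1).
Local Notation A1 := (b1 / mass_up d rho A).
Local Notation vol := (((2 ^ l0)%:R : R) ^- d).
Variable theta : R.
Hypothesis h0 : h 0 = 0.
Hypothesis theta_gt2 : 2 < theta.
Hypothesis sigma_theta : (sigma d rho)^-1 `^ theta < 2 ^+ d.
Hypothesis spread : vol * mode_decay_const d rho A0 A1 m1 theta *
  small_const theta (gap_ratio d A1 m1) <= 1.

Let A0_gt0 : 0 < A0. Proof. by rewrite divr_gt0 // mass_low_gt0. Qed.
Let A1_gt0 : 0 < A1. Proof. by rewrite divr_gt0 // mass_up_gt0. Qed.
Let vol_E : vol * (2 ^ l0)%:R ^+ d = 1.
Proof. by rewrite mulVf // expf_neq0 // pnatr_eq0 -lt0n expn_gt0. Qed.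

Lemma cut0 T ran : cut ran H (0 : 'rV['I_T.+1]_d) = 0.
Proof.
rewrite /cut (_ : vlift 0 = 0) ?scaled_0 ?h0 ?mul0r //.
by apply/rowP => i; rewrite !mxE.
Qed.

Lemma horizon_exists n : exists M, (2 ^+ d)^-1 ^+ M <= phi theta 1 n.
Proof.
have x1 : 1 < 2 ^+ d :> R by rewrite exprn_egt1 ?ltr1n // -lt0n.
have f0 : 0 < phi theta 1 n by apply: phi_gt0.
have [M hM] := expr_unbounded (phi theta 1 n)^-1 x1; exists M.
by rewrite exprVn -[leRHS]invrK lef_pV2 ?posrE ?invr_gt0 // exprn_gt0 // exprn_gt0.
Qed.

(** The threshold on [n * W] is [8 * mode_const <= (1 + mode_floor * W * n) ^ theta], solved with
    the 1 dropped. *)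
Lemma small_mode W n : 0 <= W ->
  (8 * mode_const theta) `^ theta^-1 / mode_floor d A1 m1 <= n%:R * W ->
  4 * mode_const theta * phi theta (mode_floor d A1 m1 * W) n <= 2^-1.
Proof.
move=> W0; have mf0 := mode_floor_gt0 d m1 A1_gt0.
have mc2 := mode_const_ge2 theta_gt2.
have th0 : 0 < theta by apply: lt_trans theta_gt2.
set mc := mode_const theta in mc2 *; set mf := mode_floor _ _ _ in mf0 *.
have mc0 : 0 < mc by apply: lt_le_trans mc2.
rewrite ler_pdivrMr // => hB.
set x := 1 + mf * W * n%:R.
have x_ge : (8 * mc) `^ theta^-1 <= x.
  apply: le_trans hB _; rewrite /x (_ : mf * W * n%:R = n%:R * W * mf); last by ring.
  by rewrite lerDr.
have xp : 8 * mc <= x `^ theta.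
  have -> : 8 * mc = ((8 * mc) `^ theta^-1) `^ theta.
    by rewrite -powRrM mulVf ?gt_eqF // powRr1 // mulr_ge0 // ltW.
  apply: ge0_ler_powR; rewrite ?nnegrE ?powR_ge0 ?(ltW th0) //.
  by apply: le_trans x_ge; exact: powR_ge0.
have m80 : 0 < 8 * mc by rewrite mulr_gt0.
rewrite /phi -/x powRN ler_pdivrMr; last exact: lt_le_trans m80 xp.
by move: xp; move: (x `^ theta) => z; lra.
Qed.

Section Moments.
Variable r : R.
Hypotheses (r_gt0 : 0 < r) (r_lt : r < Num.min alpha 2).
Local Notation Phi := (fun z : 'rV[int]_d => enorm (lattice_pt R z) `^ r).
Local Notation b := (displacement_scale alpha).

Let r_le2 : r <= 2.
Proof. by apply: ltW; apply: lt_le_trans r_lt _; rewrite ge_min lexx orbT. Qed.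

Lemma Phi_le T (x : 'rV['I_T.+1]_d) :
  Phi (vlift x) <= d%:R `^ r * \sum_i (cabs (x 0 i))%:R `^ r.
Proof.
apply: le_trans (enorm_powR_le _ r_gt0) _; rewrite le_eqVlt; apply/orP; left; apply/eqP.
by congr (_ * _); apply: eq_bigr => i _; rewrite lattice_pt_coord mxE absz_lift1.
Qed.

Lemma Phi_ge T (x : 'rV['I_T.+1]_d) i : (cabs (x 0 i))%:R `^ r <= Phi (vlift x).
Proof.
apply: ge0_ler_powR; rewrite ?nnegrE ?enorm_ge0 ?(ltW r_gt0) //.
by apply: le_trans (enorm_coord _ i); rewrite lattice_pt_coord mxE absz_lift1.
Qed.

Let r_sigma : 2 `^ r * sigma d rho < 1.
Proof.
rewrite /sigma tail_ratio_tau sigma_powR powRN ltr_pdivrMr ?powR_gt0 // mul1r.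
rewrite -subr_gt0.
have -> : 2 `^ Num.min alpha 2 = 2 `^ r * 2 `^ (Num.min alpha 2 - r) :> R.
  by rewrite -powRD ?pnatr_eq0 ?implybT //; congr (_ `^ _); ring.
rewrite -[X in _ - X]mulr1 -mulrBr mulr_gt0 ?powR_gt0 // subr_gt0.
have q0 : 0 < Num.min alpha 2 - r by rewrite subr_gt0.
have := @gt0_ltr_powR R _ q0 1 2; rewrite powR1; apply; rewrite ?nnegrE ?ler0n //.
by rewrite ltr1n.
Qed.

Lemma displacement_torus : exists Ku Kl : R, exists n0 : nat, [/\ 0 <= Ku, 0 < Kl &
  forall n, (n0 <= n)%N -> 0 < b n /\ forall m, exists T ran,
  [/\ (m <= ran)%N, (2 * (n * ran) < T.+1)%N,
    0 < \sum_(x : 'rV['I_T.+1]_d) cut ran H x &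
    let c := saw_count (fun x : 'rV['I_T.+1]_d => cut ran H x / \sum_(y : 'rV['I_T.+1]_d) cut ran H y) n in
    [/\ 0 < \sum_x c x,
      \sum_x Phi (vlift x) * c x <= Ku * b n `^ r * \sum_x c x &
      \sum_x c x <= Kl / b n `^ r * \sum_x Phi (vlift x) * c x]]].
Proof.
have [Q hQ] := scale_choice alpha_gt0.
have [s [n0 hn]] := hQ ((8 * mode_const theta) `^ theta^-1 / mode_floor d A1 m1).
pose MC := moment_const (2 `^ r) (sigma d rho) (2 * gap_const theta * gap_up d rho A0 l0) Q.
(* The exponent [s + 4] collects [8 = 2 ^ 3] from [moment_low], [b n < 2 ^ e.+1], and the descent by
   [s] scales. *)
exists (d%:R `^ r * (d%:R * `|MC|)), (4 * (2 ^+ (s + 4)) `^ r), n0.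
split; first by rewrite !mulr_ge0 ?powR_ge0.
  by rewrite mulr_gt0 // powR_gt0 // exprn_gt0.
move=> n nn0; have [e [se /andP[be1 be2] nW nB]] := hn n nn0.
have b0 : 0 < b n by apply: lt_le_trans be1; rewrite exprn_gt0.
split => // m.
have [Mn hMn] := horizon_exists n.
(* [m] makes the cutoffs exhaust the lattice, [Mn] meets the horizon condition at time [n], and [e]
   makes the frequency in use a resolved one. *)
pose M := (m + Mn + e)%N.
have hM : (2 ^+ d)^-1 ^+ M <= phi theta 1 n.
  apply: le_trans hMn; apply: ler_wiXn2l; rewrite ?invr_ge0 ?exprn_ge0 //.
    by rewrite invf_le1 ?exprn_gt0 // exprn_ege1 // ler1n.
  by rewrite /M; clear; lia.
(* The [n] additional doublings prevent wrapping, since [2 * n < 2 ^ (2 + n)]. *)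
have [T TJ] := torus_size (M + m0 + 5 + n).
have MJ : (M + m0 + 5 <= M + m0 + 5 + n)%N by rewrite leq_addr.
have S0 := raw_mass_gt0 TJ MJ.
have DP := raw_normalize TJ d_gt0 rho_gt0 tau_lt1 A_gt0 b1_gt0 MJ (raw TJ MJ) (cut0 _ _).
exists T, (2 ^ (M + m0 + 3))%N; split => //.
- apply: leq_trans (ltnW (ltn_expl m (isT : 1 < 2)%N)) _.
  by rewrite leq_exp2l // /M; clear; lia.
- rewrite TJ (_ : (M + m0 + 5 + n = (M + m0 + 3) + (2 + n))%N); last by clear; lia.
  rewrite mulnA mulnC (expnD 2 (M + m0 + 3)) ltn_pmul2l ?expn_gt0 //.
  have := ltn_expl n (isT : 1 < 2)%N; rewrite expnD; clear; lia.
set D := fun x : 'rV['I_T.+1]_d => _; move=> c.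
have [C0 _ _] := torus_modes TJ d_gt0 rho_gt0 tau_lt1 A0_gt0 A1_gt0 vol_E MJ DP
  theta_gt2 sigma_theta hM spread (leqnn n).
have up i := moment_up (e := e) (Q := Q) TJ d_gt0 rho_gt0 tau_lt1 A0_gt0 A1_gt0 vol_E MJ DP
  theta_gt2 sigma_theta hM spread i (leqnn n) r_gt0 r_sigma.
have lo i := moment_low (e := (e - s)%N) TJ d_gt0 rho_gt0 tau_lt1 A0_gt0 A1_gt0 vol_E MJ DP
  theta_gt2 sigma_theta hM spread i (leqnn n) r_gt0 r_le2.
rewrite -/D -/(c _) in C0.
have c0 x : 0 <= c x.
  by apply: wsum_ge0 => //; exact: (tk_ge0 DP).
have be r' : 2 ^+ r' = 2 `^ r'%:R :> R by rewrite powR_mulrn.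
split => //.
  apply: le_trans (_ : \sum_(x : 'rV['I_T.+1]_d) d%:R `^ r * \sum_i ((cabs (x 0 i))%:R `^ r * c x) <= _).
    apply: ler_sum => x _; rewrite -mulr_suml mulrA.
    by apply: ler_wpM2r => //; exact: Phi_le.
  rewrite -mulr_sumr exchange_big /= -!mulrA; apply: ler_wpM2l; first exact: powR_ge0.
  apply: le_trans (_ : \sum_(i < d) `|MC| * (b n `^ r * \sum_x c x) <= _).
    apply: ler_sum => i _; have := up i; rewrite tail_ratio_tau => /(_ nW) hu.
    apply: le_trans hu _; rewrite -/MC -mulrA.
    apply: le_trans (_ : `|MC| * ((2 `^ r) ^+ e * \sum_x c x) <= _).
      apply: ler_wpM2r (ler_norm _); rewrite mulr_ge0 ?exprn_ge0 ?powR_ge0 //.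
      exact: ltW.
    apply: ler_wpM2l => //; apply: ler_wpM2r; first exact: ltW.
    rewrite -(powR_mulrn e (powR_ge0 2 r)) powRAC -be.
    by apply: ge0_ler_powR; rewrite ?nnegrE ?exprn_ge0 ?(ltW r_gt0) // ltW.
  by rewrite sumr_const card_ord mulr_natl.
pose i0 := Ordinal d_gt0.
have W0 : 0 <= scale_gap (2 ^+ d * rho) (e - s).
  by apply: ltW; apply: scale_gap_gt0; rewrite mulr_gt0 // exprn_gt0.
have eM : (e - s <= M)%N by rewrite /M; clear; lia.
have := lo i0 eM (small_mode W0 _); rewrite tail_ratio_tau => /(_ nB) hl.
apply: le_trans hl _.
apply: le_trans (_ : 4 * (8 / 2 ^+ (e - s + m0 + 1)) `^ r * \sum_(x : 'rV['I_T.+1]_d) Phi (vlift x) * c x <= _).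
  apply: ler_wpM2l; first by rewrite mulr_ge0 ?powR_ge0.
  by apply: ler_sum => x _; apply: ler_wpM2r => //; exact: Phi_ge.
apply: ler_wpM2r.
  by apply: sumr_ge0 => x _; rewrite mulr_ge0 ?powR_ge0.
rewrite -[leRHS]mulrA; apply: ler_wpM2l => //.
have f0 k : 0 < 2 ^+ k :> R by rewrite exprn_gt0.
rewrite ler_pdivlMr ?powR_gt0 // -powRM ?divr_ge0 ?(ltW b0) ?(ltW (f0 _)) //.
apply: ge0_ler_powR; rewrite ?nnegrE ?mulr_ge0 ?invr_ge0 ?(ltW b0) ?(ltW (f0 _)) ?(ltW r_gt0) //.
rewrite mulrAC ler_pdivrMr // -exprD.
apply: le_trans (_ : 8 * 2 ^+ e.+1 <= _); first by apply: ler_wpM2l => //; exact: ltW.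
have -> : 8 = 2 ^+ 3 :> R by rewrite -natrX.
rewrite -exprD; apply: ler_weXn2l; first by rewrite ler1n.
by move: se; clear; lia.
Qed.

Lemma displacement_asymp : asymp (mean_displacement (step_distr h L) r) b.
Proof.
have [Z Z0 ZE] := normalizer_finite.
have SD : step_distr h L = (fun z => H z / Z).
  by apply/funext => z; rewrite /step_distr -[Z]/(fine Z%:E) -ZE.
have [Ku [Kl [n0 [Ku0 Kl0 TB]]]] := displacement_torus.
pose lo := Kl^-1 `^ r^-1.
exists lo, (Num.max lo (Ku `^ r^-1)); split.
- by rewrite powR_gt0 // invr_gt0.
- by rewrite le_max lexx.
exists (maxn 1 n0) => // n /=; rewrite geq_max => /andP[n1 nn0].
have [bn0 TBn] := TB n nn0; have br0 := powR_gt0 r bn0.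
have P0 (x : 'rV[int]_d) : 0 <= Phi x by exact: powR_ge0.
have Cu0 : 0 <= Ku * b n `^ r by rewrite mulr_ge0 // ltW.
have Cl0 : 0 <= Kl / b n `^ r by rewrite divr_ge0 // ltW.
have [nu [de [numE denE de0 up low]]] := moment_comparison n1 H_ge0 Z0 ZE P0 Cu0 Cl0 TBn.
rewrite SD /mean_displacement numE denE inver gt_eqF // -EFinM poweR_EFin !lee_fin.
have root k : 0 <= k -> k `^ r^-1 * b n = (k * b n `^ r) `^ r^-1.
  move=> k0; rewrite powRM ?(ltW br0) //; congr (_ * _).
  by rewrite -powRrM mulfV ?gt_eqF // powRr1 // ltW.
have x_up : nu / de <= Ku * b n `^ r by rewrite ler_pdivrMr.
have x_lo : Kl^-1 * b n `^ r <= nu / de.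
  rewrite ler_pdivlMr // -ler_pdivlMl ?mulr_gt0 ?invr_gt0 //.
  by rewrite invfM invrK mulrC; move: low; rewrite mulrC.
have ri : 0 <= r^-1 by rewrite invr_ge0 ltW.
have k0 : 0 <= Kl^-1 * b n `^ r by rewrite mulr_ge0 ?invr_ge0 // ltW.
have x0 := le_trans k0 x_lo.
apply/andP; split.
  rewrite root ?invr_ge0 ?(ltW Kl0) //.
  by apply: ge0_ler_powR; rewrite ?nnegrE.
apply: le_trans (_ : Ku `^ r^-1 * b n <= _); last first.
  by apply: ler_wpM2r; [exact: ltW|rewrite le_max lexx orbT].
by rewrite root //; apply: ge0_ler_powR; rewrite ?nnegrE.
Qed.

End Moments.

End DisplacementAsymptotics.

Theorem theorem1p4 (R : realType) (d : nat) (alpha : R) (h : 'rV[R]_d -> R)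
    (alpha_gt0 : 0 < alpha) (d_ge1 : (1 <= d)%N)
    (d_gt : 2 * Num.min alpha 2 < d%:R)
    (h_profile : step_profile alpha h)
    (D0 : forall L : R, 1 <= L -> step_distr h L 0 = 0) :
  exists2 L0 : R, 1 <= L0 & forall L : R, L0 <= L ->
    forall r : R, 0 < r -> r < Num.min alpha 2 ->
    asymp (mean_displacement (step_distr h L) r)
      (fun n : nat => if alpha == 2 then (n%:R * ln n%:R) `^ 2^-1
                      else n%:R `^ (Num.min alpha 2)^-1).
Proof.
have [A [c1 [M0 [[A0 c0] M00 h_sup h_tail h_low]]]] := profile_bounds h_profile alpha_gt0.
have [m1 M0_m1] : exists m1, M0 <= (2 ^ m1)%:R.
  have [m1 hm] := expr_unbounded M0 (ltr1n R 2 : 1 < 2).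
  by exists m1; rewrite natrX.
set a := Num.min alpha 2 in d_gt *.
have a0 : 0 < a by rewrite lt_min alpha_gt0 ltr0n.
(* The midpoint of the interval that [2 * a < d] leaves open. *)
pose theta := (2 + d%:R / a) / 2.
have da : 2 < d%:R / a by rewrite ltr_pdivlMr.
have theta_gt2 : 2 < theta by rewrite /theta; lra.
have rho0 := tail_ratio_gt0 d alpha.
have sE : sigma d (tail_ratio d alpha) = 2 `^ (- a).
  by rewrite /sigma tail_ratio_tau sigma_powR.
have sigma_theta : (sigma d (tail_ratio d alpha))^-1 `^ theta < 2 ^+ d.
  rewrite sE -powRN opprK -powRrM -powR_mulrn //.
  have e : d%:R = a * theta + (d%:R - 2 * a) / 2 by rewrite /theta; field; rewrite gt_eqF.
  have q0 : 0 < (d%:R - 2 * a) / 2 by rewrite divr_gt0 // subr_gt0.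
  rewrite [X in _ < _ `^ X]e powRD ?pnatr_eq0 ?implybT // ltr_pMr ?powR_gt0 //.
  have := @gt0_ltr_powR R _ q0 1 2; rewrite powR1; apply; rewrite ?nnegrE ?ler0n //.
  by rewrite ltr1n.
pose b1 := low_const d alpha c1 m1.
pose K := mode_decay_const d (tail_ratio d alpha) (A / mass_low d b1 m1)
  (b1 / mass_up d (tail_ratio d alpha) A) m1 theta *
  small_const theta (gap_ratio d (b1 / mass_up d (tail_ratio d alpha) A) m1).
(* [D 0 = 0] at one range is enough, because the normalizer is finite and positive; [L = 1] is
   taken. *)
have h0 : h 0 = 0.
  have [l0 hl] := pow2_bracket (lexx (1 : R)).
  have [Z Z0 ZE] := normalizer_finite h_profile alpha_gt0 d_ge1 A0 c0 h_sup h_tail h_low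
    M0_m1 (lexx 1) hl.
  have := D0 1 (lexx 1); rewrite /step_distr.
  have -> : \esum_(y in [set: 'rV[int]_d]) (h (1^-1 *: lattice_pt R y))%:E = Z%:E by [].
  move/eqP; rewrite mulf_eq0 invr_eq0 (gt_eqF Z0) orbF => /eqP.
  by rewrite /lattice_pt raddf0 scaler0.
(* [K] does not depend on [L] or [l0]: the range enters the smallness condition only through [vol],
   which is at most [1 / L] because [2 ^ l0 >= L] and [d >= 1]. *)
exists (Num.max 1 K); first by rewrite le_max lexx.
move=> L; rewrite ge_max => /andP[L1 LK] r r0 ra.
have [l0 hl] := pow2_bracket L1.
apply: (displacement_asymp h_profile alpha_gt0 d_ge1 A0 c0 h_sup h_tail h_low M0_m1 L1 hl
  h0 theta_gt2 sigma_theta) => //.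
rewrite -mulrA -/b1 -/K; have /andP[Ll _] := hl.
have l1 : 1 <= (2 ^ l0)%:R :> R := le_trans L1 Ll.
have ld : (2 ^ l0)%:R <= (2 ^ l0)%:R ^+ d :> R.
  by rewrite -[leLHS]expr1; apply: ler_weXn2l.
rewrite mulrC ler_pdivrMr ?mul1r; last exact: lt_le_trans (lt_le_trans ltr01 l1) ld.
exact: le_trans LK (le_trans Ll ld).
Qed.
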